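(* Let $\mathcal{K}$ be a stratum, and let $X$ be a homogeneous locally compact, locally connected metric space. Let $\mathcal{C}$ be one of the following four classes of metrizable spaces: the class $\mathcal{WID}$ of weakly infinite-dimensional spaces; the class $\mathbf{C}$ of $C$-spaces; the class $\mathcal{D}_{\mathcal{K}}^{n-2}$ of spaces $Y$ with $D_{\mathcal{K}}(Y)\le n-2$, for an integer $n$; the class $\mathcal{D}_{\mathcal{K}}^{<\infty}$ of strongly countable $D_{\mathcal{K}}$-dimensional spaces. Suppose $U$ is a region in $X$ with $U\notin\mathcal{C}$; in the case $\mathcal{C}=\mathcal{D}_{\mathcal{K}}^{n-2}$ assume additionally that $D_{\mathcal{K}}(U)=n$. Then $U$ is a Mazurkiewicz manifold with respect to $\mathcal{C}$.
   Context: All spaces considered are metrizable unless said otherwise. A space $X$ is homogeneous if for all $x,y\in X$ there is a homeomorphism $h:X\to X$ with $h(x)=y$. A region in $X$ is an open connected subset of $X$. A continuum is a compact connected (metric) space. For a CW-complex $K$ and a space $X$, $K\in AE(X)$ means that $K$ is an absolute extensor for $X$: every continuous map from a closed subset of $X$ to $K$ extends to a continuous map from $X$ to $K$. Let $\mathbb{I}=[0,1]$. A sequence $\mathcal{K}=\{K_0,K_1,\dots\}$ of CW-complexes is called a stratum (for a dimension theory) if for each space $X$ admitting a perfect map onto a metrizable space and each $n\ge 0$, $K_n\in AE(X)$ implies both $K_{n+1}\in AE(X\times\mathbb{I})$ and $K_{n+j}\in AE(X)$ for all $j\ge 0$. Given a stratum $\mathcal{K}$, the dimension function $D_{\mathcal{K}}$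 on metrizable spaces is defined by: $D_{\mathcal{K}}(X)=-1$ iff $X=\emptyset$; $D_{\mathcal{K}}(X)\le n$ if $K_n\in AE(X)$, for $n\ge 0$; if $D_{\mathcal{K}}(X)\le n$ and $K_m\notin AE(X)$ for all $m<n$, then $D_{\mathcal{K}}(X)=n$ (for nonempty $X$); $D_{\mathcal{K}}(X)=\infty$ if $D_{\mathcal{K}}(X)\le n$ holds for no $n$. A metrizable space is strongly countable $D_{\mathcal{K}}$-dimensional (i.e. belongs to $\mathcal{D}_{\mathcal{K}}^{<\infty}$) if it can be represented as a countable union of closed subsets each of which has finite dimension $D_{\mathcal{K}}$. A metrizable space $X$ is weakly infinite-dimensional if for every sequence $(A_i,B_i)_{i\ge1}$ of pairs of disjoint closed subsets of $X$ there are partitions $L_i$ in $X$ between $A_i$ and $B_i$ (closed sets $L_i$ such that $X\setminus L_i$ is a union of two disjoint open sets, one containing $A_i$ and the other containing $B_i$) with $\bigcap_{i=1}^\infty L_i=\emptyset$. A metrizable space $X$ is a $C$-space if for every sequence $(\mathcal{G}_i)_{i\ge 1}$ of open covers of $X$ there is a sequence $(\mathcal{H}_i)_{i\ge1}$ of families of pairwise disjoint open subsets of $X$ such that each member of $\mathcal{H}_i$ is contained in a member of $\mathcal{G}_i$ and $\bigcup_{i=1}^\infty\mathcal{H}_i$ covers $X$. A metrizable space $Y$ is a Mazurkiewicz manifold with respect to a class $\mathcal{C}$ if for every two closed, disjoint subsets $Y_0,Y_1\subset Y$, both having non-empty interiors in $Y$, and every $F_\sigma$-subset $F\subset Y$ with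 $F\in\mathcal{C}$, there exists a continuum in $Y\setminus F$ joining $Y_0$ and $Y_1$ (i.e. intersecting both $Y_0$ and $Y_1$). *)

(* Defs.v *)
From HB Require Import structures.
From mathcomp Require Import all_boot all_order all_algebra.
From mathcomp Require Import all_classical all_reals all_analysis.
From mathcomp Require Import borel_hierarchy.

Set Implicit Arguments.
Unset Strict Implicit.
Unset Printing Implicit Defensive.

Import Order.TTheory GRing.Theory Num.Theory.
Import numFieldNormedType.Exports.

Local Open Scope classical_set_scope.
Local Open Scope ring_scope.

(* A subset [A] of a space, when used as a space in its own right, is the
   sigma type [set_type A] with the initial topology of the inclusion; it may be
   empty ([topologicalType] is not pointed). *)

Definition homeomorphism (X Y : topologicalType) (h : X -> Y) : Prop :=
  continuous h /\
  exists2 g : Y -> X, continuous g & cancel h g /\ cancel g h.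

Definition homogeneous (X : topologicalType) : Prop :=
  forall x y : X, exists2 h : X -> X, homeomorphism h & h x = y.

Definition locally_connected (X : topologicalType) : Prop :=
  forall (x : X) (U : set X), nbhs x U ->
    exists V : set X, [/\ open V, connected V, V x & V `<=` U].

Definition region (X : topologicalType) (U : set X) : Prop :=
  open U /\ connected U.

Definition continuum (X : topologicalType) (Z : set X) : Prop :=
  compact Z /\ connected Z.

Definition metrizable (R : realType) (X : topologicalType) : Prop :=
  exists d : X -> X -> R,
    [/\ forall x y, 0 <= d x y /\ (d x y = 0 <-> x = y),
        forall x y, d x y = d y x,
        forall x y z, d x z <= d x y + d y z
      & forall (x : X) (U : set X),
          nbhs x U <-> exists2 e, 0 < e & [set y | d x y < e] `<=` U].

(* As is customary, perfect maps have Hausdorff domains. *)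
Definition perfect_map (X M : topologicalType) (f : X -> M) : Prop :=
  [/\ hausdorff_space X,
      continuous f,
      forall A : set X, closed A -> closed (f @` A)
    & forall y : M, compact (f @^-1` [set y])].

Section cw_complexes.
Variable R : realType.

Definition sqnorm (n : nat) (x : 'rV[R]_n) : R := \sum_(i < n) x ord0 i ^+ 2.

Definition disk (n : nat) : set 'rV[R]_n :=
  [set x | sqnorm x <= 1].
Arguments disk : clear implicits.

Definition disk_boundary (n : nat) : set (set_type (disk n)) :=
  [set x | sqnorm (set_val x) = 1].
Arguments disk_boundary : clear implicits.

Definition disk_interior (n : nat) : set (set_type (disk n)) :=
  [set x | sqnorm (set_val x) < 1].
Arguments disk_interior : clear implicits.

(* Whitehead's definition: the cells are indexed by [I], the cell [i] has
   dimension [dim i] and characteristic map [Phi i]. *)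
Definition cw_structure (K : topologicalType) (I : Type) (dim : I -> nat)
    (Phi : forall i, set_type (disk (dim i)) -> K) : Prop :=
  let cell i := Phi i @` disk_interior (dim i) in
  [/\ forall i, continuous (Phi i),
      forall i, exists2 g : K -> set_type (disk (dim i)),
        {within cell i, continuous g} &
        forall x, disk_interior (dim i) x -> g (Phi i x) = x,
      trivIset [set: I] cell /\ \bigcup_(i in [set: I]) cell i = [set: K],
      forall i, exists2 J : set I,
        finite_set J /\ (forall j, J j -> (dim j < dim i)%N) &
        Phi i @` disk_boundary (dim i) `<=` \bigcup_(j in J) cell j
    & forall A : set K, closed A <-> forall i, closed (Phi i @^-1` A)].

Definition cw_complex (K : topologicalType) : Prop :=
  hausdorff_space K /\
  exists (I : Type) (dim : I -> nat)
    (Phi : forall i, set_type (disk (dim i)) -> K), cw_structure Phi.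

End cw_complexes.

Definition absolute_extensor (K X : topologicalType) : Prop :=
  forall (A : set X) (f : set_type A -> K), closed A -> continuous f ->
    exists2 g : X -> K, continuous g & forall a : set_type A, g (set_val a) = f a.

Definition stratum (R : realType) (K : nat -> topologicalType) : Prop :=
  (forall n, cw_complex R (K n)) /\
  forall (X M : topologicalType) (p : X -> M),
    metrizable R M -> perfect_map p -> range p = [set: M] ->
    forall n, absolute_extensor (K n) X ->
      absolute_extensor (K n.+1) (X * set_type `[0 : R, 1])%type /\
      forall j, absolute_extensor (K (n + j)%N) X.

Definition stratum_dim (K : nat -> topologicalType) (X : topologicalType) :
    \bar int :=
  if pselect ([set: X] = set0) then (-1)%:E
  else if pselect (exists n, `[< absolute_extensor (K n) X >]) is left h
    then (Posz (ex_minn h))%:E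
  else +oo%E.

Definition partition_between (X : topologicalType) (A B L : set X) : Prop :=
  closed L /\
  exists V W : set X,
    [/\ open V, open W, V `&` W = set0, ~` L = V `|` W & A `<=` V /\ B `<=` W].

Definition weakly_infinite_dimensional (R : realType) (X : topologicalType) :
    Prop :=
  metrizable R X /\
  forall A B : nat -> set X,
    (forall i, [/\ closed (A i), closed (B i) & A i `&` B i = set0]) ->
    exists2 L : nat -> set X,
      (forall i, partition_between (A i) (B i) (L i)) &
      \bigcap_i L i = set0.

Definition C_space (R : realType) (X : topologicalType) : Prop :=
  metrizable R X /\
  forall G : nat -> set (set X),
    (forall i, (forall O, G i O -> open O) /\ \bigcup_(O in G i) O = [set: X]) ->
    exists2 H : nat -> set (set X),
      (forall i,
        [/\ forall O, H i O -> open O,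
            trivIset (H i) id
          & forall O, H i O -> exists2 P, G i P & O `<=` P]) &
      \bigcup_i \bigcup_(O in H i) O = [set: X].

Definition stratum_dim_le (R : realType) (K : nat -> topologicalType) (m : int)
    (X : topologicalType) : Prop :=
  metrizable R X /\ (stratum_dim K X <= m%:E)%E.

Definition strongly_countable_dim (R : realType) (K : nat -> topologicalType)
    (X : topologicalType) : Prop :=
  metrizable R X /\
  exists F : nat -> set X,
    [/\ forall i, closed (F i), \bigcup_i F i = [set: X]
      & forall i, (stratum_dim K (set_type (F i)) < +oo)%E].

Definition mazurkiewicz_manifold (C : topologicalType -> Prop)
    (Y : topologicalType) : Prop :=
  forall Y0 Y1 : set Y,
    closed Y0 -> closed Y1 -> Y0 `&` Y1 = set0 ->
    Y0° !=set0 -> Y1° !=set0 ->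
    forall F : set Y, Fsigma F -> C (set_type F) ->
      exists Z : set Y,
        [/\ continuum Z, Z `<=` ~` F, Z `&` Y0 !=set0 & Z `&` Y1 !=set0].

(* Main.v *)
(** Call a compactum [F] thin if through every point of [X] there are arbitrarily
    small compacta [M] that no homeomorphic copy of [F] separates or covers.

    If a thin [F] separated a region into [V] and [W], take [x] in the closures
    of both and a small such [M] through [x], meeting [V] say.  By a weak form of
    Effros' theorem (a Baire category argument) a homeomorphism close to the
    identity on [M] moves [x] into [W] and keeps a point of [M] in [V], so a copy
    of [M] is separated by [F].  Hence a region minus a thin set is a region, and
    by local connectedness a decreasing sequence of regions with compact closures
    produces a continuum avoiding countably many thin sets.

    Thinness comes from minimality.  A compactum outside the class fails some
    test: an essential sequence of pairs, a sequence of covers, or a map to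
    [K_(n+1)] that does not extend.  A minimal compactum failing the test is not
    separated by small sets, because solutions on the two sides can be
    amalgamated.  Minimal compacta of decreasing diameters shrink to a point, and
    homogeneity moves that point anywhere.  Amalgamating extensions over a set [F]
    with [K_n] in AE([F]) uses [K_(n+1)] in AE([F * I]) and the fact that CW
    complexes are neighbourhood extensors for compacta, proved by attaching cells
    one at a time. *)
Require Import Defs.
From HB Require Import structures.
From mathcomp Require Import finmap.
From mathcomp Require Import all_boot all_order all_algebra.
From mathcomp Require Import all_classical all_reals all_analysis.
From mathcomp Require Import borel_hierarchy.
From mathcomp Require Import ring lra.

Set Implicit Arguments.
Unset Strict Implicit.
Unset Printing Implicit Defensive.

Import Order.TTheory GRing.Theory Num.Theory.
Import numFieldNormedType.Exports.

Local Open Scope classical_set_scope.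
Local Open Scope ring_scope.

(** * Compact exhaustions of regions *)

(** Compactness is forced by the search for minimal failing sets: a test solved on a compactum stays
    solved on a neighbourhood, so failure survives intersections of chains. Both ends of the
    argument therefore have to be brought down to compacta. The set to be avoided is an [Fsigma] in
    a sigma-compact region, hence covered by countably many compacta. The failure of the region is
    pushed down to a single compactum: by a countable sum theorem in the two covering-type classes
    and for strong countable dimension, and by extending maps step by step along an exhaustion in
    the case of a single dimension bound.

    The gap of two in the dimension bound is spent as follows. If [K_m] is an extensor for [F] with
    [m <= n - 2], amalgamation over [F] costs one degree and works for maps to [K_(m+1)]; since
    [m + 1 < n], such maps still fail to extend somewhere in the region.

    The complexes need be neither metrizable nor locally finite, so closeness is never measured in
    [K], only in the domain and in the disks of the cells. *)

Lemma bigcup_seq_cons (I : eqType) (T : Type) (x : I) (s : seq I) (F : I -> set T) :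
  \bigcup_(y in [set` x :: s]) F y = F x `|` \bigcup_(y in [set` s]) F y.
Proof.
apply/seteqP; split=> z.
  by move=> [y /=]; rewrite inE => /orP[/eqP->|ys] Fz; [left|right; exists y].
by move=> [Fz|[y /= ys Fz]]; [exists x|exists y] => //=; rewrite inE ?eqxx ?ys ?orbT.
Qed.

Lemma compact_cover_compact (T : topologicalType) (A : set T) :
  compact A -> cover_compact A.
Proof.
have [->|/set0P[a _] cA] := eqVneq A set0.
  by move=> _ I D f _ _; exists fset0 => // x.
(* A point of [A] makes [T] a pointed space, in which compactness by filters and by covers is
   compared; empty [A] was treated apart. *)
pose pT : ptopologicalType := HB.pack_for ptopologicalType T (isPointed.Build (T : Type) a).
have : @compact pT A by exact: cA.
by rewrite (@compact_cover pT).
Qed.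

Lemma compact_bigcup_nat (T : topologicalType) (Z : set T) (O : nat -> set T) :
  compact Z -> (forall i, open (O i)) -> Z `<=` \bigcup_i O i ->
  exists k, Z `<=` \bigcup_(i < k) O i.
Proof.
move=> /compact_cover_compact cZ oO ZO.
have [//|D _ ZD] := cZ nat [set: nat] O (fun i _ => oO i).
exists (\max_(i <- finmap.enum_fset D) i).+1 => z /ZD[i /= iD Oiz].
by exists i => //=; rewrite ltnS; exact: (@leq_bigmax_seq _ _ xpredT id).
Qed.

Lemma finite_net (R : realType) (X : pseudoMetricType R) (Z : set X) (e : R) :
  compact Z -> 0 < e ->
  exists l : seq X, (forall x, x \in l -> Z x) /\
    (forall z, Z z -> exists2 x, x \in l & ball x e z).
Proof.
move=> /compact_cover_compact cZ e0.
have [| |D DZ ZD] := cZ X Z (fun x => (ball x e)°).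
- by move=> i _; exact: open_interior.
- move=> z Zz; exists z => //; exact: nbhsx_ballx.
exists (finmap.enum_fset D); split=> [x xD|z /ZD[x /= xD bxz]].
  by apply/set_mem/DZ.
by exists x => //; exact: interior_subset bxz.
Qed.

Lemma compact_dense_sequence (R : realType) (X : pseudoMetricType R) (Z : set X) :
  compact Z -> Z !=set0 ->
  exists s : nat -> X, (forall n, Z (s n)) /\
    (forall z e, Z z -> 0 < e -> exists n, ball z e (s n)).
Proof.
move=> cZ [z0 Zz0].
have /choice[l lP] : forall k : nat, exists l : seq X,
    (forall x, x \in l -> Z x) /\
    (forall z, Z z -> exists2 x, x \in l & ball x k.+1%:R^-1 z).
  by move=> k; exact: (finite_net (e := k.+1%:R^-1)).
(* [n] codes a pair [(k, i)] and stands for the [i]-th point of the net of mesh [1/(k+1)]; [z0]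
   fills the indices without meaning. *)
pose s n : X := if unpickle n is Some ki then nth z0 (l ki.1) ki.2 else z0.
exists s; split=> [n|z e Zz e0].
  rewrite /s; case: unpickle => // -[k i] /=.
  have [ilt|ige] := ltnP i (size (l k)).
    by apply: (lP k).1; exact: mem_nth.
  by rewrite nth_default.
have [k ke] : exists k : nat, k.+1%:R^-1 < e.
  exists (Num.truncn e^-1); rewrite invf_plt ?posrE//.
  exact: truncnS_gt.
have [x xl bxz] := (lP k).2 z Zz.
exists (pickle (k, index x (l k))); rewrite /s pickleK /= nth_index//.
by apply: ball_sym; apply: le_ball bxz; exact: ltW.
Qed.

Lemma metric_ball_open (R : realType) (X : metricType R) (x : X) (e : R) :
  open (ball x e).
Proof.
rewrite openE => y; rewrite {1}ballEmdist/= => xye.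
apply/nbhs_ballP; exists (e - mdist x y) => /=; first by rewrite subr_gt0.
move=> z; rewrite !ballEmdist/= ltrBrDl.
by apply: le_lt_trans; exact: metric_triangle.
Qed.

Section exhaustion.
Variables (R : realType) (X : metricType R).
Hypothesis lcX : locally_compact [set: X].

Lemma compact_closed_ball (V : set X) (x : X) : open V -> V x ->
  exists2 e : R, 0 < e & compact (closure (ball x e)) /\ closure (ball x e) `<=` V.
Proof.
move=> oV Vx.
have [B xB [cB clB]] : exists2 B, nbhs x B & compact B /\ closed B.
  have : compact_near (within [set: X] (nbhs x)) := @lcX x I.
  by rewrite withinET => -[B BP [? ?]]; exists B.
have : nbhs x (B `&` V) by apply: filterI => //; exact: open_nbhs_nbhs.
move=> /uniform_regular[C xC CBV].
have /nbhs_ballP[e /= e0 eC] := xC.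
exists e => //; have eBV := subset_trans (closureS eC) CBV.
split; last by move=> y /eBV[].
by apply: subclosed_compact cB _; [exact: closed_closure|move=> y /eBV[]].
Qed.

(** [X] need not be separable, but a connected locally compact metric space is sigma-compact: from
    one point, the dense sequences of compact balls around points already reached generate a
    countable set whose closure is clopen in [V]. The interiors of countably many of these balls
    cover [V]. *)
Lemma region_exhaustion (V : set X) : region V ->
  exists L : nat -> set X,
    [/\ forall k, compact (L k), forall k, L k `<=` V
      & forall Z, compact Z -> Z `<=` V -> exists k, Z `<=` L k].
Proof.
move=> [oV cV]; have [->|/set0P[x0 Vx0]] := eqVneq V set0.
  exists (fun=> set0); split=> [k|k|Z _ Z0]; first exact: compact0.
    by [].
  by exists 0%N.
pose cb (x : X) (q : nat) := closure (ball x (q.+1%:R^-1 : R)).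
pose good (x : X) (q : nat) := compact (cb x q) /\ cb x q `<=` V.
have cbc x q : cb x q x by apply: subset_closure; exact: ballxx.
have small (e : R) : 0 < e -> exists q : nat, q.+1%:R^-1 < e.
  move=> e0; exists (Num.truncn e^-1); rewrite invf_plt ?posrE//.
  exact: truncnS_gt.
have /choice[e eP] : forall xq : X * nat, exists s : nat -> X,
    good xq.1 xq.2 -> (forall n, cb xq.1 xq.2 (s n)) /\
    (forall z d, cb xq.1 xq.2 z -> 0 < d -> exists n, ball z d (s n)).
  move=> [x q]; have [gxq|ngxq] := pselect (good x q); last by exists (fun=> x).
  have [s [s1 s2]] := compact_dense_sequence gxq.1 (ex_intro _ x (cbc x q)).
  by exists s => _; split.
(* [D w] is reached from [x0] along the word [w]: the letter [(q, n)] moves to the [n]-th point of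
   the dense sequence in the closed ball of index [q], or stays if that ball is not good. *)
pose D : seq (nat * nat) -> X := foldr (fun qn x =>
  if `[< good x qn.1 >] then e (x, qn.1) qn.2 else x) x0.
have DV w : V (D w).
  elim: w => //= -[q n] w IH /=; case: asboolP => // g.
  by apply: g.2; exact: (eP (D w, q) g).1.
have subgood (x y : X) (q p : nat) : p.+1%:R^-1 <= (q.+1%:R^-1 : R) / 2 ->
    ball y (p.+1%:R^-1 : R) x ->
    good x q -> good y p /\ cb y p `<=` cb x q.
  move=> pq bxy [cq qV]; suff pqs : cb y p `<=` cb x q.
    split => //; split; last exact: subset_trans qV.
    by exact: subclosed_compact (@closed_closure _ _) cq pqs.
  apply: closureS => z byz; rewrite [q.+1%:R^-1]splitr.
  by apply: (@ball_triangle _ _ y); apply: le_ball pq _ _; [exact: ball_sym|].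
have goodex x : V x -> exists q, good x q.
  move=> Vx; have [r r0 [cr rV]] := compact_closed_ball oV Vx.
  have [q qr] := small _ r0; exists q.
  have s : cb x q `<=` closure (ball x r).
    by apply: closureS; apply: le_ball; exact: ltW.
  split; last exact: subset_trans rV.
  by exact: subclosed_compact (@closed_closure _ _) cr s.
have pick q : exists p : nat, p.+1%:R^-1 <= q.+1%:R^-1 / 2 :> R.
  have [p pq] := small (q.+1%:R^-1 / 2) ltac:(by rewrite divr_gt0).
  by exists p; exact: ltW.
have bpos (p : nat) (x : X) : nbhs x (ball x (p.+1%:R^-1 : R)) by exact: nbhsx_ballx.
(* Some [D w] is so close to [y] that its good ball of index [p] contains a neighbourhood of [y];
   one more letter makes [D] dense in that ball. *)
have cDn y : V y -> closure (range D) y -> nbhs y (closure (range D)).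
  move=> /goodex[q gy] cy; have [p pq] := pick q; have [p' pp'] := pick p.
  have [_ [[w _ <-] byw]] := cy _ (bpos p' y).
  have p'p : p'.+1%:R^-1 <= p.+1%:R^-1 :> R.
    by rewrite (le_trans pp')// ler_pdivrMr// ler_peMr// ler1n.
  have [gw _] := subgood _ _ _ _ pq (ball_sym (le_ball p'p byw)) gy.
  apply: filterS (bpos p' y) => z byz.
  have cz : cb (D w) p z.
    apply: subset_closure; rewrite [_^-1]splitr.
    by apply: (@ball_triangle _ _ y); apply: le_ball pp' _ _; [exact: ball_sym|].
  move=> B /nbhs_ballP[d /= d0 dB].
  have [n zn] := (eP (D w, p) gw).2 z d cz d0.
  exists (D ((p, n) :: w)); split; first by exists ((p, n) :: w).
  by apply: dB; rewrite /D/= asboolT.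
have VD : V `<=` closure (range D).
  suff <- : V `&` closure (range D) = V by move=> z [].
  apply: cV.
  - by exists x0; split => //; apply: subset_closure; exists [::].
  - exists (closure (range D))°; first exact: open_interior.
    apply/seteqP; split=> z [Vz]; last by move=> /interior_subset.
    by move=> cz; split => //; exact: cDn.
  - by exists (closure (range D)) => //; exact: closed_closure.
pose K n := if unpickle n is Some wq then
  if `[< good (D wq.1) wq.2 >] then cb (D wq.1) wq.2 else set0 else set0.
have Kc n : compact (K n) /\ K n `<=` V.
  rewrite /K; case: unpickle => [[w q]/=|]; last by split => //; exact: compact0.
  by case: asboolP => [//|_]; split => //; exact: compact0.
exists (fun k => \bigcup_(i < k) K i); split=> [k|k z [i _]|Z cZ ZV].
- by rewrite bigcup_mkord; apply: bigsetU_compact => i _; exact: (Kc i).1.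
- exact: (Kc i).2.
- have [|z /ZV Vz|k kZ] := compact_bigcup_nat (O := fun n => (K n)°) cZ.
  + by move=> n; exact: open_interior.
  + have [q gz] := goodex _ Vz; have [p pq] := pick q.
    have [_ [[w _ <-] bzw]] := VD _ Vz _ (bpos p z).
    have [gw _] := subgood _ _ _ _ pq (ball_sym bzw) gz.
    exists (pickle (w, p)) => //; rewrite /K pickleK/= asboolT//.
    rewrite /interior.
    have : nbhs z (ball (D w) (p.+1%:R^-1 : R)).
      by apply: open_nbhs_nbhs; split; [exact: metric_ball_open|exact: ball_sym].
    by apply: filterS => y; exact: subset_closure.
  + by exists k => z /kZ[i ik /interior_subset Kz]; exists i.
Qed.

End exhaustion.

(** * Homeomorphisms and Baire category *)

Lemma homeomorphism_inv (X Y : topologicalType) (h : X -> Y) :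
  homeomorphism h ->
  exists g : Y -> X, [/\ homeomorphism g, cancel h g & cancel g h].
Proof.
by move=> [ch [g cg [hg gh]]]; exists g; split => //; split => //; exists h.
Qed.

Lemma homeomorphism_comp (X Y Z : topologicalType) (f : Y -> Z) (h : X -> Y) :
  homeomorphism f -> homeomorphism h -> homeomorphism (f \o h).
Proof.
move=> [cf [f' cf' [ff' f'f]]] [ch [h' ch' [hh' h'h]]]; split.
  by move=> x; apply: continuous_comp; [exact: ch|exact: cf].
exists (h' \o f').
  by move=> x; apply: continuous_comp; [exact: cf'|exact: ch'].
by split; [exact: can_comp|exact: can_comp].
Qed.

Lemma continuous_connected_image (X Y : topologicalType) (f : X -> Y) (A : set X) :
  continuous f -> connected A -> connected (f @` A).
Proof.
by move=> cf cA; apply: connected_continuous_connected => //;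
  exact: continuous_subspaceT.
Qed.

Lemma continuous_compact_image (X Y : topologicalType) (f : X -> Y) (A : set X) :
  continuous f -> compact A -> compact (f @` A).
Proof.
by move=> cf cA; apply: continuous_compact => //; exact: continuous_subspaceT.
Qed.

Lemma image_cancel (X Y : Type) (h : X -> Y) (g : Y -> X) (A : set X) :
  cancel h g -> cancel g h -> h @` A = g @^-1` A.
Proof.
move=> hg gh; apply/seteqP; split=> [_ [x Ax <-]|y Ay] /=; first by rewrite hg.
by exists (g y).
Qed.

Lemma nested_compact_nonempty (T : topologicalType) (W : nat -> set T) :
  hausdorff_space T -> (forall n, compact (W n)) ->
  (forall n, W n.+1 `<=` W n) -> (forall n, W n !=set0) ->
  exists z, forall n, W n z.
Proof.
move=> hT cW dW W0; apply: contrapT => nex.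
have dWn m n : (m <= n)%N -> W n `<=` W m.
  move=> /subnK <-; elim: (n - m)%N => // k IH.
  by apply: subset_trans IH; exact: dW.
have [i|z Wz|k kW] := compact_bigcup_nat (O := fun n => ~` W n) (cW 0%N).
- by rewrite openC; exact: compact_closed.
- by apply: contrapT => nz; apply: nex; exists z => n; apply: contrapT => nW;
    apply: nz; exists n.
- have [z Wz] := W0 k; have [i /= ik] := kW z (dWn _ _ (leq0n k) _ Wz).
  by apply; exact: dWn (ltnW ik) _ Wz.
Qed.

Lemma seq_positive_min (R : realType) (T : eqType) (l : seq T) (r : T -> R) :
  (forall x, 0 < r x) -> exists2 d, 0 < d & forall x, x \in l -> d <= r x.
Proof.
move=> r0; elim: l => [|x l [d d0 dl]]; first by exists 1.
exists (Order.min d (r x)); first by rewrite lt_min d0 r0.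
move=> y; rewrite inE => /orP[/eqP->|/dl dy]; first by rewrite ge_min lexx orbT.
by rewrite ge_min dy.
Qed.

Lemma compact_uniform_nbhs (R : realType) (X : pseudoMetricType R) (M G : set X) :
  compact M -> open G -> M `<=` G ->
  exists2 e : R, 0 < e & forall z, M z -> ball z e `<=` G.
Proof.
move=> cM oG MG.
have /choice[r rP] : forall z : X, exists r : R,
    0 < r /\ (M z -> ball z (r * 2) `<=` G).
  move=> z; have [Mz|nMz] := pselect (M z); last by exists 1.
  have /nbhs_ballP[r /= r0 rG] := open_nbhs_nbhs (conj oG (MG _ Mz)).
  by exists (r / 2); rewrite divr_gt0// divfK.
have [| |D DM MD] := compact_cover_compact cM (D := M) (f := fun x => (ball x (r x))°).
- by move=> z _; exact: open_interior.
- by move=> z Mz; exists z => //; apply: nbhsx_ballx; exact: (rP z).1.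
have [d d0 dD] := seq_positive_min (finmap.enum_fset D) (fun x => (rP x).1).
exists d => // z /MD[x /= xD /interior_subset bxz] z' bzz'.
apply: ((rP x).2 (set_mem (DM _ xD))).
rewrite mulr_natr mulr2n; apply: ball_triangle bxz _.
by apply: le_ball bzz'; exact: dD.
Qed.

Lemma compact_uniform (R : realType) (X Y : pseudoMetricType R) (g : X -> Y)
    (L : set X) (e : R) : continuous g -> compact L -> 0 < e ->
  exists2 d : R, 0 < d &
    forall z z', L z -> ball z d z' -> ball (g z) e (g z').
Proof.
move=> cg cL e0.
have e2 : 0 < e / 2 by rewrite divr_gt0.
have /choice[r rP] : forall z : X, exists r : R,
    0 < r /\ forall z', ball z (r * 2) z' -> ball (g z) (e / 2) (g z').
  move=> z; have := cg z _ (nbhsx_ballx (g z) _ e2).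
  move=> /nbhs_ballP[r /= r0 rb]; exists (r / 2); split; first by rewrite divr_gt0.
  by move=> z'; rewrite divfK// => /rb.
have [| |D DL LD] := compact_cover_compact cL (D := L) (f := fun x => (ball x (r x))°).
- by move=> z _; exact: open_interior.
- by move=> z Lz; exists z => //; apply: nbhsx_ballx; exact: (rP z).1.
have [d d0 dD] := seq_positive_min (finmap.enum_fset D) (fun x => (rP x).1).
exists d => //.
move=> z z' /LD[x /= xD /interior_subset bxz] bzz'.
have gxz : ball (g x) (e / 2) (g z).
  apply: (rP x).2; apply: le_ball bxz.
  by rewrite ler_peMr ?ler1n// ltW//; exact: (rP x).1.
have gxz' : ball (g x) (e / 2) (g z').
  apply: (rP x).2; rewrite mulr_natr mulr2n; apply: ball_triangle bxz _.
  by apply: le_ball bzz'; exact: dD.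
by rewrite [e]splitr; apply: ball_triangle gxz'; exact: ball_sym.
Qed.

Section baire.
Variables (R : realType) (X : metricType R).
Hypothesis lcX : locally_compact [set: X].

(** Otherwise nested open sets with compact closures can be chosen, the one of index [n + 1] missing
    the closure of [S n]; their common point would lie in [O] and in no [S n]. *)
Lemma baire_locally_compact (O : set X) (S : nat -> set X) :
  open O -> O !=set0 -> O `<=` \bigcup_n S n ->
  exists n, exists W, [/\ open W, W !=set0, W `<=` O & W `<=` closure (S n)].
Proof.
move=> oO [x0 Ox0] OS; apply: contrapT => nex.
pose good (W : set X) := [/\ open W, W !=set0 & compact (closure W)].
have shrink V x : open V -> V x -> exists2 W, good W & closure W `<=` V.
  move=> oV Vx; have [e e0 [ce eV]] := compact_closed_ball lcX oV Vx.
  exists (ball x e) => //; split => //; first exact: metric_ball_open.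
  by exists x; exact: ballxx.
have /choice[F FP] : forall nW : nat * set X, exists W' : set X,
    open nW.2 -> nW.2 !=set0 -> nW.2 `<=` O ->
    good W' /\ closure W' `<=` nW.2 `\` closure (S nW.1).
  move=> [n W] /=.
  have [[oW W0 WO]|nW] := pselect [/\ open W, W !=set0 & W `<=` O]; last first.
    by exists W => *; exfalso; exact: nW.
  have : ~ (W `<=` closure (S n)) by move=> WS; apply: nex; exists n, W.
  move=> /existsNP[x /not_implyP[Wx nSx]].
  have [W' gW' WW'] : exists2 W', good W' & closure W' `<=` W `\` closure (S n).
    apply: (shrink _ x) => //; rewrite setDE; apply: openI => //.
    by rewrite openC; exact: closed_closure.
  by exists W'.
have [W0 gW0 W0O] := shrink _ _ oO Ox0.
pose W := fix W n := if n is m.+1 then F (m, W m) else W0.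
have WP n : good (W n) /\ closure (W n) `<=` O.
  elim: n => [//|n [[oW nW cW] WO]] /=.
  have [gW' sW'] := FP (n, W n) oW nW (subset_trans (@subset_closure _ _) WO).
  by split => // z /sW'[/subset_closure/WO].
have WS n : closure (W n.+1) `<=` W n `\` closure (S n).
  have [[oW nW cW] WO] := WP n.
  exact: (FP (n, W n) oW nW (subset_trans (@subset_closure _ _) WO)).2.
have [z Wz] : exists z, forall n, closure (W n) z.
  apply: nested_compact_nonempty.
  - exact: metric_hausdorff.
  - by move=> n; have [[]] := WP n.
  - by move=> n z /WS[/subset_closure].
  - by move=> n; have [[_ [x Wx] _] _] := WP n; exists x; exact: subset_closure.
have [n _ Sz] := OS z ((WP 0%N).2 z (Wz 0%N)).
by have [_] := WS n z (Wz n.+1); apply; exact: subset_closure.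
Qed.

End baire.

Lemma component_region (X : topologicalType) (x : X) : locally_connected X ->
  region (connected_component [set: X] x).
Proof.
move=> lX; split; last exact: component_connected.
rewrite openE => y xy; have [V [oV cV Vy _]] := lX y setT filterT.
apply: filterS (open_nbhs_nbhs (conj oV Vy)) => z Vz.
apply: connected_component_trans xy _.
by exists V.
Qed.

Section effros.
Variables (R : realType) (X : metricType R).
Hypothesis homX : homogeneous X.
Hypothesis lcX : locally_compact [set: X].
Hypothesis lconX : locally_connected X.

(* A weak form of Effros' theorem: the orbit map of the homeomorphism group is
   nearly open.  Homeomorphisms fall into countably many classes such that
   [h^-1 \o h'] is close to the identity on [M] for [h], [h'] in one class. *)
Lemma weak_effros (x : X) (G M : set X) (e : R) :
  region G -> G x -> compact M -> M `<=` G -> 0 < e ->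
  nbhs x (closure
    [set h x | h in [set h : X -> X |
      homeomorphism h /\ forall z, M z -> ball z e (h z)]]).
Proof.
move=> [oG cG] Gx cM MG e0.
(* Only a component is known to be sigma-compact. A homeomorphism sending [x] into [X0] maps the
   connected set [G], hence [M], into [X0], and its inverse maps [X0] into itself. *)
pose X0 := connected_component [set: X] x.
have rX0 : region X0 := component_region x lconX.
have X0x : X0 x by exact: connected_component_refl.
have X0max (A : set X) y : connected A -> A y -> X0 y -> A `<=` X0.
  move=> cA Ay X0y z Az; apply: connected_component_trans X0y _.
  by exists A.
have [L [cL LX0 Lex]] := region_exhaustion lcX rX0.
have e4 : 0 < e / 2 / 2 by rewrite !divr_gt0.
have /choice[N NP] : forall kq : nat * nat, exists l : seq X,
    (forall x, x \in l -> L kq.1 x) /\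
    (forall z, L kq.1 z -> exists2 x, x \in l & ball x (kq.2.+1%:R^-1 : R) z).
  by move=> [k q]; exact: finite_net.
have /choice[E EP] : forall k : nat, exists l : seq X,
    (forall x, x \in l -> L k x) /\
    (forall z, L k z -> exists2 x, x \in l & ball x (e / 2 / 2) z).
  by move=> k; exact: finite_net.
(* The code [(k, l, q, s)] records that [h] maps [M] into [L k], that [1/(q+1)] is a modulus of
   continuity of the inverse [g] on [L k], and, through [s], which net point of [L l] is close to
   the image under [g] of each net point of [L k]. *)
pose P (h g : X -> X) (c : nat * nat * nat * seq nat) :=
  let: (k, l, q, s) := c in
  [/\ [set h z | z in M] `<=` L k,
      forall z z', L k z -> ball z (q.+1%:R^-1 : R) z' ->
        ball (g z) (e / 2 / 2) (g z')
    & forall i, (i < size (N (k, q)))%N ->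
        ball (nth x (E l) (nth 0%N s i)) (e / 2 / 2) (g (nth x (N (k, q)) i))].
pose S (c : nat * nat * nat * seq nat) := [set y : X | exists h g,
  [/\ homeomorphism h, homeomorphism g, cancel h g, cancel g h & h x = y /\ P h g c]].
have X0S : X0 `<=` \bigcup_c S c.
  move=> y X0y; have [h hh hx] := homX x y.
  have [g [gg hg gh]] := homeomorphism_inv hh.
  have [k hMk] : exists k, [set h z | z in M] `<=` L k.
    apply: Lex; first exact: continuous_compact_image hh.1 cM.
    apply: (@subset_trans _ (h @` G)); first exact: image_subset.
    apply: (X0max _ y) => //; first exact: continuous_connected_image hh.1 cG.
    by exists x.
  have [l gLl] : exists l, [set g z | z in L k] `<=` L l.
    apply: Lex; first exact: continuous_compact_image gg.1 (cL k).
    apply: (@subset_trans _ (g @` X0)); first exact: image_subset.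
    apply: (X0max _ x) => //; first exact: continuous_connected_image gg.1 rX0.2.
    by exists y => //; rewrite -hx hg.
  have [d d0 gd] := compact_uniform gg.1 (cL k) e4.
  have [q qd] : exists q : nat, q.+1%:R^-1 < d.
    exists (Num.truncn d^-1); rewrite invf_plt ?posrE//; exact: truncnS_gt.
  have /choice[s sP] : forall i, exists j, (i < size (N (k, q)))%N ->
      ball (nth x (E l) j) (e / 2 / 2) (g (nth x (N (k, q)) i)).
    move=> i; have [ilt|ige] := ltnP i (size (N (k, q))); last by exists 0%N.
    have Ni : L k (nth x (N (k, q)) i) by apply: (NP (k, q)).1; exact: mem_nth.
    have [w wE bw] := (EP l).2 _ (gLl _ (imageP g Ni)).
    by exists (index w (E l)) => _; rewrite nth_index.
  exists (k, l, q, mkseq s (size (N (k, q)))) => //.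
  exists h, g; split => //; split => //; split=> // [z z' Lz bz|i ilt].
    by apply: gd => //; apply: le_ball bz; exact: ltW.
  by rewrite nth_mkseq//; exact: sP.
have [n [W [oW [w Ww] WX0 WS]]] : exists n, exists W, [/\ open W, W !=set0,
    W `<=` X0 & W `<=` closure (if unpickle n is Some c then S c else set0)].
  apply: baire_locally_compact => //; first exact: rX0.1.
    by exists x.
  move=> y /X0S[c _ Sc]; exists (pickle c) => //.
  by rewrite pickleK.
move: WS; case: (unpickle n) => [c WS|]; last first.
  by rewrite closure0 => /(_ _ Ww).
(* A reference homeomorphism [h0] of the class found by Baire. For [z] near [x], the point [h0 z] is
   a limit of points [h x] with [h] in the same class, so the maps [g0 \o h] send [x] arbitrarily
   close to [z]. *)
have [_ [[h0 [g0 [hh0 gg0 hg0 gh0 [<- P0]]]] Wh0]] :=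
  WS w Ww W (open_nbhs_nbhs (conj oW Ww)).
have : nbhs x (h0 @^-1` W) by apply: hh0.1; exact: open_nbhs_nbhs.
apply: filterS => z Wz B Bz.
have : nbhs (h0 z) (g0 @^-1` B) by apply: gg0.1; rewrite hg0.
move=> /(WS _ Wz)[_ [[h [g [hh gg hg gh [<- Ph]]]] Bh]].
exists (g0 (h x)); split => //; exists (g0 \o h) => //; split.
  exact: homeomorphism_comp.
move=> y My /=.
move: c P0 Ph {WS} => [[[k l] q] s] [_ u0 s0] [hM u1 s1].
have Lhy : L k (h y) by apply: hM; exists y.
have [v vN bv] := (NP (k, q)).2 _ Lhy.
have iv : (index v (N (k, q)) < size (N (k, q)))%N by rewrite index_mem.
have Lv : L k v by exact: (NP (k, q)).1.
have := s0 _ iv; have := s1 _ iv; rewrite nth_index// => b1 b0.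
have c1 := u1 _ _ Lv bv; have c0 := u0 _ _ Lv bv; rewrite hg in c1.
(* Four steps of length [e/4]: from [y = g (h y)] to [g v], to the net point recorded for [v] in the
   common code, to [g0 v], to [g0 (h y)]. *)
rewrite [e]splitr; apply: (@ball_triangle _ _ (nth x (E l) (nth 0%N s (index v (N (k, q))))));
  rewrite [e / 2]splitr.
  by apply: ball_sym; apply: ball_triangle c1.
by apply: ball_triangle c0.
Qed.

End effros.

(** * Thin sets *)

(** All copies of [F] occur because moving [M] by a homeomorphism and then removing [F] amounts to
    removing another copy of [F] from [M]. *)
Definition thin (X : topologicalType) (F : set X) : Prop :=
  compact F /\ forall (x : X) (N : set X), nbhs x N ->
    exists M : set X, [/\ compact M, M x, M `<=` N & forall h : X -> X,
      homeomorphism h -> connected (M `\` h @` F) /\ M `\` h @` F !=set0].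

Lemma homeomorphism_id (X : topologicalType) : homeomorphism (@id X).
Proof.
by split=> [x|]; [exact: cvg_id|exists id => // x; exact: cvg_id].
Qed.

Lemma thin_codense (X : topologicalType) (F O : set X) :
  thin F -> open O -> O !=set0 -> O `\` F !=set0.
Proof.
move=> [_ tF] oO [x Ox]; have [M [_ _ MO MF]] := tF x O (open_nbhs_nbhs (conj oO Ox)).
have [_ [m]] := MF id (homeomorphism_id X).
by rewrite image_id => -[Mm nFm]; exists m; split => //; exact: MO.
Qed.

Lemma separated_open (X : topologicalType) (P Q : set X) :
  open P -> open Q -> P `&` Q = set0 ->
  separated P Q.
Proof.
move=> oP oQ PQ; split; apply/seteqP; split=> z //.
  by move=> [cz Qz]; have := cz Q (open_nbhs_nbhs (conj oQ Qz)); rewrite PQ => -[].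
by move=> [Pz /(_ P (open_nbhs_nbhs (conj oP Pz)))]; rewrite setIC PQ => -[].
Qed.

Lemma compact_bigcap_nat (T : topologicalType) (W : nat -> set T) :
  hausdorff_space T -> (forall n, compact (W n)) -> compact (\bigcap_n W n).
Proof.
move=> hT cW; apply: subclosed_compact (cW 0%N) _; last by move=> z; apply.
by apply: closed_bigI => n _; exact: compact_closed.
Qed.

Lemma nested_compact_connected (R : realType) (X : metricType R) (W : nat -> set X) :
  (forall n, compact (W n)) -> (forall n, connected (W n)) ->
  (forall n, W n.+1 `<=` W n) -> connected (\bigcap_n W n).
Proof.
move=> cW conW dW; have hX := @metric_hausdorff _ X.
have cZ := compact_bigcap_nat hX cW.
set Z := \bigcap_n W n in cZ *.
apply: contrapT => /connectedPn[E [E0 ZE [sE1 sE2]]].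
have clZ : closed Z := compact_closed hX cZ.
have clE b : closed (E b).
  move=> z cz; have Zz : Z z.
    apply: clZ; apply: closureS cz; rewrite ZE.
    by case: (b) => y Ey; [right|left].
  move: Zz; rewrite ZE; case: b cz => cz [] // Ez; exfalso.
    by suff : (E false `&` closure (E true)) z by rewrite sE2.
  by suff : (closure (E false) `&` E true) z by rewrite sE1.
have [|P [Q [oP oQ EP EQ PQ]]] :=
  (@normal_openP R X).1 pseudometric_normal _ _ (clE false) (clE true).
  by apply/seteqP; split=> z // -[E1 E2]; rewrite -sE1; split=> //;
    exact: subset_closure.
have [n|n|n|z Wz] := @nested_compact_nonempty _ (fun n => W n `&` ~` (P `|` Q)) hX.
- apply: compact_closedI => //; rewrite closedC; exact: openU.
- by move=> z [/dW].
- apply: contrapT => nz.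
  have WPQ : W n `<=` P `|` Q.
    by move=> z Wz; apply: contrapT => nPQ; apply: nz; exists z.
  have sPQ := separated_open oP oQ PQ.
  have ZW : Z `<=` W n by move=> z; apply.
  have [f Ef] := E0 false; have [t Et] := E0 true.
  have [WP|WQ] := connected_subset sPQ WPQ (conW n).
    have : (P `&` Q) t by split; [apply/WP/ZW; rewrite ZE; right|exact: EQ].
    by rewrite PQ.
  have : (P `&` Q) f by split; [exact: EP|apply/WQ/ZW; rewrite ZE; left].
  by rewrite PQ.
- have Zz : Z z by move=> n _; have [] := Wz n.
  have [_] := Wz 0%N; apply; move: Zz; rewrite ZE.
  by move=> [/EP|/EQ] ?; [left|right].
Qed.

Section regions.
Variables (R : realType) (X : metricType R).
Hypothesis homX : homogeneous X.
Hypothesis lcX : locally_compact [set: X].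
Hypothesis lconX : locally_connected X.

Let hX := @metric_hausdorff _ X.

(* A set [M] through a boundary point [x] of [W] that meets [V] can be moved
   slightly so that [x] enters [W] while a point of [M] stays in [V]. *)
Lemma thin_no_crossing (F G V W M : set X) (x m : X) :
  compact F -> region G -> open V -> open W -> V `&` W = set0 ->
  G `\` F `<=` V `|` W -> compact M -> M `<=` G ->
  (forall h : X -> X, homeomorphism h -> connected (M `\` h @` F)) ->
  M x -> closure W x -> M m -> V m -> W `<=` ~` F -> V `<=` ~` F -> False.
Proof.
move=> cF rG oV oW VW GVW cM MG Mcon Mx clWx Mm Vm WF VF.
have [e1 e10 e1G] := compact_uniform_nbhs cM rG.1 MG.
have /nbhs_ballP[e2 /= e20 e2V] := open_nbhs_nbhs (conj oV Vm).
(* [e1] keeps the moved copy of [M] inside [G], [e2] keeps [h m] in [V]. *)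
pose e := Order.min e1 e2.
have e0 : 0 < e by rewrite lt_min e10.
have nx := weak_effros homX lcX lconX rG (MG _ Mx) cM MG e0.
have [w [Ww cw]] := clWx _ nx.
have [_ [[h [hh he] <-] Whx]] := cw W (open_nbhs_nbhs (conj oW Ww)).
have [g [gg hg gh]] := homeomorphism_inv hh.
(* This set is the image of [M] under [h] with [F] removed. It is connected, lies in the union of
   [V] and [W], and meets both. *)
have cN : connected (h @` (M `\` g @` F)).
  by apply: continuous_connected_image; [exact: hh.1|exact: Mcon].
have gF z : F (h z) -> (g @` F) z by move=> Fz; exists (h z).
have Fg z : (g @` F) z -> F (h z) by move=> [y Fy <-]; rewrite gh.
have hMVW : h @` (M `\` g @` F) `<=` V `|` W.
  move=> _ [z [Mz nFz] <-]; apply: GVW; split; last by move=> /gF.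
  by apply: (e1G z) => //; apply: le_ball (he _ Mz); rewrite ge_min lexx.
have Vhm : V (h m) by apply: e2V; apply: le_ball (he _ Mm); rewrite ge_min lexx orbT.
have hNx : (h @` (M `\` g @` F)) (h x) by exists x => //; split=> // /Fg/(WF _ Whx).
have hNm : (h @` (M `\` g @` F)) (h m) by exists m => //; split=> // /Fg/(VF _ Vhm).
have [/(_ _ hNx) Vx|/(_ _ hNm) Wm] := connected_subset (separated_open oV oW VW) hMVW cN.
  by have : (V `&` W) (h x) by []; rewrite VW.
by have : (V `&` W) (h m) by []; rewrite VW.
Qed.

Lemma region_setD_thin (F G : set X) : thin F -> region G -> region (G `\` F).
Proof.
move=> tF rG; have clF : closed F by apply: compact_closed; [exact: hX|exact: tF.1].
have oGF : open (G `\` F) by rewrite setDE; apply: openI; [exact: rG.1|rewrite openC].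
split => //; apply: contrapT => /connectedPn[E [E0 GE [sE1 sE2]]].
have oE b : open (E b).
  have -> : E b = (G `\` F) `&` ~` closure (E (~~ b)).
    rewrite GE; apply/seteqP; split=> z.
      case: b => Ez; (split; [by [left|right]|move=> cz]).
        by have : (closure (E false) `&` E true) z by []; rewrite sE1.
      by have : (E false `&` closure (E true)) z by []; rewrite sE2.
    by case: b => -[[]Ez nz] //; exfalso; apply: nz; exact: subset_closure.
  by apply: openI => //; rewrite openC; exact: closed_closure.
have E01 : E false `&` E true = set0.
  by apply/seteqP; split=> z // -[Ef Et]; rewrite -sE1; split=> //;
    exact: subset_closure.
have EGF b : E b `<=` G `\` F by move=> z Ez; rewrite GE; case: b Ez; [right|left].
(* A thin set has empty interior, so what remains of [G] is dense in [G]. *)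
have Gcl : G `<=` closure (E false) `|` closure (E true).
  move=> z Gz; rewrite -closureU -GE => B Bz.
  have [||y [[Gy By] nFy]] := thin_codense (O := G `&` B°) tF.
  - by apply: openI; [exact: rG.1|exact: open_interior].
  - by exists z.
  - by exists y; split => //; exact: interior_subset.
(* Otherwise the closure of [E false] would be clopen in the connected [G]. *)
have [x [Gx xf xt]] : exists x, [/\ G x, closure (E false) x & closure (E true) x].
  apply: contrapT => nx.
  have : G `&` closure (E false) = G.
    apply: rG.2.
    - have [y Ey] := E0 false; exists y; split; last exact: subset_closure.
      by have [] := EGF _ _ Ey.
    - exists (~` closure (E true)); first by rewrite openC; exact: closed_closure.
      apply/seteqP; split=> z [Gz zE]; split => //.
        by move=> zt; apply: nx; exists z.
      by have [] := Gcl z Gz.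
    - by exists (closure (E false)) => //; exact: closed_closure.
  have [y Ey] := E0 true; move=> GE'.
  have : G y by have [] := EGF _ _ Ey.
  by rewrite -GE' => -[_ cy]; have : (closure (E false) `&` E true) y by [];
    rewrite sE1.
have [M [cM Mx MG Mh]] := tF.2 x G (open_nbhs_nbhs (conj rG.1 Gx)).
have [_ [m [Mm]]] := Mh id (homeomorphism_id X).
rewrite image_id => nFm.
have EF b : E b `<=` ~` F by move=> z /EGF[].
have : (G `\` F) m by split => //; exact: MG.
rewrite GE => -[Em|Em].
  apply: (thin_no_crossing (V := E false) (W := E true)
    (F := F) (G := G) (M := M) (x := x) (m := m)) => //.
  - exact: tF.1.
  - by rewrite GE.
  - by move=> h /Mh[].
apply: (thin_no_crossing (V := E true) (W := E false)
  (F := F) (G := G) (M := M) (x := x) (m := m)) => //.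
- exact: tF.1.
- by rewrite setIC.
- by rewrite GE setUC.
- by move=> h /Mh[].
Qed.

Lemma small_region (G : set X) (x : X) : open G -> G x ->
  exists G', [/\ region G', G' x, compact (closure G') & closure G' `<=` G].
Proof.
move=> oG Gx; have [e e0 [ce eG]] := compact_closed_ball lcX oG Gx.
have [V [oV cV Vx Ve]] := lconX (nbhsx_ballx x e e0).
exists V; split => //.
  by apply: subclosed_compact (@closed_closure _ _) ce _; exact: closureS.
by apply: subset_trans eG; exact: closureS.
Qed.

(** The points [y] that can be reached in this way form a clopen subset of [G]: at a limit point, a
    small region is added to a region that meets it. *)
Lemma relatively_compact_region (G : set X) (x y : X) :
  region G -> G x -> G y ->
  exists G', [/\ region G', G' x, G' y, compact (closure G') & closure G' `<=` G].
Proof.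
move=> rG Gx Gy.
pose B := [set z | exists G', [/\ region G', G' x, G' z,
  compact (closure G') & closure G' `<=` G]].
suff GB : G `&` B = G by have [] : (G `&` B) y by rewrite GB.
apply: rG.2.
- exists x; split => //.
  by have [G' [? ? ? ?]] := small_region rG.1 Gx; exists G'.
- exists B => //; rewrite openE => z [G' [rG' G'x G'z cG' G'G]].
  apply: filterS (open_nbhs_nbhs (conj rG'.1 G'z)) => w G'w.
  by exists G'.
- exists (closure B); first exact: closed_closure.
  apply/seteqP; split=> z [Gz Bz]; split => //; first exact: subset_closure.
  have [H [rH Hz cH HG]] := small_region rG.1 Gz.
  have [w [[G' [rG' G'x G'w cG' G'G]] Hw]] := Bz H (open_nbhs_nbhs (conj rH.1 Hz)).
  exists (G' `|` H); split; [|by left|by right| |].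
  + split; first by apply: openU; [exact: rG'.1|exact: rH.1].
    by apply: connectedU; [exists w|exact: rG'.2|exact: rH.2].
  + by rewrite closureU; exact: compactU.
  + by rewrite closureU => ? [/G'G|/HG].
Qed.

(** A fixed end point might lie in some [F i], so the regions are only required to meet [O0] and
    [O1], with new points chosen at each stage. This is why the limit continuum is only known to
    meet the closures. *)
Lemma continuum_avoiding_thin (U O0 O1 : set X) (F : nat -> set X) :
  (forall i, thin (F i)) -> region U -> open O0 -> open O1 ->
  U `&` O0 !=set0 -> U `&` O1 !=set0 ->
  exists Z : set X, [/\ continuum Z, Z `<=` U `\` \bigcup_i F i,
    Z `&` closure O0 !=set0 & Z `&` closure O1 !=set0].
Proof.
move=> tF rU oO0 oO1 UO0 UO1.
pose good (G : set X) := [/\ region G, G `&` O0 !=set0 & G `&` O1 !=set0].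
have /choice[f fP] : forall iG : nat * set X, exists G' : set X, good iG.2 ->
    [/\ good G', compact (closure G') & closure G' `<=` iG.2 `\` F iG.1].
  move=> [i G] /=; have [gG|ng] := pselect (good G); last by exists G.
  have [rG G0 G1] := gG; have rGF := region_setD_thin (tF i) rG.
  have [|a [[Ga O0a] nFa]] := thin_codense (tF i) _ G0.
    by apply: openI => //; exact: rG.1.
  have [|b [[Gb O1b] nFb]] := thin_codense (tF i) _ G1.
    by apply: openI => //; exact: rG.1.
  have [G' [rG' G'a G'b cG' G'G]] :=
    @relatively_compact_region _ a b rGF (conj Ga nFa) (conj Gb nFb).
  by exists G' => _; split => //; split => //; [exists a|exists b].
pose G := fix G n := if n is m.+1 then f (m, G m) else U.
have gG n : good (G n) by elim: n => // n IH /=; have [] := fP (n, G n) IH.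
have [cG GF] : (forall n, compact (closure (G n.+1))) /\
    (forall n, closure (G n.+1) `<=` G n `\` F n).
  by split=> n; have [] := fP (n, G n) (gG n).
pose W n := closure (G n.+1).
have dW n : W n.+1 `<=` W n by move=> z /GF[/subset_closure].
exists (\bigcap_n W n); split.
- split; first exact: compact_bigcap_nat.
  apply: nested_compact_connected => // n; apply: connected_closure.
  by have [[]] := gG n.+1.
- move=> z Wz; split; first by have [] := GF 0%N z (Wz 0%N I).
  by move=> [i _ Fz]; have [_] := GF i z (Wz i I); apply.
- have [|n z [/dW]//|n|z Wz] := @nested_compact_nonempty _ (fun n => W n `&` closure O0) hX.
  + by move=> n; apply: compact_closedI; [exact: cG|exact: closed_closure].
  + have [_ [z [Gz Oz]] _] := gG n.+1.
    by exists z; split; exact: subset_closure.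
  + by exists z; split; [move=> n _; have [] := Wz n|have [] := Wz 0%N].
- have [|n z [/dW]//|n|z Wz] := @nested_compact_nonempty _ (fun n => W n `&` closure O1) hX.
  + by move=> n; apply: compact_closedI; [exact: cG|exact: closed_closure].
  + have [_ _ [z [Gz Oz]]] := gG n.+1.
    by exists z; split; exact: subset_closure.
  + by exists z; split; [move=> n _; have [] := Wz n|have [] := Wz 0%N].
Qed.

End regions.

(** * Minimal compacta *)

Lemma total_seq_sup (T : Type) (F : set (set T)) (l : seq (set T)) :
  total_on F subset -> (forall A, A \in l -> F A) ->
  exists A, (F A \/ A = set0) /\ forall A', A' \in l -> A' `<=` A.
Proof.
move=> tF; elim: l => [|A l IH] Fl; first by exists set0; split => //; right.
have [|A' [FA' lA']] := IH; first by move=> C lC; apply: Fl; rewrite inE lC orbT.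
have FA : F A by apply: Fl; rewrite inE eqxx.
case: FA' => [FA'|A'0].
  have [AA'|A'A] := tF _ _ FA FA'.
    exists A'; split; first by left.
    by move=> C; rewrite inE => /orP[/eqP->|/lA'].
  exists A; split; first by left.
  by move=> C; rewrite inE => /orP[/eqP->//|/lA' CA']; exact: subset_trans A'A.
exists A; split; first by left.
by move=> C; rewrite inE => /orP[/eqP->//|/lA']; rewrite A'0 subset0 => ->.
Qed.

Section minimal.
Variables (X : topologicalType) (Pr : set X -> Prop).
Hypothesis hX : hausdorff_space X.
Hypothesis Pr_nbhs : forall Z, compact Z -> Pr Z ->
  exists O, [/\ open O, Z `<=` O & forall Z', compact Z' -> Z' `<=` O -> Pr Z'].

Let compactD (B A : set X) : compact B -> open A -> compact (B `\` A).
Proof.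
by move=> cB oA; rewrite setDE; apply: compact_closedI => //; rewrite closedC.
Qed.

Lemma minimal_failing (B : set X) : compact B -> ~ Pr B ->
  exists M, [/\ compact M, M `<=` B, ~ Pr M
    & forall M', compact M' -> M' `<=` M -> M' <> M -> Pr M'].
Proof.
(* Zorn's lemma runs over the open sets to be removed: a maximal one leaves a minimal compactum. *)
move=> cB nB; pose P A := open A /\ ~ Pr (B `\` A).
have [F FP tF|A [[oA nA] maxA]] := @Zorn_bigcup X P.
  split; first by apply: bigcup_open => A /FP[].
  set U := \bigcup_(A in F) A => PU.
  have oU : open U by apply: bigcup_open => A /FP[].
  have [V [oV UV VP]] := Pr_nbhs (compactD cB oU) PU.
  (* If removing the whole union left a set with [Pr], then [V] and finitely many members of the
     chain, hence [V] and a single member [A], would cover [B]; what [A] leaves would have [Pr] as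
     well. *)
  have [| |D DF BD] := compact_cover_compact cB (D := F `|` [set V]) (f := id).
  - by move=> A [/FP[]//|->].
  - move=> z Bz; have [[A FA Az]|nUz] := pselect (U z).
      by exists A => //; left.
    by exists V; [right|exact: UV].
  have [|A [FA lA]] := @total_seq_sup _ F
    [seq A <- finmap.enum_fset D | `[< F A >]] tF.
    by move=> A; rewrite mem_filter => /andP[/asboolP].
  have BAV : B `\` A `<=` V.
    move=> z [Bz nAz]; have [C /= CD Cz] := BD z Bz.
    have [FC|/= <-//] := set_mem (DF _ CD).
    by exfalso; apply: nAz; apply: (lA C) => //; rewrite mem_filter asboolT.
  case: FA => [FA|A0].
    have [oA] := FP _ FA; apply; apply: VP => //; exact: compactD.
  by apply: nB; apply: VP => //; rewrite A0 setD0 in BAV.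
exists (B `\` A); split; [exact: compactD|by move=> z []|exact: nA|].
move=> M' cM' M'M neM'; apply: contrapT => nM'.
have := maxA (~` M' `|` A); apply.
  split; first by move=> z Az; right.
  move=> sub; apply: neM'; apply/seteqP; split => // z [Bz nAz].
  by apply: contrapT => nM'z; apply/nAz/sub; left.
split; first by apply: openU => //; rewrite openC; exact: compact_closed.
suff -> : B `\` (~` M' `|` A) = M' by [].
apply/seteqP; split=> z.
  by move=> [_ /not_orP[/contrapT]].
by move=> M'z; have [Bz nAz] := M'M _ M'z; split => // -[|].
Qed.

(** Each half of a separation, closed up and joined with the part of [M] in [F], is a proper
    subcompactum and has [Pr] by minimality. The two halves meet only in [F], so amalgamation would
    give [Pr M]. *)
Lemma minimal_connected (M F : set X) : compact M -> ~ Pr M ->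
  (forall M', compact M' -> M' `<=` M -> M' <> M -> Pr M') -> compact F ->
  (forall M1 M2, compact M1 -> compact M2 -> M1 `&` M2 `<=` F ->
    Pr M1 -> Pr M2 -> Pr (M1 `|` M2)) ->
  connected (M `\` F).
Proof.
move=> cM nM minM cF amal; apply: contrapT => /connectedPn[E [E0 ME [s1 s2]]].
have clM := compact_closed hX cM; have clF := compact_closed hX cF.
pose N b := closure (E b) `|` (M `&` F).
have EM b : E b `<=` M `\` F by move=> z Ez; rewrite ME; case: b Ez; [right|left].
have cEM b : closure (E b) `<=` M.
  by rewrite ((closure_id M).1 clM); apply: closureS => z /EM[].
have NM b : N b `<=` M by move=> z [/cEM|[]].
have cN b : compact (N b).
  apply: subclosed_compact cM (NM b); apply: closedU; first exact: closed_closure.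
  exact: closedI.
have nN b : N b <> M.
  move=> NMb; have [y Ey] := E0 (~~ b); have [My nFy] := EM _ _ Ey.
  move: My; rewrite -NMb => -[cy|[]//].
  case: b Ey cy {NMb} => /= Ey cy.
    by have : (E false `&` closure (E true)) y by []; rewrite s2.
  by have : (closure (E false) `&` E true) y by []; rewrite s1.
apply: nM; suff -> : M = N false `|` N true.
  apply: amal => //; try (by apply: minM).
  move=> z [[c0|[]//] [c1|[]//]]; apply: contrapT => nFz.
  have : (M `\` F) z by split => //; exact: cEM c0.
  rewrite ME => -[Ez|Ez].
    by have : (E false `&` closure (E true)) z by []; rewrite s2.
  by have : (closure (E false) `&` E true) z by []; rewrite s1.
apply/seteqP; split=> z; last by case=> /NM.
move=> Mz; have [Fz|nFz] := pselect (F z); first by left; right.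
have : (M `\` F) z by [].
by rewrite ME => -[Ez|Ez]; [left|right]; left; exact: subset_closure.
Qed.

End minimal.

Section thin_of_cantor.
Variables (R : realType) (X : metricType R).
Hypothesis homX : homogeneous X.

Lemma closure_ball2 (x : X) (e : R) : 0 < e -> closure (ball x e) `<=` ball x (e * 2).
Proof.
move=> e0 y cy; have [z [xz yz]] := cy _ (nbhsx_ballx y e e0).
by rewrite mulr_natr mulr2n; apply: ball_triangle xz _; exact: ball_sym.
Qed.

(** The third hypothesis is asked of every compactum that is not tiny, so that it can be used again
    inside a small piece of the previous one; finite additivity of [tiny] provides such a piece. *)
Lemma thin_of_cantor (tiny : set X -> Prop) (F B0 : set X) :
  compact F -> tiny set0 ->
  (forall Z1 Z2, compact Z1 -> compact Z2 -> tiny Z1 -> tiny Z2 -> tiny (Z1 `|` Z2)) ->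
  (forall B, compact B -> ~ tiny B -> exists M, [/\ compact M, M `<=` B, ~ tiny M &
    forall h : X -> X, homeomorphism h ->
      connected (M `\` h @` F) /\ M `\` h @` F !=set0]) ->
  compact B0 -> ~ tiny B0 -> thin F.
Proof.
move=> cF t0 tU cantor cB0 nB0; have hX := @metric_hausdorff _ X.
pose good (M : set X) := [/\ compact M, ~ tiny M & forall h : X -> X,
  homeomorphism h -> connected (M `\` h @` F) /\ M `\` h @` F !=set0].
(* Points of the closure of a ball of radius [e] are within [2 * e] of its centre, hence within
   [4 * e] of each other. *)
have /choice[f fP] : forall kM : nat * set X, exists M' : set X, good kM.2 ->
    [/\ good M', M' `<=` kM.2 & forall z z', M' z -> M' z' ->
      ball z (kM.1.+1%:R^-1 * 2 * 2 : R) z'].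
  move=> [k M] /=; have [gM|ng] := pselect (good M); last by exists M.
  have [cM nM _] := gM; pose e : R := k.+1%:R^-1; have e0 : 0 < e by rewrite invr_gt0.
  have [l [lM Ml]] := finite_net cM e0.
  have [x xnt] : exists x, ~ tiny (M `&` closure (ball x e)).
    apply: contrapT => /forallNP allt; apply: nM.
    have -> : M = M `&` \bigcup_(x in [set x | x \in l]) closure (ball x e).
      apply/seteqP; split=> z; last by case.
      move=> Mz; split => //; have [x xl xz] := Ml z Mz.
      by exists x => //; exact: subset_closure.
    suff /(_ l)[_ //] : forall s : seq X,
        compact (M `&` \bigcup_(x in [set` s]) closure (ball x e)) /\
        tiny (M `&` \bigcup_(x in [set` s]) closure (ball x e)) by [].
    elim=> [|x s [cs ts]].
      by rewrite set_nil bigcup_set0 setI0; split => //; exact: compact0.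
    rewrite bigcup_seq_cons setIUr.
    have cx : compact (M `&` closure (ball x e)).
      by apply: compact_closedI => //; exact: closed_closure.
    split; first exact: compactU.
    by apply: tU => //; apply: contrapT; exact: allt.
  have cMx : compact (M `&` closure (ball x e)).
    by apply: compact_closedI => //; exact: closed_closure.
  have [M' [cM' M'M nM' M'h]] := cantor _ cMx xnt.
  exists M' => _; split => //; first by move=> z /M'M[].
  move=> z z' /M'M[_ /(closure_ball2 e0)xz] /M'M[_ /(closure_ball2 e0)xz'].
  by rewrite mulr_natr mulr2n; apply: ball_triangle xz'; exact: ball_sym.
have [M0 [cM0 _ nM0 M0h]] := cantor _ cB0 nB0.
pose M := fix M n := if n is m.+1 then f (m, M m) else M0.
have gM n : good (M n) by elim: n => // n IH /=; have [] := fP (n, M n) IH.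
have [MS Md] : (forall n, M n.+1 `<=` M n) /\ (forall n z z', M n.+1 z ->
    M n.+1 z' -> ball z (n.+1%:R^-1 * 2 * 2 : R) z').
  by split=> n; have [] := fP (n, M n) (gM n).
have [p Mp] : exists p, forall n, M n p.
  apply: nested_compact_nonempty => // n; first by have [] := gM n.
  by have [_ _ /(_ id (homeomorphism_id X))[_ [z [Mz _]]]] := gM n; exists z.
split => // x N Nx; have [h hh hp] := homX p x.
have [g [gg hg gh]] := homeomorphism_inv hh.
have /nbhs_ballP[e /= e0 eN] : nbhs p (h @^-1` N) by apply: hh.1; rewrite hp.
have [k ke] : exists k : nat, k.+1%:R^-1 * 2 * 2 < e.
  exists (Num.truncn (e / 2 / 2)^-1); rewrite -!ltr_pdivlMr//.
  by rewrite invf_plt ?posrE ?divr_gt0//; exact: truncnS_gt.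
have [cM nM Mh] := gM k.+1.
exists (h @` M k.+1); split.
- exact: continuous_compact_image hh.1 cM.
- by exists p.
- by move=> _ [z Mz <-]; apply: (eN z); apply: le_ball (ltW ke) _ _; exact: Md.
- move=> h' hh'; have [c0 [z [Mz nz]]] := Mh _ (homeomorphism_comp gg hh').
  have e1 : h @` M k.+1 `\` h' @` F = h @` (M k.+1 `\` (g \o h') @` F).
    apply/seteqP; split=> [_ [[w Mw <-] nw]|_ [w [Mw nw] <-]].
      by exists w => //; split => // -[u Fu /= gu]; apply: nw; exists u => //;
        rewrite -gu gh.
    by split; [exists w|move=> [u Fu hu]; apply: nw; exists u => //=; rewrite hu hg].
  rewrite e1; split; first exact: continuous_connected_image hh.1 c0.
  by exists (h z); exists z.
Qed.

End thin_of_cantor.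

(** * Weak infinite-dimensionality and the C-property *)

Section resolution.
Variables (X : topologicalType) (Test : Type) (valid : Test -> Prop)
  (res : Test -> set X -> Prop).
Hypothesis hX : hausdorff_space X.
Hypothesis res_open : forall t V, res t V -> open V.
Hypothesis res_glue : forall t V V' S S', valid t -> res t V -> res t V' ->
  closed S -> closed S' -> S `&` S' = set0 ->
  exists V'', [/\ res t V'', S `&` V `<=` V'' & S' `&` V' `<=` V''].
Hypothesis res_homeo : forall t (h : X -> X), valid t -> homeomorphism h ->
  exists t', valid t' /\ forall V, res t' V -> res t (h @` V).

(* A test is, for weak infinite-dimensionality, a pair of disjoint closed sets,
   solved by the complements of the partitions, and, for the C-property, an open
   cover, solved by the unions of disjoint open refinements. *)
Definition resolved (t : nat -> Test) (S : set X) : Prop :=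
  exists V : nat -> set X, (forall i, res (t i) (V i)) /\ S `<=` \bigcup_i V i.

Definition negligible (S : set X) : Prop :=
  forall t, (forall i, valid (t i)) -> resolved t S.

Lemma resolved_subset (t : nat -> Test) (S S' : set X) :
  S `<=` S' -> resolved t S' -> resolved t S.
Proof. by move=> SS' [V [tV S'V]]; exists V; split => //; exact: subset_trans S'V. Qed.

Lemma negligible_subset (S S' : set X) : S `<=` S' -> negligible S' -> negligible S.
Proof. by move=> SS' nS' t /nS'; exact: resolved_subset. Qed.

(** The tests of even index are spent on [S], those of odd index on [S']. *)
Lemma negligible_setU (S S' : set X) :
  negligible S -> negligible S' -> negligible (S `|` S').
Proof.
move=> nS nS' t vt.
have [V [tV SV]] := nS (fun i => t i.*2) (fun i => vt _).
have [V' [tV' SV']] := nS' (fun i => t i.*2.+1) (fun i => vt _).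
exists (fun n => if odd n then V' n./2 else V n./2); split.
  by move=> n; rewrite -[in t n](odd_double_half n); case: odd;
    [exact: tV'|exact: tV].
move=> z [/SV[i _ Vz]|/SV'[i _ Vz]].
  by exists i.*2 => //; rewrite odd_double doubleK.
by exists i.*2.+1 => //=; rewrite odd_double /= uphalf_double.
Qed.

Lemma negligible_homeo (S : set X) (h : X -> X) :
  homeomorphism h -> negligible S -> negligible (h @` S).
Proof.
move=> hh nS t vt.
have /choice[t' t'P] : forall i, exists t',
    valid t' /\ forall V, res t' V -> res (t i) (h @` V).
  by move=> i; exact: res_homeo.
have [V [tV SV]] := nS t' (fun i => (t'P i).1).
exists (fun i => h @` V i); split=> [i|]; first exact: (t'P i).2.
by move=> _ [z /SV[i _ Vz] <-]; exists i => //; exists z.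
Qed.

(** By compactness the first [k] tests already settle [M1] and [M2] separately. The tail of the
    sequence is spent on [F], with union [Q]; outside [Q] the two compacta are disjoint, so their
    solutions of the first [k] tests can be glued. *)
Lemma resolved_amalgam (t : nat -> Test) (F M1 M2 : set X) :
  (forall i, valid (t i)) -> negligible F -> compact M1 -> compact M2 ->
  M1 `&` M2 `<=` F -> resolved t M1 -> resolved t M2 -> resolved t (M1 `|` M2).
Proof.
move=> vt nF cM1 cM2 MF [V1 [tV1 MV1]] [V2 [tV2 MV2]].
have [k1 Mk1] := compact_bigcup_nat cM1 (fun i => res_open (tV1 i)) MV1.
have [k2 Mk2] := compact_bigcup_nat cM2 (fun i => res_open (tV2 i)) MV2.
pose k := maxn k1 k2.
have [VF [tVF FVF]] := nF (fun i => t (k + i)%N) (fun i => vt _).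
pose Q := \bigcup_i VF i.
have oQ : open Q by apply: bigcup_open => i _; exact: res_open (tVF i).
have clQ (M : set X) : compact M -> closed (M `\` Q).
  by move=> cM; rewrite setDE; apply: closedI; [exact: compact_closed|rewrite closedC].
have MQ0 : (M1 `\` Q) `&` (M2 `\` Q) = set0.
  by apply/seteqP; split=> z // -[[M1z nQz] [M2z _]]; apply/nQz/FVF/MF.
have /choice[W WP] : forall i, exists V'', [/\ res (t i) V'',
    (M1 `\` Q) `&` V1 i `<=` V'' & (M2 `\` Q) `&` V2 i `<=` V''].
  by move=> i; apply: res_glue => //; exact: clQ.
exists (fun n => if (n < k)%N then W n else VF (n - k)%N); split.
  move=> n; case: ltnP => [_|kn]; first by have [] := WP n.
  by have := tVF (n - k)%N; rewrite subnKC.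
move=> z Mz; have [[i _ Fz]|nQz] := pselect (Q z).
  by exists (k + i)%N => //; rewrite ltnNge leq_addr/= addKn.
case: Mz => Mz.
  have [i /= ik Vz] := Mk1 z Mz; exists i => //.
  by rewrite (leq_trans ik (leq_maxl _ _)); have [_ + _] := WP i; apply.
have [i /= ik Vz] := Mk2 z Mz; exists i => //.
by rewrite (leq_trans ik (leq_maxr _ _)); have [_ _] := WP i; apply.
Qed.

(** Minimality refers to one unresolved sequence [t], whereas [F] must be negligible for all
    sequences, because amalgamation spends a tail of [t] on it. *)
Lemma negligible_cantor (B : set X) : compact B -> ~ negligible B ->
  exists M, [/\ compact M, M `<=` B, ~ negligible M &
    forall F, compact F -> negligible F -> connected (M `\` F) /\ M `\` F !=set0].
Proof.
move=> cB /existsNP[t /not_implyP[vt nB]].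
have [Z cZ [V [tV ZV]]|M [cM MB nM minM]] := minimal_failing hX (Pr := resolved t) _ cB nB.
  exists (\bigcup_i V i); split => //.
    by apply: bigcup_open => i _; exact: res_open (tV i).
  by move=> Z' _ Z'V; exists V.
have nnM : ~ negligible M by move=> /(_ t vt).
exists M; split => // F cF nF; split.
  apply: (minimal_connected hX cM nM minM cF) => M1 M2 cM1 cM2 MF.
  exact: (resolved_amalgam vt nF).
apply: contrapT => M0; apply: nnM; apply: negligible_subset nF => z Mz.
by apply: contrapT => nFz; apply: M0; exists z.
Qed.

End resolution.

Lemma negligible_thin (R : realType) (X : metricType R) (Test : Type)
    (valid : Test -> Prop) (res : Test -> set X -> Prop) (F B0 : set X) :
  (forall t V, res t V -> open V) ->
  (forall t V V' S S', valid t -> res t V -> res t V' ->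
    closed S -> closed S' -> S `&` S' = set0 ->
    exists V'', [/\ res t V'', S `&` V `<=` V'' & S' `&` V' `<=` V'']) ->
  (forall t (h : X -> X), valid t -> homeomorphism h ->
    exists t', valid t' /\ forall V, res t' V -> res t (h @` V)) ->
  (forall t, valid t -> exists V, res t V) ->
  homogeneous X -> compact F -> negligible valid res F ->
  compact B0 -> ~ negligible valid res B0 -> thin F.
Proof.
move=> ro rg rh rex homX cF nF cB0 nB0; have hX := @metric_hausdorff _ X.
apply: (thin_of_cantor homX (tiny := negligible valid res) cF _ _ _ cB0 nB0).
- move=> t vt; have /choice[V tV] := fun i => rex _ (vt i).
  by exists V; split => // z.
- by move=> ? ? _ _; exact: negligible_setU.
- move=> B cB nB.
  have [M [cM MB nM MF]] := negligible_cantor hX ro rg cB nB.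
  exists M; split => // h hh; apply: MF.
    exact: continuous_compact_image hh.1 cF.
  exact: negligible_homeo.
Qed.

(** * Hereditary normality of metric spaces *)

Section halfball.
Variables (R : realType) (X : metricType R).

(* The balls of half the radius make extensions of disjoint relatively open
   subsets of [Z] disjoint. *)
Definition half_ball_hull (Z S : set X) : set X :=
  [set x | exists s r, [/\ S s, 0 < r, ball s r `&` Z `<=` S & ball s (r / 2) x]].

Lemma half_ball_hull_open (Z S : set X) : open (half_ball_hull Z S).
Proof.
rewrite openE => x [s [r [Ss r0 sZ sx]]].
apply: filterS (open_nbhs_nbhs (conj (@metric_ball_open _ _ s (r / 2)) sx)) => y sy.
by exists s, r.
Qed.

(** At a common point the two centres are closer than the larger radius, so the centre with the
    smaller radius would belong to both sets. *)
Lemma half_ball_hull_disjoint (Z S S' : set X) : S `<=` Z -> S' `<=` Z ->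
  S `&` S' = set0 -> half_ball_hull Z S `&` half_ball_hull Z S' = set0.
Proof.
move=> SZ S'Z SS'; apply/seteqP; split=> x //.
move=> [[s [r [Ss r0 sS sx]]] [s' [r' [S's' r'0 s'S s'x]]]].
have [rr'|r'r] := leP r r'.
  have : (S `&` S') s; last by rewrite SS'.
  split => //; apply: s'S; split; last exact: SZ.
  rewrite [r']splitr; apply: ball_triangle s'x _; apply: ball_sym.
  by apply: le_ball sx; rewrite ler_pM2r// invr_gt0.
have : (S `&` S') s'; last by rewrite SS'.
split => //; apply: sS; split; last exact: S'Z.
rewrite [r]splitr; apply: ball_triangle sx _; apply: ball_sym.
by apply: le_ball s'x; rewrite ler_pM2r ?invr_gt0// ltW.
Qed.

Lemma sub_half_ball_hull (Z S O : set X) : open O -> Z `&` O = S ->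
  S `<=` half_ball_hull Z S.
Proof.
move=> oO ZO s Ss; have Os : O s by move: Ss; rewrite -ZO => -[].
have /nbhs_ballP[r /= r0 rO] := open_nbhs_nbhs (conj oO Os).
exists s, r; split => //; first by rewrite -ZO => x [/rO Ox Zx].
by apply: ballxx; rewrite divr_gt0.
Qed.

(** Separated sets are disjoint and relatively open in their union, which is what the hulls require;
    closedness is not assumed. *)
Lemma separated_open_hull (P Q : set X) : separated P Q ->
  exists V W, [/\ open V, open W, V `&` W = set0, P `<=` V & Q `<=` W].
Proof.
move=> [PQ1 PQ2]; pose Z := P `|` Q.
exists (half_ball_hull Z P), (half_ball_hull Z Q); split.
- exact: half_ball_hull_open.
- exact: half_ball_hull_open.
- apply: half_ball_hull_disjoint => [z|z|]; [by left|by right|].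
  apply/seteqP; split=> z // -[Pz Qz]; rewrite -PQ1; split => //.
  exact: subset_closure.
- apply: (@sub_half_ball_hull _ _ (~` closure Q)).
    by rewrite openC; exact: closed_closure.
  apply/seteqP; split=> z.
    by move=> [[//|Qz] nQz]; exfalso; apply: nQz; exact: subset_closure.
  move=> Pz; split; first by left.
  by move=> cQ; have : (P `&` closure Q) z by []; rewrite PQ2.
- apply: (@sub_half_ball_hull _ _ (~` closure P)).
    by rewrite openC; exact: closed_closure.
  apply/seteqP; split=> z.
    by move=> [[Pz|//] nPz]; exfalso; apply: nPz; exact: subset_closure.
  move=> Qz; split; first by right.
  by move=> cP; have : (closure P `&` Q) z by []; rewrite PQ1.
Qed.

End halfball.

(** * Homeomorphisms and embeddings *)

Lemma homeomorphism_open (X Y : topologicalType) (h : X -> Y) (V : set X) :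
  homeomorphism h -> open V -> open (h @` V).
Proof.
move=> /homeomorphism_inv[g [gg hg gh]] oV; rewrite (image_cancel _ hg gh).
by apply: open_comp => // x _; exact: gg.1.
Qed.

Lemma homeomorphism_preimage_closed (X Y : topologicalType) (h : X -> Y) (V : set Y) :
  homeomorphism h -> closed V -> closed (h @^-1` V).
Proof. by move=> hh cV; apply: closed_comp => // x _; exact: hh.1. Qed.

Lemma homeomorphism_preimage_open (X Y : topologicalType) (h : X -> Y) (V : set Y) :
  homeomorphism h -> open V -> open (h @^-1` V).
Proof. by move=> hh oV; apply: open_comp => // x _; exact: hh.1. Qed.

(** Subsets of subsets of [U] are nested sigma types; their composite inclusions into [X] are
    treated uniformly as embeddings, so that compacta can be studied in [X] itself. *)
Definition embedding (Y X : topologicalType) (j : Y -> X) : Prop :=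
  injective j /\ forall V : set Y, open V <-> exists2 O, open O & V = j @^-1` O.

Lemma embedding_closed (Y X : topologicalType) (j : Y -> X) (A : set Y) :
  embedding j -> closed A <-> exists2 C, closed C & A = j @^-1` C.
Proof.
move=> [_ jo]; split=> [cA|[C cC ->]].
  have [Q oQ AQ] : exists2 Q, open Q & ~` A = j @^-1` Q by apply/jo; rewrite openC.
  by exists (~` Q); rewrite ?closedC// -[A]setCK AQ.
rewrite -openC; apply/jo; exists (~` C) => //; by rewrite openC.
Qed.

Lemma embedding_set_val (X : topologicalType) (A : set X) :
  embedding (set_val : set_type A -> X).
Proof.
split; first exact: val_inj.
by move=> V; split=> [[Q oQ <-]|[Q oQ ->]]; exists Q.
Qed.

Lemma embedding_comp (Z Y X : topologicalType) (j : Y -> X) (k : Z -> Y) :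
  embedding j -> embedding k -> embedding (j \o k).
Proof.
move=> [ij jo] [ik ko]; split; first exact: inj_comp.
move=> V; split=> [/ko[V' /jo[Q oQ ->] ->]|[Q oQ ->]]; first by exists Q.
by apply/ko; exists (j @^-1` Q) => //; apply/jo; exists Q.
Qed.

Lemma embedding_compact (Y X : topologicalType) (j : Y -> X) (Z : set X) :
  embedding j -> compact Z -> Z `<=` range j -> compact (j @^-1` Z).
Proof.
move=> ej cZ Zj F FF FZ; pose G := j @ F.
have [z [Zz Gz]] := cZ G _ FZ; have [y _ yz] := Zj z Zz.
exists y; split; first by rewrite /= yz.
move=> S N FS; rewrite nbhsE => -[V [/ej.2[W oW VW] Vy] VN].
have GS : G (j @` S).
  have -> : G (j @` S) = F (j @^-1` (j @` S)) by [].
  by apply: filterS FS => x Sx; exists x.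
have Wz : W z by rewrite -yz; move: Vy; rewrite VW.
have [_ [[x Sx <-] Wx]] := Gz _ W GS (open_nbhs_nbhs (conj oW Wz)).
by exists x; split => //; apply: VN; rewrite VW.
Qed.

Lemma embedding_connected (Y X : topologicalType) (j : Y -> X) (Z : set X) :
  embedding j -> connected Z -> Z `<=` range j -> connected (j @^-1` Z).
Proof.
move=> ej cZ Zj B [b Bb] [C1 /ej.2[W1 oW1 CW1] BC1] [C2 /(embedding_closed _ ej)[W2 cW2 CW2] BC2].
have B1 y : B y <-> Z (j y) /\ W1 (j y) by rewrite BC1 CW1.
have B2 y : B y <-> Z (j y) /\ W2 (j y) by rewrite BC2 CW2.
have ZW : Z `&` W1 = Z.
  apply: cZ.
  - by exists (j b); apply/B1.
  - by exists W1.
  - exists W2 => //; apply/seteqP; split=> z [Zz Wz]; split => //;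
      have [y _ yz] := Zj z Zz; rewrite -yz; rewrite -yz in Zz Wz.
      by have /B2[] : B y by apply/B1.
    by have /B1[] : B y by apply/B2.
apply/seteqP; split=> y; first by move=> /B1[].
by move=> Zy; apply/B1; have : Z (j y) by []; rewrite -{1}ZW.
Qed.

Lemma embedding_separation (Y X : topologicalType) (j : Y -> X) (V W : set Y)
    (z : X) : embedding j -> open W -> V `&` W = set0 -> closure (j @` V) z ->
  ~ (j @` W) z.
Proof.
move=> [ij jo] /jo[Q oQ WQ] VW cz [w Ww wz].
have Qz : Q z by rewrite -wz; move: Ww; rewrite WQ.
have [_ [[v Vv <-] Qv]] := cz Q (open_nbhs_nbhs (conj oQ Qz)).
by have : (V `&` W) v; [split => //; rewrite WQ|rewrite VW].
Qed.

Lemma closure_disjoint_open (X : topologicalType) (V W : set X) (z : X) :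
  open W -> V `&` W = set0 -> closure V z -> ~ W z.
Proof.
move=> oW VW cz Wz; have := cz W (open_nbhs_nbhs (conj oW Wz)).
by rewrite VW => -[].
Qed.

Lemma metrizable_set_type (R : realType) (X : metricType R) (A : set X) :
  metrizable R (set_type A).
Proof.
exists (fun x y => mdist (set_val x) (set_val y)); split.
- move=> x y; split; first exact: mdist_ge0.
  by split=> [/mdist_positivity/val_inj//|->]; exact: mdistxx.
- by move=> x y; exact: metric_sym.
- by move=> x y z; exact: metric_triangle.
- move=> x U; split.
    move=> [_ [[Q oQ <-] /= Qx QU]].
    have /nbhs_ballP[e /= e0 eQ] := open_nbhs_nbhs (conj oQ Qx).
    exists e => // y /= xy; apply: QU; apply: eQ.
    by rewrite ballEmdist.
  move=> [e e0 eU]; exists (set_val @^-1` ball (set_val x) e); split.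
  + by exists (ball (set_val x) e) => //; exact: metric_ball_open.
  + exact: ballxx.
  + by move=> y; rewrite /= ballEmdist => /eU.
Qed.

(** * Partitions and weak infinite-dimensionality *)

Section wid.
Variables (R : realType) (X : metricType R).
Let hX := @metric_hausdorff _ X.

Definition wid_valid (t : set X * set X) : Prop :=
  [/\ closed t.1, closed t.2 & t.1 `&` t.2 = set0].

Definition wid_res (t : set X * set X) (S : set X) : Prop :=
  exists V W, [/\ open V, open W, V `&` W = set0, t.1 `<=` V /\ t.2 `<=` W
    & S = V `|` W].

Lemma wid_res_open t V : wid_res t V -> open V.
Proof. by move=> [V1 [W1 [oV oW _ _ ->]]]; exact: openU. Qed.

Lemma wid_res_ex t : wid_valid t -> exists V, wid_res t V.
Proof.
case: t => A B [/= cA cB AB].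
have [V [W [oV oW VW AV BW]]] : exists V W,
    [/\ open V, open W, V `&` W = set0, A `<=` V & B `<=` W].
  apply: separated_open_hull; split.
    by rewrite -((closure_id A).1 cA).
  by rewrite -((closure_id B).1 cB).
by exists (V `|` W), V, W.
Qed.

(** Adding to [A] the parts of [V1] in [S] and of [V2] in [S'], and likewise for [B] with [W1] and
    [W2], gives two separated sets; disjoint open hulls of them form the common solution. *)
Lemma wid_res_glue t V V' S S' : wid_valid t -> wid_res t V -> wid_res t V' ->
  closed S -> closed S' -> S `&` S' = set0 ->
  exists V'', [/\ wid_res t V'', S `&` V `<=` V'' & S' `&` V' `<=` V''].
Proof.
case: t => A B [/= cA cB AB] [V1 [W1 [oV1 oW1 VW1 [/= AV1 BW1] ->]]].
move=> [V2 [W2 [oV2 oW2 VW2 [/= AV2 BW2] ->]]] cS cS' SS'.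
clear V V'.
have dis (P Q : set X) z : P `&` Q = set0 -> P z -> Q z -> False.
  by move=> PQ Pz Qz; have : (P `&` Q) z by []; rewrite PQ.
have sep (A' B' V1' W1' V2' W2' : set X) : closed A' -> A' `&` B' = set0 ->
    open W1' -> open W2' -> V1' `&` W1' = set0 -> V2' `&` W2' = set0 ->
    A' `<=` V1' -> A' `<=` V2' -> B' `<=` W1' -> B' `<=` W2' ->
    closure (A' `|` S `&` V1' `|` S' `&` V2') `&` (B' `|` S `&` W1' `|` S' `&` W2') = set0.
  move=> cA' AB' oW1' oW2' VW1' VW2' AV1' AV2' BW1' BW2'.
  apply/seteqP; split=> z // -[]; rewrite !closureU => clz Qz.
  have cS1 (T V0 : set X) : closed T -> closure (T `&` V0) z -> T z /\ closure V0 z.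
    move=> cT c; split; last by apply: closureS c => y [].
    by rewrite ((closure_id T).1 cT); apply: closureS c => y [].
  case: clz => [[]|].
  - rewrite -((closure_id A').1 cA') => Az.
    case: Qz => [[Bz|[_ Wz]]|[_ Wz]]; first exact: dis AB' Az Bz.
      exact: dis VW1' (AV1' _ Az) Wz.
    exact: dis VW2' (AV2' _ Az) Wz.
  - move=> /(cS1 _ _ cS)[Sz cVz]; have nW := closure_disjoint_open oW1' VW1' cVz.
    case: Qz => [[Bz|[_ Wz]]|[S'z _]] //; first exact: nW (BW1' _ Bz).
    exact: dis SS' Sz S'z.
  - move=> /(cS1 _ _ cS')[S'z cVz]; have nW := closure_disjoint_open oW2' VW2' cVz.
    case: Qz => [[Bz|[Sz _]]|[_ Wz]] //; first exact: nW (BW2' _ Bz).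
    exact: dis SS' Sz S'z.
have [V [W [oV oW VW PV QW]]] : exists V W, [/\ open V, open W, V `&` W = set0,
    A `|` S `&` V1 `|` S' `&` V2 `<=` V & B `|` S `&` W1 `|` S' `&` W2 `<=` W].
  apply: separated_open_hull; split; first exact: sep.
  by rewrite setIC; apply: sep => //; rewrite setIC.
exists (V `|` W); split.
- exists V, W; split => //=; split=> z ?; [apply: PV|apply: QW]; by left; left.
- by move=> z [Sz [?|?]]; [left; apply: PV|right; apply: QW]; left; right.
- by move=> z [Sz [?|?]]; [left; apply: PV|right; apply: QW]; right.
Qed.

Lemma wid_res_homeo t (h : X -> X) : wid_valid t -> homeomorphism h ->
  exists t', wid_valid t' /\ forall V, wid_res t' V -> wid_res t (h @` V).
Proof.
case: t => A B [/= cA cB AB] hh; exists (h @^-1` A, h @^-1` B); split.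
  split; try exact: homeomorphism_preimage_closed.
  by rewrite /= -preimage_setI AB preimage_set0.
have [g [gg hg gh]] := homeomorphism_inv hh.
move=> _ [V [W [oV oW VW [/= AV BW] ->]]]; exists (h @` V), (h @` W); split.
- exact: homeomorphism_open.
- exact: homeomorphism_open.
- by rewrite !(image_cancel _ hg gh) -preimage_setI VW preimage_set0.
- by split=> z zz; exists (g z); rewrite ?gh//; [apply: AV|apply: BW]; rewrite /= gh.
- exact: image_setU.
Qed.

(** A partition of the traces in [Y] is carried back to [X]: the closed pair, enlarged by the two
    open sides restricted to [Z], is separated in [X] because [Z] is closed. *)
Lemma wid_negligible (Y : topologicalType) (j : Y -> X) (Z : set X) :
  embedding j -> weakly_infinite_dimensional R Y -> compact Z -> Z `<=` range j ->
  negligible wid_valid wid_res Z.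
Proof.
move=> ej [_ wY] cZ Zj t vt; have clZ := compact_closed hX cZ.
have [i|L LP L0] := wY (fun i => j @^-1` (t i).1) (fun i => j @^-1` (t i).2).
  have [c1 c2 AB] := vt i; split.
  - by apply/(embedding_closed _ ej); exists (t i).1.
  - by apply/(embedding_closed _ ej); exists (t i).2.
  - by rewrite -preimage_setI AB preimage_set0.
have /choice[S SP] : forall i, exists S, wid_res (t i) S /\
    ~` L i `&` j @^-1` Z `<=` j @^-1` S.
  move=> i; have [cL [V [W [oV oW VW LVW [AV BW]]]]] := LP i.
  have [c1 c2 AB] := vt i.
  have sep (A B : set X) (V' W' : set Y) : closed A -> A `&` B = set0 ->
      j @^-1` A `<=` V' -> j @^-1` B `<=` W' -> open W' -> V' `&` W' = set0 ->
      closure (A `|` Z `&` j @` V') `&` (B `|` Z `&` j @` W') = set0.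
    move=> cA AB' AV' BW' oW' VW'; apply/seteqP; split=> z // -[].
    rewrite closureU => -[cAz|clz] Qz.
      have Az : A z by rewrite ((closure_id A).1 cA).
      case: Qz => [Bz|[_ [w Ww wz]]].
        by have : (A `&` B) z by []; rewrite AB'.
      have : (V' `&` W') w by split => //; apply: AV'; rewrite /= wz.
      by rewrite VW'.
    have Zz : Z z by rewrite ((closure_id Z).1 clZ); apply: closureS clz => y [].
    have nW := embedding_separation ej oW' VW' (closureS (@subIsetr _ _ _) clz).
    case: Qz => [Bz|[_ Wz]]; last exact: nW.
    have [y _ yz] := Zj z Zz; apply: nW; exists y => //; apply: BW'.
    by rewrite /= yz.
  have [V' [W' [oV' oW' VW' PV QW]]] : exists V' W', [/\ open V', open W',
      V' `&` W' = set0, (t i).1 `|` Z `&` j @` V `<=` V'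
      & (t i).2 `|` Z `&` j @` W `<=` W'].
    apply: separated_open_hull; split; first exact: sep.
    by rewrite setIC; apply: sep => //; rewrite setIC.
  exists (V' `|` W'); split.
    by exists V', W'; split => //; split=> z ?; [apply: PV|apply: QW]; left.
  rewrite LVW => y [[Vy|Wy] Zy]; [left; apply: PV|right; apply: QW];
  by right; split => //; exists y.
exists S; split=> [i|z Zz]; first exact: (SP i).1.
have [y _ yz] := Zj z Zz.
have [i nLi] : exists i, ~ L i y.
  apply: contrapT => /forallNP nL; have : (\bigcap_i L i) y.
    by move=> i _; apply: contrapT; exact: nL.
  by rewrite L0.
by exists i => //; rewrite -yz; apply: (SP i).2; split => //; rewrite /= yz.
Qed.

(** Countable sum theorem: the test of index [pickle (k, i)] is spent on [Z k], so one sequence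
    serves all the compacta. Its solution on [Z k] is then enlarged to a partition in the whole of
    [U]. *)
Lemma wid_of_negligible (U : set X) (Z : nat -> set X) :
  (forall k, compact (Z k)) -> (forall k, Z k `<=` U) -> U `<=` \bigcup_k Z k ->
  (forall k, negligible wid_valid wid_res (Z k)) ->
  weakly_infinite_dimensional R (set_type U).
Proof.
move=> cZ ZU UZ nZ; split; first exact: metrizable_set_type.
move=> A B AB; pose j := @set_val X U; have ej := embedding_set_val U : embedding j.
have rj z : U z -> exists y, j y = z by move=> Uz; exists (SigSub (mem_set Uz)).
have jU y : U (j y) by exact: set_valP.
have tr (A' : set (set_type U)) k : closed A' -> closed (j @` A' `&` Z k).
  move=> /(embedding_closed _ ej)[C cC ->].
  suff -> : j @` (j @^-1` C) `&` Z k = C `&` Z k.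
    by apply: closedI => //; exact: compact_closed.
  apply/seteqP; split=> z; first by move=> [[y Cy <-]].
  by move=> [Cz Zz]; split => //; have [y yz] := rj z (ZU _ _ Zz);
    exists y => //=; rewrite yz.
have djAB i z : (j @` A i) z -> (j @` B i) z -> False.
  have [_ _ ABi] := AB i; move=> [y Ay <-] [y' By' yy'].
  have : (A i `&` B i) y by split => //; rewrite -(ej.1 _ _ yy').
  by rewrite ABi.
have /choice[V VP] : forall k, exists V : nat -> set X, (forall i, wid_res
    (j @` A (pickle (k, i)) `&` Z k, j @` B (pickle (k, i)) `&` Z k) (V i)) /\
    Z k `<=` \bigcup_i V i.
  move=> k; apply: (nZ k (fun i => (j @` A (pickle (k, i)) `&` Z k, j @` B (pickle (k, i)) `&` Z k))) => i.
  have [cA cB _] := AB (pickle (k, i)).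
  split; [exact: tr|exact: tr|].
  by apply/seteqP; split=> z // [[jA _] [jB _]]; exact: djAB jA jB.
have /choice[VW VWP] : forall n, exists VW : set X * set X,
    [/\ open VW.1, open VW.2, VW.1 `&` VW.2 = set0,
      j @` A n `<=` VW.1 /\ j @` B n `<=` VW.2 & forall k i, pickle_inv n = Some (k, i) ->
      Z k `&` V k i `<=` VW.1 `|` VW.2].
  move=> n; have [cA cB _] := AB n.
  suff [k [V1 [W1 [cZk ZkU [oV1 oW1 VW1] [AV BW] Vki]]]] :
      exists Zk V1 W1, [/\ compact Zk, Zk `<=` U, [/\ open V1, open W1 & V1 `&` W1 = set0],
        j @` A n `&` Zk `<=` V1 /\ j @` B n `&` Zk `<=` W1 &
        forall k i, pickle_inv n = Some (k, i) -> Z k `&` V k i `<=` Zk `&` (V1 `|` W1)].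
    have clZk := compact_closed hX cZk.
    have sep (A' B' : set (set_type U)) (V' W' : set X) : closed A' ->
        (forall z, (j @` A') z -> (j @` B') z -> False) ->
        j @` A' `&` k `<=` V' -> j @` B' `&` k `<=` W' -> open W' -> V' `&` W' = set0 ->
        closure (j @` A' `|` k `&` V') `&` (j @` B' `|` k `&` W') = set0.
      move=> /(embedding_closed _ ej)[C cC AC] AB' AV' BW' oW' VW'.
      (* The image of a closed set of [U] need not be closed in [X]; a closed [C] inducing it
         suffices, since all points compared lie in [U]. *)
      have cA' z : closure (j @` A') z -> C z.
        rewrite ((closure_id C).1 cC); apply: closureS => _ [y + <-].
        by rewrite AC.
      apply/seteqP; split=> z // -[]; rewrite closureU => -[/cA' Cz|clz].
        move=> [[y By yz]|[kz Wz]].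
          by apply: (AB' z); exists y => //; rewrite AC /= yz.
        have [y yz] := rj z (ZkU _ kz).
        have Vz : V' z by apply: AV'; split => //; exists y => //; rewrite AC /= yz.
        by have : (V' `&` W') z by []; rewrite VW'.
      have kz : k z by rewrite ((closure_id k).1 clZk); apply: closureS clz => y [].
      have nW := closure_disjoint_open oW' VW' (closureS (@subIsetr _ _ _) clz).
      by move=> [Bz|[_ Wz]]; apply: nW => //; exact: BW'.
    have [V' [W' [oV' oW' VW' PV QW]]] : exists V' W', [/\ open V', open W',
        V' `&` W' = set0, j @` A n `|` k `&` V1 `<=` V' & j @` B n `|` k `&` W1 `<=` W'].
      apply: separated_open_hull; split.
        by apply: sep => //; exact: djAB.
      rewrite setIC; apply: sep => //; last by rewrite setIC.
      by move=> z jB jA; exact: djAB jA jB.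
    exists (V', W'); split => //=.
      by split=> z ?; [apply: PV|apply: QW]; left.
    by move=> k' i /Vki ki z /ki[kz [?|?]]; [left; apply: PV|right; apply: QW]; right.
  case E : (pickle_inv n) => [[k i]|].
    have [V1 [W1 [oV1 oW1 VW1 [/= AV BW] VE]]] := (VP k).1 i.
    have nE : pickle (k, i) = n by have := @pickle_invK (nat * nat)%type n; rewrite E.
    rewrite nE in AV BW; exists (Z k), V1, W1; split => //.
    by move=> k' i' [<- <-] z [Zz Vz]; split => //; rewrite -VE.
  (* An index that codes no pair still needs a partition; the empty compactum imposes nothing on
     it. *)
  exists set0, set0, set0; split => //; try by rewrite setI0.
  - exact: compact0.
  - by split; [exact: open0|exact: open0|rewrite setI0].
exists (fun n => ~` (j @^-1` ((VW n).1 `|` (VW n).2))).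
  move=> n; have [oV oW VWn [AV BW] _] := VWP n; split.
    rewrite closedC; apply/ej.2; exists ((VW n).1 `|` (VW n).2) => //; exact: openU.
  exists (j @^-1` (VW n).1), (j @^-1` (VW n).2); split.
  - by apply/ej.2; exists (VW n).1.
  - by apply/ej.2; exists (VW n).2.
  - by rewrite -preimage_setI VWn preimage_set0.
  - by rewrite setCK preimage_setU.
  - by split=> y ?; [apply: AV|apply: BW]; exists y.
apply/seteqP; split=> y // Ly.
have [k _ Zy] := UZ _ (jU y); have [i _ Vy] := (VP k).2 _ Zy.
have [_ _ _ _ /(_ k i)] := VWP (pickle (k, i)); rewrite pickleK_inv => /(_ erefl _ (conj Zy Vy)).
exact: Ly.
Qed.

End wid.

(** * Disjoint refinements and C-spaces *)

Section cspace.
Variables (R : realType) (X : metricType R).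
Let hX := @metric_hausdorff _ X.

Definition cover_valid (G : set (set X)) : Prop :=
  (forall V, G V -> open V) /\ \bigcup_(V in G) V = [set: X].

Definition cover_res (G : set (set X)) (S : set X) : Prop :=
  exists H : set (set X), [/\ forall V, H V -> open V, trivIset H id,
    forall V, H V -> exists2 P, G P & V `<=` P & S = \bigcup_(V in H) V].

Lemma cover_res_open G V : cover_res G V -> open V.
Proof. by move=> [H [oH _ _ ->]]; apply: bigcup_open => W /oH. Qed.

Lemma cover_res_ex G : cover_valid G -> exists V, cover_res G V.
Proof.
by move=> _; exists set0, set0; split => //; rewrite bigcup_set0.
Qed.

(** Disjoint open neighbourhoods of [S] and [S'] cut the two families apart, so their union is still
    a disjoint family. *)
Lemma cover_res_glue G V V' S S' : cover_valid G -> cover_res G V -> cover_res G V' ->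
  closed S -> closed S' -> S `&` S' = set0 ->
  exists V'', [/\ cover_res G V'', S `&` V `<=` V'' & S' `&` V' `<=` V''].
Proof.
move=> _ [H [oH tH rH ->]] [H' [oH' tH' rH' ->]] cS cS' SS'.
have [P [Q [oP oQ SP SQ PQ]]] :=
  (@normal_openP R X).1 pseudometric_normal _ _ cS cS' SS'.
pose K := [set h `&` P | h in H] `|` [set h `&` Q | h in H'].
exists (\bigcup_(V in K) V); split.
- exists K; split => //.
  + by move=> _ [[h Hh <-]|[h Hh <-]]; apply: openI => //; [exact: oH|exact: oH'].
  + move=> _ _ [[h Hh <-]|[h Hh <-]] [[k Hk <-]|[k Hk <-]] [z [[hz Pz] [kz Qz]]].
    * by rewrite (tH h k Hh Hk)//; exists z.
    * by have : (P `&` Q) z by []; rewrite PQ.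
    * by have : (P `&` Q) z by []; rewrite PQ.
    * by rewrite (tH' h k Hh Hk)//; exists z.
  + move=> _ [[h /rH[g Gg hg] <-]|[h /rH'[g Gg hg] <-]]; exists g => //;
    by move=> z [/hg].
- by move=> z [Sz [h Hh hz]]; exists (h `&` P); [left; exists h|split => //; exact: SP].
- by move=> z [Sz [h Hh hz]]; exists (h `&` Q); [right; exists h|split => //; exact: SQ].
Qed.

Lemma cover_res_homeo G (h : X -> X) : cover_valid G -> homeomorphism h ->
  exists G', cover_valid G' /\ forall V, cover_res G' V -> cover_res G (h @` V).
Proof.
move=> [oG cG] hh; have [g [gg hg gh]] := homeomorphism_inv hh.
exists [set h @^-1` V | V in G]; split.
  split; first by move=> _ [V /oG oV <-]; exact: homeomorphism_preimage_open.
  apply/seteqP; split=> z // _; have : [set: X] (h z) by [].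
  by rewrite -cG => -[V GV Vz]; exists (h @^-1` V) => //; exists V.
move=> _ [H [oH tH rH ->]]; exists [set h @` V | V in H]; split.
- by move=> _ [V /oH oV <-]; exact: homeomorphism_open.
- move=> _ _ [V HV <-] [W HW <-] [_ [[z Vz <-] [w Ww /(can_inj hg) wz]]].
  by rewrite (tH V W HV HW)//; exists z; split => //; rewrite -wz.
- move=> _ [V HV <-]; have [_ [P GP <-] VP] := rH V HV.
  by exists P => // _ [z /VP Pz <-].
- apply/seteqP; split=> z.
    by move=> [w [V HV Vw] <-]; exists (h @` V); [exists V|exists w].
  by move=> [_ [V HV <-] [w Vw <-]]; exists w => //; exists V.
Qed.

Lemma C_space_negligible (Y : topologicalType) (j : Y -> X) (Z : set X) :
  embedding j -> C_space R Y -> compact Z -> Z `<=` range j ->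
  negligible cover_valid cover_res Z.
Proof.
move=> ej [_ wY] cZ Zj t vt; have clZ := compact_closed hX cZ.
have [i|H HP Hc] := wY (fun i => [set j @^-1` g | g in t i]).
  have [ot ct] := vt i; split.
    by move=> _ [g /ot og <-]; apply/ej.2; exists g.
  apply/seteqP; split=> y // _; have : [set: X] (j y) by [].
  by rewrite -ct => -[g tg gy]; exists (j @^-1` g) => //; exists g.
have /choice[g gP] : forall ih : nat * set Y, exists g : set X,
    H ih.1 ih.2 -> t ih.1 g /\ ih.2 `<=` j @^-1` g.
  move=> [i h] /=; have [Hh|nHh] := pselect (H i h); last by exists set0.
  by have [_ _ /(_ h Hh)[_ [g tg <-] hg]] := HP i; exists g.
(* The hull keeps the traces on [Z] disjoint and open in [X]; the factor [g] restores the
   refinement. *)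
pose e i h := half_ball_hull Z (Z `&` j @` h) `&` g (i, h).
have eh i h : H i h -> Z `&` j @` h `<=` e i h.
  move=> Hh z [Zz [y hy yz]]; split; last by rewrite -yz; exact: (gP (i, h) Hh).2.
  have [/(_ _ Hh)/(ej.2)[V oV hV] _ _] := HP i.
  apply: (@sub_half_ball_hull _ _ _ _ V) => //; last by split => //; exists y.
  apply/seteqP; split=> w [Zw].
    move=> Vw; split => //; have [x _ xw] := Zj w Zw; exists x => //.
    by rewrite hV /= xw.
  by move=> [x hx xw]; split => //; move: hx; rewrite hV /= xw.
exists (fun i => \bigcup_(h in H i) e i h); split.
  move=> i; have [oH tH rH] := HP i; exists [set e i h | h in H i]; split.
  - move=> _ [h Hh <-]; apply: openI; first exact: half_ball_hull_open.
    by apply: (vt i).1; exact: (gP (i, h) Hh).1.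
  - move=> _ _ [h Hh <-] [h' Hh' <-] [z [[hz _] [h'z _]]].
    suff -> : h = h' by [].
    apply: tH => //; apply: contrapT => hh'.
    have [] : (half_ball_hull Z (Z `&` j @` h) `&` half_ball_hull Z (Z `&` j @` h')) z by [].
    suff : half_ball_hull Z (Z `&` j @` h) `&` half_ball_hull Z (Z `&` j @` h') = set0.
      by move=> dis ? ?; have : set0 z by rewrite -dis.
    apply: half_ball_hull_disjoint; try exact: subIsetl.
    apply/seteqP; split=> w // -[[_ [y hy yw]] [_ [y' hy' y'w]]].
    by apply: hh'; exists y; split => //; rewrite -(ej.1 y' y) // yw.
  - by move=> _ [h Hh <-]; exists (g (i, h)); [exact: (gP (i, h) Hh).1|exact: subIsetr].
  - apply/seteqP; split=> z; first by move=> [h Hh ez]; exists (e i h) => //; exists h.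
    by move=> [_ [h Hh <-] ez]; exists h.
move=> z Zz; have [y _ yz] := Zj z Zz; have : [set: Y] y by [].
rewrite -Hc => -[i _ [h Hh hy]]; exists i => //; exists h => //.
by apply: eh => //; split => //; exists y.
Qed.

Lemma C_space_of_negligible (U : set X) (Z : nat -> set X) :
  (forall k, compact (Z k)) -> (forall k, Z k `<=` U) -> U `<=` \bigcup_k Z k ->
  (forall k, negligible cover_valid cover_res (Z k)) ->
  C_space R (set_type U).
Proof.
move=> cZ ZU UZ nZ; split; first exact: metrizable_set_type.
move=> G GP; pose j := @set_val X U; have ej := embedding_set_val U : embedding j.
have rj z : U z -> exists y, j y = z by move=> Uz; exists (SigSub (mem_set Uz)).
have jU y : U (j y) by exact: set_valP.
(* A test must cover all of [X], while [G] only concerns [U]; the complement of [Z k] fills the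
   gap. *)
pose T (k i : nat) : set (set X) := [set g | open g /\ exists2 P, G (pickle (k, i)) P &
  j @^-1` g `<=` P] `|` [set ~` Z k].
have /choice[V VP] : forall k, exists V : nat -> set X,
    (forall i, cover_res (T k i) (V i)) /\ Z k `<=` \bigcup_i V i.
  move=> k; apply: (nZ k (T k)) => i; split.
    by move=> _ [[]//|->]; rewrite openC; exact: compact_closed.
  apply/seteqP; split=> z // _; have [Zz|nZz] := pselect (Z k z); last first.
    by exists (~` Z k) => //; right.
  have [y yz] := rj z (ZU _ _ Zz); have [oG cG] := GP (pickle (k, i)).
  have : [set: set_type U] y by []; rewrite -cG => -[P GP' Py].
  have [V oV PV] := (ej.2 P).1 (oG _ GP').
  exists V; first by left; split => //; exists P => //; rewrite PV.
  by rewrite -yz; move: Py; rewrite PV.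
have /choice[K KP] : forall ki : nat * nat, exists H : set (set X),
    [/\ forall V, H V -> open V, trivIset H id,
      forall V, H V -> exists2 P, T ki.1 ki.2 P & V `<=` P &
      V ki.1 ki.2 = \bigcup_(V in H) V].
  by move=> [k i] /=; have [H HP] := (VP k).1 i; exists H.
(* A member that misses [Z k] may refine only the filler set; such members are dropped, which loses
   no point of [Z k]. *)
pose H (n : nat) : set (set (set_type U)) := if pickle_inv n is Some ki then
  [set j @^-1` h | h in K ki `&` [set h | h `&` Z ki.1 !=set0]] else set0.
exists H.
  move=> n; rewrite /H; case E : (pickle_inv n) => [[k i]|]; last by split.
  have nE : pickle (k, i) = n by have := @pickle_invK (nat * nat)%type n; rewrite E.
  have [oK tK rK _] := KP (k, i); split.
  - by move=> _ [h [Kh _] <-]; apply/ej.2; exists h => //; exact: oK.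
  - move=> _ _ [h [Kh _] <-] [h' [Kh' _] <-] [y [hy h'y]].
    by rewrite (tK h h' Kh Kh')//; exists (j y).
  - move=> _ [h [Kh [z [hz Zz]]] <-]; have [P [[oP [Q GQ PQ]]|/= PZ] hP] := rK h Kh.
      by exists Q; [rewrite -nE|move=> y /hP/PQ].
    by exfalso; have := hP _ hz; rewrite PZ.
apply/seteqP; split=> y // _; have [k _ Zy] := UZ _ (jU y).
have [i _] := (VP k).2 _ Zy; have [_ _ _ ->] := KP (k, i).
move=> [h Kh hy]; exists (pickle (k, i)) => //; exists (j @^-1` h) => //.
rewrite /H pickleK_inv; exists h => //; split => //.
by exists (j y).
Qed.

End cspace.

(** * Extensors *)

Lemma within_continuousP (T K : topologicalType) (A : set T) (f : T -> K) :
  {within A, continuous f} <-> forall x, A x -> forall N, nbhs (f x) N ->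
    exists V, [/\ open V, V x & forall y, A y -> V y -> N (f y)].
Proof.
rewrite subspace_continuousP; split=> cf x Ax.
  move=> N /(cf x Ax); rewrite /= /nbhs/= /within/= => nN.
  have : nbhs x [set y | A y -> N (f y)] by exact: nN.
  rewrite nbhsE => -[V [oV Vx] VN].
  by exists V; split => // y Ay Vy; exact: VN.
move=> N /(cf x Ax)[V [oV Vx VN]].
rewrite /nbhs/= /within/=; apply: filterS (open_nbhs_nbhs (conj oV Vx)) => y Vy Ay.
exact: VN.
Qed.

Section within.
Variables (T K : topologicalType).

Lemma within_eq_continuous (A : set T) (f g : T -> K) :
  (forall x, A x -> f x = g x) -> {within A, continuous f} -> {within A, continuous g}.
Proof.
move=> fg /within_continuousP cf; apply/within_continuousP => x Ax N.
rewrite -fg// => /(cf x Ax)[V [oV Vx VN]]; exists V; split => // y Ay Vy.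
by rewrite -fg//; exact: VN.
Qed.

Lemma within_comp_continuous (S : topologicalType) (A : set T) (f : T -> K)
    (p : S -> T) : {within A, continuous f} ->
  continuous p -> (forall s, A (p s)) -> continuous (f \o p).
Proof.
move=> /within_continuousP cf cp pA s N /= /(cf _ (pA s))[V [oV Vx VN]].
have nV : nbhs s (p @^-1` V) := cp s V (open_nbhs_nbhs (conj oV Vx)).
suff : nbhs s ((f \o p) @^-1` N) by [].
by apply: filterS nV => s' Vs'; exact: VN.
Qed.

Lemma within_comp_preimage (S : topologicalType) (A : set T) (f : T -> K)
    (p : S -> T) (B : set S) : {within A, continuous f} ->
  {within B, continuous p} -> (forall s, B s -> A (p s)) ->
  {within B, continuous (f \o p)}.
Proof.
move=> /within_continuousP cf /within_continuousP cp pA.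
apply/within_continuousP => s Bs N /= /(cf _ (pA s Bs))[V [oV Vx VN]].
have [W [oW Ws WV]] := cp s Bs V (open_nbhs_nbhs (conj oV Vx)).
by exists W; split => // s' Bs' Ws'; apply: VN; [exact: pA|exact: WV].
Qed.

Definition glue (A : set T) (f g : T -> K) (x : T) : K :=
  if `[< A x >] then f x else g x.

Lemma glueE1 (A : set T) (f g : T -> K) x : A x -> glue A f g x = f x.
Proof. by move=> Ax; rewrite /glue asboolT. Qed.

Lemma glueE2 (A B : set T) (f g : T -> K) x :
  (forall y, A y -> B y -> f y = g y) -> B x -> glue A f g x = g x.
Proof.
move=> fg Bx; rewrite /glue; case: asboolP => // Ax; exact: fg.
Qed.

Lemma within_glue_continuous (A B : set T) (f g : T -> K) :
  closed A -> closed B -> (forall y, A y -> B y -> f y = g y) ->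
  {within A, continuous f} -> {within B, continuous g} ->
  {within A `|` B, continuous (glue A f g)}.
Proof.
move=> cA cB fg cf cg; refine (withinU_continuous cA cB _ _).
  by refine (within_eq_continuous _ cf) => x Ax; rewrite glueE1.
by refine (within_eq_continuous _ cg) => x Bx; rewrite (glueE2 fg).
Qed.

(* [K] is an absolute extensor for the subspace [Z]; vacuously true when [K] is
   empty and [T] is not. *)
Definition extensor_on (Z : set T) : Prop :=
  forall (A : set T) (f : T -> K), closed A -> A `<=` Z -> {within A, continuous f} ->
    exists2 g : T -> K, {within Z, continuous g} & forall x, A x -> g x = f x.

Lemma extensor_on_subset (Z Z' : set T) : Z `<=` Z' ->
  extensor_on Z' -> extensor_on Z.
Proof.
move=> ZZ' eZ' A f cA AZ cf; have [g cg gf] := eZ' A f cA (subset_trans AZ ZZ') cf.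
by exists g => //; exact: continuous_subspaceW cg.
Qed.

(** The second extension problem, on [Z'], prescribes the values of the first extension on the
    overlap as well as those of [f], so the two results agree there. *)
Lemma extensor_on_setU (Z Z' : set T) : closed Z -> closed Z' ->
  extensor_on Z -> extensor_on Z' -> extensor_on (Z `|` Z').
Proof.
move=> cZ cZ' eZ eZ' A f cA AZ cf.
have [|||g cg gf] := eZ (A `&` Z) f; [exact: closedI|by move=> ? []| |].
  by refine (continuous_subspaceW _ cf) => ? [].
have gfA y : Z y -> A y -> g y = f y by move=> Zy Ay; exact: gf.
pose f' := glue Z g f.
have cf' : {within Z `|` A, continuous f'} by exact: within_glue_continuous.
have [|||g' cg' gf'] := eZ' ((Z `|` A) `&` Z') f'.
- by apply: closedI => //; exact: closedU.
- by move=> ? [].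
- by refine (continuous_subspaceW _ cf') => ? [].
have ff : forall y, (Z `|` A) y -> Z' y -> f' y = g' y.
  by move=> y ZAy Z'y; rewrite gf'.
exists (glue (Z `|` A) f' g').
  refine (@continuous_subspaceW _ _ _ ((Z `|` A) `|` Z') _ _ _).
    by move=> x [?|?]; [left; left|right].
  by apply: within_glue_continuous => //; exact: closedU.
move=> x Ax; rewrite glueE1; last by right.
by rewrite /f' (glueE2 gfA).
Qed.

Lemma extensor_on_homeo (Z : set T) (h : T -> T) : homeomorphism h ->
  extensor_on Z -> extensor_on (h @` Z).
Proof.
move=> hh eZ A f cA AZ cf; have [g [gg hg gh]] := homeomorphism_inv hh.
have [|||k ck kf] := eZ (h @^-1` A) (f \o h).
- exact: homeomorphism_preimage_closed.
- by move=> x /= /AZ[z Zz /(can_inj hg) <-].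
- refine (within_comp_preimage cf _ _) => //; apply: continuous_subspaceT.
  exact: hh.1.
exists (k \o g); last by move=> x Ax /=; rewrite kf/= gh.
refine (within_comp_preimage ck _ _); first by apply: continuous_subspaceT; exact: gg.1.
by move=> _ [z Zz <-]; rewrite hg.
Qed.

(** Turns a map on an abstract subspace into a total function on [T], the form in which
    [extensor_on] speaks of maps; [k0] is the default off the range. *)
Lemma embedding_lift (k0 : K) (S : topologicalType) (j : S -> T) (f : S -> K) :
  embedding j -> continuous f ->
  exists2 F : T -> K, {within range j, continuous F} & forall s, F (j s) = f s.
Proof.
move=> ej cf.
pose F z := if pselect (exists s, j s = z) is left e then f (projT1 (cid e)) else k0.
have Fj s : F (j s) = f s.
  rewrite /F; case: pselect => [e|]; last by case; exists s.
  by case: cid => s' /= /ej.1 ->.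
exists F => //; apply/within_continuousP => _ [s _ <-] N; rewrite Fj => Ns.
have := cf s N Ns; rewrite nbhsE => -[V [/ej.2[W oW VW] Vs] VN].
exists W; split => //; first by move: Vs; rewrite VW.
by move=> _ [s' _ <-] Ws'; rewrite Fj; apply: VN; rewrite VW.
Qed.

Lemma embedding_continuous (S : topologicalType) (j : S -> T) :
  embedding j -> continuous j.
Proof.
move=> ej; have cj : continuous j.
  by apply/continuousP => V oV; apply/ej.2; exists V.
exact: cj.
Qed.

Lemma absolute_extensor_embedding (k0 : K) (Y : topologicalType) (j : Y -> T) :
  embedding j -> absolute_extensor K Y -> extensor_on (range j).
Proof.
move=> ej aeK A f cA AZ cf; have cj := embedding_continuous ej.
have cjA : closed (j @^-1` A) by apply/(embedding_closed _ ej); exists A.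
have cv : continuous (set_val : set_type (j @^-1` A) -> Y).
  by exact: initial_continuous.
have [|g cg gf] := aeK (j @^-1` A) (f \o (j \o set_val)) cjA.
  apply: (within_comp_continuous cf).
    by move=> x; apply: continuous_comp; [exact: cv|exact: cj].
  by move=> s; exact: (set_valP s).
have [F cF Fj] := embedding_lift k0 ej cg.
exists F => // x Ax; have [y _ yx] := AZ x Ax; rewrite -yx Fj.
have Ay : (j @^-1` A) y by rewrite /= yx.
by have := gf (SigSub (mem_set Ay)); rewrite /= => ->.
Qed.

Lemma extensor_on_embedding (k0 : K) (Y : topologicalType) (j : Y -> T) :
  embedding j -> closed (range j) -> extensor_on (range j) -> absolute_extensor K Y.
Proof.
move=> ej cZ eZ A f cA cf; have eA := embedding_comp ej (embedding_set_val A).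
have [F cF Fv] := embedding_lift k0 eA cf.
have [C cC AC] := (embedding_closed _ ej).1 cA.
have rA : range (j \o (set_val : set_type A -> Y)) = C `&` range j.
  apply/seteqP; split=> [_ [a _ <-]|z [Cz [y _ yz]]].
    split; last by exists (set_val a).
    suff : (j @^-1` C) (set_val a) by [].
    by rewrite -AC; exact: set_valP.
  have Ay : A y by rewrite AC /= yz.
  by rewrite -yz; exists (SigSub (mem_set Ay)).
have [| |g cg gF] := eZ _ F _ _ cF.
- by rewrite rA; exact: closedI.
- by rewrite rA; move=> ? [].
exists (g \o j).
  by apply: (within_comp_continuous cg); [exact: embedding_continuous|move=> s; exists s].
by move=> a; rewrite /= gF ?(Fv a)//; exists a.
Qed.

Lemma range_set_val (Z : set T) : range (set_val : set_type Z -> T) = Z.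
Proof.
apply/seteqP; split=> [_ [z _ <-]|z Zz]; first exact: set_valP.
by exists (SigSub (mem_set Zz)).
Qed.

Lemma extensor_onP (k0 : K) (Z : set T) : closed Z ->
  extensor_on Z <-> absolute_extensor K (set_type Z).
Proof.
move=> cZ; have ej := embedding_set_val Z; split.
  by move=> eZ; apply: (extensor_on_embedding k0 ej); rewrite range_set_val.
by move=> /(absolute_extensor_embedding k0 ej); rewrite range_set_val.
Qed.

End within.

Lemma absolute_extensor_inhabited (K X : topologicalType) (x : X) :
  absolute_extensor K X -> exists k : K, True.
Proof.
move=> aeK; have f0 (a : set_type (@set0 X)) : K by exfalso; exact: (set_valP a).
have [|g _ _] := aeK set0 f0 closed0; last by exists (g x).
by move=> a; exfalso; exact: (set_valP a).
Qed.

(** * CW complexes are neighbourhood extensors *)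

(** A pseudometric space is given by its balls, so the distance to [G] is an infimum of radii.
    Adding the radius 1 keeps that infimum defined when no ball around [p] meets [G], and caps the
    distance. *)
Lemma capped_dist (R : realType) (P : pseudoMetricType R) (G : set P) :
  exists d : P -> R, [/\ continuous d, forall p, 0 <= d p, forall p, G p -> d p = 0
    & forall p r, d p < r -> r <= 1 -> exists2 g, G g & ball p r g].
Proof.
pose S p : set R := [set r | (0 < r /\ exists2 g, G g & ball p r g) \/ r = 1].
have S1 p : S p 1 by right.
have S0 p : lbound (S p) 0 by move=> r [[/ltW]|->//].
have iS p : has_inf (S p) by split; [exists 1|exists 0].
have lip p q e : 0 < e -> ball p e q -> inf (S q) <= inf (S p) + e.
  move=> e0 pq; rewrite -lerBlDr; apply: lb_le_inf; first by exists 1.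
  move=> r [[r0 [g Gg gr]]|->].
    rewrite lerBlDr; apply: ge_inf; first by exists 0.
    left; split; first exact: addr_gt0.
    by exists g => //; rewrite addrC; apply: ball_triangle gr; exact: ball_sym.
  rewrite lerBlDr; apply: (@le_trans _ _ 1); last by rewrite lerDl ltW.
  by apply: ge_inf; first by exists 0.
exists (fun p => inf (S p)); split.
- move=> p; apply/cvgrPdist_le => /= e e0.
  apply/nbhs_ballP; exists e => //= q pq.
  by rewrite ler_distl lerBlDr !lip//; exact: ball_sym.
- by move=> p; apply: lb_le_inf; first by exists 1.
- move=> p Gp; apply/eqP; rewrite eq_le; apply/andP; split; last first.
    by apply: lb_le_inf; first by exists 1.
  apply/ler_addgt0Pl => e e0; rewrite addr0; apply: ge_inf; first by exists 0.
  by left; split => //; exists p => //; exact: ballxx.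
- move=> p r pr r1; have rp : 0 < r - inf (S p) by rewrite subr_gt0.
  have [s Ss] := inf_adherent rp (iS p); rewrite subrKC => sr.
  case: Ss => [[s0 [g Gg pg]]|s1]; last by move: sr; rewrite s1 ltNge r1.
  by exists g => //; apply: le_ball pg; exact: ltW.
Qed.

Lemma for_continuous_sum (R : realType) (T : topologicalType) (I : Type) (s : seq I)
    (f : I -> T -> R) (x : T) : (forall i, {for x, continuous (f i)}) ->
  {for x, continuous (fun y => \sum_(i <- s) f i y)}.
Proof.
move=> cf; elim: s => [|i s IH].
  by under [X in {for x, continuous X}]funext do rewrite big_nil; exact: cvg_cst.
under [X in {for x, continuous X}]funext do rewrite big_cons.
by apply: (@continuousD _ R^o); [exact: cf|exact: IH].
Qed.

Lemma within_row_continuous (R : realType) (T : topologicalType) (n : nat) (A : set T)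
    (f : T -> 'rV[R]_n) :
  (forall i, {within A, continuous (fun x => f x ord0 i)}) -> {within A, continuous f}.
Proof.
move=> cf; rewrite subspace_continuousP => x Ax N [P nP PN].
suff : \forall y \near within A (nbhs x), forall i, P ord0 i (f y ord0 i).
  by apply: filterS => y Py; apply: PN => i j; rewrite (ord1 i).
apply: filter_forall => i.
have := cf i; rewrite subspace_continuousP => /(_ x Ax) ci.
exact: ci (nP ord0 i).
Qed.

Lemma within_coord_continuous (R : realType) (T : topologicalType) (n : nat) (A : set T)
    (f : T -> 'rV[R]_n) i :
  {within A, continuous f} -> {within A, continuous (fun x => f x ord0 i)}.
Proof.
move=> cf; apply: (@within_comp_preimage _ _ _ setT (fun v : 'rV[R]_n => v ord0 i) f A _ cf).
  by apply: continuous_subspaceT; exact: coord_continuous.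
by [].
Qed.

Lemma sqnorm_continuous (R : realType) (n : nat) : continuous (@sqnorm R n).
Proof.
move=> v; apply: for_continuous_sum => i.
under [X in {for v, continuous X}]funext do rewrite expr2.
by apply: (@continuousM R); exact: coord_continuous.
Qed.

Lemma coord_sqnorm (R : realType) (n : nat) (v : 'rV[R]_n) i :
  v ord0 i ^+ 2 <= sqnorm v.
Proof.
rewrite /sqnorm (bigD1 i)//= lerDl; apply: sumr_ge0 => j _; exact: sqr_ge0.
Qed.

Lemma sqnorm_ge0 (R : realType) (n : nat) (v : 'rV[R]_n) : 0 <= sqnorm v.
Proof. by apply: sumr_ge0 => j _; exact: sqr_ge0. Qed.

Lemma sqnormZ (R : realType) (n : nat) (c : R) (v : 'rV[R]_n) :
  sqnorm (c *: v) = c ^+ 2 * sqnorm v.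
Proof. by rewrite /sqnorm mulr_sumr; apply: eq_bigr => i _; rewrite mxE exprMn. Qed.

Lemma coord_sqrt_sqnorm (R : realType) (n : nat) (v : 'rV[R]_n) i :
  `|v ord0 i| <= Num.sqrt (sqnorm v).
Proof. by rewrite -sqrtr_sqr ler_wsqrtr// coord_sqnorm. Qed.

Lemma sqnorm_close (R : realType) (n : nat) (v w : 'rV[R]_n) (e : R) :
  sqnorm w <= 1 -> e <= 2 -> (forall i, `|v ord0 i - w ord0 i| <= e) ->
  `|sqnorm v - sqnorm w| <= n%:R * 4 * e.
Proof.
move=> w1 e2 vw; rewrite /sqnorm -sumrB (le_trans (ler_norm_sum _ _ _))//.
(* Each difference of squares is a product of a factor at most [e] and a factor at most
   [e + 2 <= 4]. *)
have -> : n%:R * 4 * e = \sum_(i < n) (4 * e).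
  by rewrite sumr_const card_ord -[RHS]mulr_natl mulrA.
apply: ler_sum => i _; rewrite subr_sqr normrM mulrC.
have wi : `|w ord0 i| <= 1.
  by rewrite (le_trans (coord_sqrt_sqnorm w i))// -sqrtr1 ler_wsqrtr.
have e0 : 0 <= e by apply: le_trans (vw i).
rewrite ler_pM//.
have -> : v ord0 i + w ord0 i = (v ord0 i - w ord0 i) + (w ord0 i + w ord0 i) by ring.
rewrite (le_trans (ler_normD _ _))//; have := ler_normD (w ord0 i) (w ord0 i).
have := vw i; lra.
Qed.

Lemma within_vanishing_continuous (R : realType) (T : topologicalType) (A B : set T)
    (f : T -> R) : closed B ->
  {within A `\` B, continuous f} -> (forall b, B b -> f b = 0) ->
  (forall b (e : R), B b -> 0 < e ->
    exists V, [/\ open V, V b & forall a, (A `\` B) a -> V a -> `|f a| < e]) ->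
  {within A, continuous f}.
Proof.
move=> cB /within_continuousP cf fB fV; apply/within_continuousP => x Ax N.
have [Bx|nBx] := pselect (B x).
  rewrite fB// => /nbhs_ballP[e /= e0 eN]; have [V [oV Vx Ve]] := fV x e Bx e0.
  exists V; split => // y Ay Vy; apply: eN; rewrite /ball/= sub0r normrN.
  have [By|nBy] := pselect (B y); first by rewrite fB// normr0.
  exact: Ve.
move=> /(cf x (conj Ax nBx))[V [oV Vx VN]]; exists (V `&` ~` B); split => //.
  by apply: openI => //; rewrite openC.
by move=> y Ay [Vy nBy]; exact: VN.
Qed.

Lemma for_row_continuous (R : realType) (T : topologicalType) (n : nat)
    (f : T -> 'rV[R]_n) (x : T) :
  (forall i, {for x, continuous (fun y => f y ord0 i)}) -> {for x, continuous f}.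
Proof.
move=> cf N [P nP PN].
suff : \forall y \near x, forall i, P ord0 i (f y ord0 i).
  by apply: filterS => y Py; apply: PN => i j; rewrite (ord1 i).
by apply: filter_forall => i; exact: cf (nP ord0 i).
Qed.

(* [z] is the disk coordinate of a map on [A] into a space with a cell attached,
   [B] the part of [A] sent outside the cell.  Since [z] need not converge at [B],
   the functions [u = 1 - |z|^2] and [u * z], which vanish on [B], are extended
   instead; their quotient extends [z] to the set [C] of the points that are close
   to [A] relative to [u^2].  Pushing it radially outwards gives [m], which reaches
   the sphere on the part [E] of the frontier of [C] near [B]. *)
Section collar.
Variables (R : realType) (T : pseudoMetricType R) (n : nat).
Variables (A B : set T) (z : T -> 'rV[R]_n).
Hypotheses (cA : closed A) (cB : closed B) (BA : B `<=` A).
Hypothesis cz : {within A `\` B, continuous z}.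
Hypothesis z1 : forall a, (A `\` B) a -> sqnorm (z a) < 1.
Hypothesis zB : forall b (e : R), B b -> 0 < e ->
  exists V, [/\ open V, V b & forall a, (A `\` B) a -> V a -> 1 - e < sqnorm (z a)].

Let u (a : T) : R := if `[< B a >] then 0 else 1 - sqnorm (z a).

Let uB b : B b -> u b = 0. Proof. by move=> Bb; rewrite /u asboolT. Qed.
Let uA a : ~ B a -> u a = 1 - sqnorm (z a). Proof. by move=> nB; rewrite /u asboolF. Qed.

Let u01 a : A a -> 0 <= u a <= 1.
Proof.
move=> Aa; have [Ba|nBa] := pselect (B a); first by rewrite uB// lexx ler01.
by rewrite uA// subr_ge0 ltW ?z1//= gerBl sqnorm_ge0.
Qed.

Let u_gt0 a : (A `\` B) a -> 0 < u a.
Proof. by move=> ABa; rewrite uA ?subr_gt0 ?z1//; case: ABa. Qed.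

Let z_le1 a i : (A `\` B) a -> `|z a ord0 i| <= 1.
Proof.
move=> /z1/ltW s1; rewrite (le_trans (coord_sqrt_sqnorm _ i))// -sqrtr1.
exact: ler_wsqrtr.
Qed.

Let u_small b (e : R) : B b -> 0 < e ->
  exists V, [/\ open V, V b & forall a, (A `\` B) a -> V a -> `|u a| < e].
Proof.
move=> Bb e0; have [V [oV Vb Ve]] := zB Bb e0; exists V; split => // a ABa Va.
have h := Ve a ABa Va; have /andP[u0 _] := u01 ABa.1; rewrite ger0_norm//.
by rewrite uA; [lra|case: ABa].
Qed.

Let cu : {within A, continuous u}.
Proof.
refine (within_vanishing_continuous cB _ uB (@u_small)).
refine (@within_eq_continuous _ _ _ (fun a => 1 - sqnorm (z a)) _ _ _).
  by move=> a [_ nBa]; rewrite uA.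
refine (@within_comp_preimage _ _ _ setT (fun v : 'rV[R]_n => 1 - sqnorm v) z _ _ cz _) => //.
apply: continuous_subspaceT => v.
have cc : {for v, continuous (fun _ : 'rV[R]_n => (1 : R))} by exact: cst_continuous.
exact: (@continuousB _ R^o _ _ _ _ cc (@sqnorm_continuous R n v)).
Qed.

Let w i (a : T) : R := u a * z a ord0 i.

Let w_le_u i a : A a -> `|w i a| <= u a.
Proof.
move=> Aa; have /andP[u0 _] := u01 Aa; rewrite /w normrM (ger0_norm u0).
have [Ba|nBa] := pselect (B a); first by rewrite uB// mul0r.
by rewrite ler_piMr// z_le1.
Qed.

Let cw i : {within A, continuous (w i)}.
Proof.
refine (within_vanishing_continuous cB _ _ _).
- have cz' := @within_coord_continuous _ _ _ _ _ i cz.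
  have cu' : {within A `\` B, continuous u} by refine (continuous_subspaceW _ cu) => ? [].
  move=> x; exact: (@continuousM R (subspace (A `\` B)) u (fun a => z a ord0 i) x (cu' x) (cz' x)).
- by move=> b Bb; rewrite /w uB// mul0r.
- move=> b e Bb e0; have [V [oV Vb Ve]] := u_small Bb e0.
  exists V; split => // a ABa Va; apply: le_lt_trans (Ve a ABa Va).
  by rewrite (le_trans (w_le_u i ABa.1))// ler_norm.
Qed.

Lemma collar_extension : exists (U : T -> R) (W : 'I_n -> T -> R),
  [/\ continuous U, forall i, continuous (W i), forall x, 0 <= U x,
      forall a, A a -> U a = u a & forall i a, A a -> W i a = w i a].
Proof.
have nT : normal_space T := pseudometric_normal.
have [|U [AU cU _]] := continuous_bounded_extension nT cA ltr01 cu.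
  by move=> a /u01/andP[u0 u1]; rewrite ger0_norm.
have /choice[W WP] : forall i, exists W : T -> R, {in A, w i =1 W} /\ continuous W.
  move=> i; have [|W [AW cW _]] := continuous_bounded_extension nT cA ltr01 (cw (i := i)).
    by move=> a Aa; have /andP[_ u1] := u01 Aa; exact: le_trans (w_le_u i Aa) u1.
  by exists W.
(* Tietze's extension may become negative; its absolute value still equals [u] on [A]. *)
exists (fun x => `|U x|), W; split => //.
- by move=> x; apply: continuous_comp; [exact: cU|exact: norm_continuous].
- by move=> i; exact: (WP i).2.
- by move=> a Aa; rewrite -(AU a (mem_set Aa)) ger0_norm//; have /andP[] := u01 Aa.
- by move=> i a Aa; rewrite -((WP i).1 a (mem_set Aa)).
Qed.

(** The constant in [|1 - sqnorm zt| <= k * U]: the part [2 * U] bounds [u = 1 - sqnorm z] at a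
    nearby point of [A], and [16 * n * U] comes from [sqnorm_close] with coordinate error
    [4 * U]. *)
Let k : R := 2 + n%:R * 16.

(** The last clause stands in for continuity of [m] at [B], where none can be expected: near [B] the
    values of [m] are close to values of [z] at nearby points of [A]. *)
Lemma collar : exists (C C0 V E : set T) (m : T -> 'rV[R]_n),
  [/\ [/\ closed C, open C0, open V & closed E],
      [/\ A `<=` C, C0 `<=` C, A `\` B `<=` C0 & B `<=` V],
      B `<=` E /\ V `&` C `\` C0 `<=` E,
      [/\ {within C `\` B, continuous m}, forall x, (C `\` B) x -> sqnorm (m x) <= 1,
          forall a, (A `\` B) a -> m a = z a
        & forall x, (E `\` B) x -> sqnorm (m x) = 1]
    & E `<=` C /\ forall b (e : R) (P : set T), B b -> 0 < e -> nbhs b P ->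
      exists Q, [/\ open Q, Q b &
        forall x, (C `\` B) x -> Q x ->
          exists2 a, (A `\` B) a & P a /\ ball (z a) e (m x)]].
Proof.
have [U [W [cU cW U0 AU AW]]] := collar_extension.
(* Being close to the graph of [(W, U)] over [A] means being close to a point of [A] at which [W]
   and [U] have nearly the same values; a distance to [A] alone would not control the values. *)
pose kap (x : T) : T * ('rV[R]_n * R) := (x, (\row_i W i x, U x)).
have ckap : continuous kap.
  have cr x : {for x, continuous (fun y => \row_i W i y : 'rV[R]_n)}.
    apply: for_row_continuous => i.
    by under [X in {for x, continuous X}]funext do rewrite mxE; exact: cW.
  move=> x N [[P Q] /= [nP [[Q1 Q2] /= [nQ1 nQ2] QQ]] PQ].
  have h1 : nbhs x ((fun y => \row_i W i y : 'rV[R]_n) @^-1` Q1) := cr x _ nQ1.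
  have h2 : nbhs x (U @^-1` Q2) := cU x _ nQ2.
  suff : nbhs x (kap @^-1` N) by [].
  apply: filterS (filterI nP (filterI h1 h2)) => y [Py [q1 q2]].
  by apply: (PQ (kap y)); split => //=; apply: (QQ (_, _)); split.
have [d [cd d0 dA dball]] := capped_dist (kap @` A).
pose D x := d (kap x).
have cD : continuous D by move=> x; apply: continuous_comp; [exact: ckap|exact: cd].
have D0 x : 0 <= D x by exact: d0.
have DA a : A a -> D a = 0 by move=> Aa; apply: dA; exists a.
have Dball x r : D x < r -> r <= 1 -> exists a, [/\ A a, ball x r a,
    `|U x - u a| < r & forall i, `|W i x - w i a| < r].
  move=> Dr r1; have [_ [a Aa <-] [/= xa [[_ wa] ua]]] := dball _ _ Dr r1.
  exists a; split => // [|i]; first by rewrite -(AU a Aa).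
  by have := wa ord0 i; rewrite !mxE -(AW i a Aa).
(* If [U x = 0] then [D x = 0], so [x] is in the closed set [A], where [U = u] vanishes only on
   [B]. *)
have U_gt0 x : D x <= U x ^+ 2 -> ~ B x -> 0 < U x.
  move=> DU nBx; rewrite lt_neqAle U0 andbT; apply/eqP => U00.
  have Dx0 : D x = 0.
    by apply/eqP; rewrite eq_le D0 andbT; move: DU; rewrite -U00 expr0n.
  have Ax : A x.
    rewrite ((closure_id A).1 cA) => N /nbhs_ballP[e /= e0 eN].
    have [||a [Aa xa _ _]] := Dball x (Order.min e 1).
    - by rewrite Dx0 lt_min e0 ltr01.
    - by rewrite ge_min lexx orbT.
    - by exists a; split => //; apply: eN; apply: le_ball xa; rewrite ge_min lexx.
  by have := u_gt0 (conj Ax nBx); rewrite -AU// -U00 ltxx.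
(* The quotient [zt] extends [z]. The ratio [mu] is 0 on [A] away from [B], and 1 on the locus
   [D = U^2] away from [B]. The factor [c] stretches by [1 + mu] and normalises whatever would leave
   the unit disk. *)
pose zt x : 'rV[R]_n := \row_i (W i x / U x).
pose mu x := D x / U x ^+ 2.
pose Nz x := Num.sqrt (sqnorm (zt x)).
pose c x := (1 + mu x) / Order.max 1 ((1 + mu x) * Nz x).
pose m x := c x *: zt x.
pose C := [set x | D x <= U x ^+ 2].
have mu01 x : (C `\` B) x -> 0 <= mu x <= 1.
  move=> [Cx nBx]; have Ux := U_gt0 x Cx nBx.
  by rewrite /mu divr_ge0 ?sqr_ge0//= ler_pdivrMr ?exprn_gt0// mul1r.
have max_gt0 x : 0 < Order.max 1 ((1 + mu x) * Nz x) by rewrite lt_max ltr01.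
(* The radius is [2 * U^2]: it exceeds [D], keeps [u a] positive so that [a] is not in [B], and
   after division by [U] leaves the error [2 * U + 2 * U] in each coordinate. *)
have key x : (C `\` B) x -> U x < 1 / 2 -> exists2 a, (A `\` B) a &
    [/\ ball x (2 * U x ^+ 2) a, u a <= 2 * U x
      & forall i, `|zt x ord0 i - z a ord0 i| <= 4 * U x].
  move=> [Cx nBx] U2; have Ux := U_gt0 x Cx nBx.
  have U22 : U x ^+ 2 <= U x / 2 by rewrite expr2 ler_pM2l//; lra.
  have Up : 0 < U x ^+ 2 by rewrite exprn_gt0.
  have [||a [Aa xa ua wa]] := Dball x (2 * U x ^+ 2).
  - by move: Cx; rewrite /C /=; lra.
  - lra.
  have ua' : u a <= 2 * U x by move: ua; rewrite ltr_norml => /andP[]; lra.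
  have nBa : ~ B a.
    by move=> Ba; move: ua; rewrite uB// subr0 ger0_norm//; lra.
  have zw i : w i a = u a * z a ord0 i by [].
  exists a => //; split => // i; rewrite mxE.
  have -> : W i x / U x - z a ord0 i =
      ((W i x - w i a) + z a ord0 i * (u a - U x)) / U x.
    by rewrite zw; field; rewrite gt_eqF.
  rewrite normrM (@gtr0_norm _ (U x)^-1) ?invr_gt0// ler_pdivrMr//.
  rewrite (le_trans (ler_normD _ _))// normrM.
  have h1 : `|z a ord0 i| * `|u a - U x| <= 2 * U x ^+ 2.
    rewrite -[leRHS]mul1r ler_pM ?z_le1//.
    by rewrite distrC ltW.
  by have := wa i; lra.
have sq_zt x : (C `\` B) x -> U x < 1 / 2 -> `|1 - sqnorm (zt x)| <= k * U x.
  move=> Cx U2; have [a ABa [_ ua za]] := key x Cx U2.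
  have := @sqnorm_close _ _ (zt x) (z a) (4 * U x) (ltW (z1 ABa)) _ za.
  have hu : 1 - sqnorm (z a) <= 2 * U x by rewrite -uA//; case: ABa.
  have hz : 0 <= 1 - sqnorm (z a) by rewrite subr_ge0 ltW ?z1.
  have -> : k * U x = 2 * U x + n%:R * 4 * (4 * U x) by rewrite /k; ring.
  move=> /(_ ltac:(lra)) h.
  have -> : 1 - sqnorm (zt x) = (1 - sqnorm (z a)) - (sqnorm (zt x) - sqnorm (z a)) by ring.
  by rewrite (le_trans (ler_normB _ _))// lerD// ger0_norm.
(* If the stretched vector is normalised, it moves by exactly [|1 - Nz|]; if not, it moves by
   [mu * Nz <= 1 - Nz]. Both are at most [|1 - Nz^2|]. *)
have mz x i : (C `\` B) x -> U x < 1 / 2 -> `|m x ord0 i - zt x ord0 i| <= k * U x.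
  move=> Cx U2; apply: le_trans (sq_zt x Cx U2).
  have /andP[m0 m1] := mu01 x Cx.
  rewrite mxE -{2}[zt x ord0 i]mul1r -mulrBl normrM.
  have N0 : 0 <= Nz x := sqrtr_ge0 _.
  have NN : Nz x ^+ 2 = sqnorm (zt x) by rewrite sqr_sqrtr// sqnorm_ge0.
  apply: (@le_trans _ _ (`|c x - 1| * Nz x)).
    by rewrite ler_wpM2l// coord_sqrt_sqnorm.
  apply: (@le_trans _ _ `|1 - Nz x|); last first.
    rewrite -NN -[1 in leRHS](expr1n _ 2) subr_sqr normrM ler_peMr//.
    by rewrite ger0_norm ?addr_ge0// lerDl.
  rewrite /c; case: (leP 1 ((1 + mu x) * Nz x)) => h.
    have Np : 0 < Nz x.
      rewrite lt_neqAle N0 andbT; apply/eqP => N00; move: h; rewrite -N00 mulr0.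
      by rewrite leNgt ltr01.
    have -> : (1 + mu x) / ((1 + mu x) * Nz x) - 1 = (1 - Nz x) / Nz x.
      by field; rewrite !gt_eqF//; lra.
    by rewrite normrM (@gtr0_norm _ (Nz x)^-1) ?invr_gt0// divfK// gt_eqF.
  rewrite divr1 addrC addKr ger0_norm//.
  by rewrite (@le_trans _ _ (1 - Nz x))// ?ler_norm//; lra.
have k0 : 0 < k by rewrite /k ltr_pwDl// mulr_ge0.
(* Away from [B], the bound on [k * U] makes [Nz] at least 1/2 on [E], and [mu = 1] there, so
   doubling reaches the sphere. *)
pose E := [set x | D x = U x ^+ 2 /\ k * U x <= 1 / 2].
have UB b : B b -> U b = 0 by move=> Bb; rewrite AU ?uB//; exact: BA.
have ckU x : {for x, continuous (fun y => k * U y)}.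
  have ck : {for x, continuous (fun _ : T => k)} by exact: cst_continuous.
  exact: (@continuousM R _ _ U x ck (cU x)).
have cU2 x : {for x, continuous (fun y => U y ^+ 2)}.
  exact: (@continuousM R _ U U x (cU x) (cU x)).
have cDU x : {for x, continuous (fun y => U y ^+ 2 - D y)}.
  exact: (@continuousB _ R^o _ _ _ _ (cU2 x) (cD x)).
exists C, [set x | D x < U x ^+ 2], [set x | k * U x < 1 / 2], E, m; split.
- split.
  + rewrite (_ : C = (fun x => U x ^+ 2 - D x) @^-1` [set r | 0 <= r]).
      by apply: closed_comp => [x _|]; [exact: cDU|exact: closed_ge].
    by apply/seteqP; split=> x /=; rewrite /C /= subr_ge0.
  + rewrite (_ : [set x | _] = (fun x => U x ^+ 2 - D x) @^-1` [set r | 0 < r]).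
      by apply: open_comp => [x _|]; [exact: cDU|exact: open_gt].
    by apply/seteqP; split=> x /=; rewrite subr_gt0.
  + rewrite (_ : [set x | _] = (fun x => k * U x) @^-1` [set r | r < 1 / 2]) //.
    by apply: open_comp => [x _|]; [exact: ckU|exact: open_lt].
  + rewrite (_ : E = (fun x => U x ^+ 2 - D x) @^-1` [set 0] `&`
        (fun x => k * U x) @^-1` [set r | r <= 1 / 2]).
      apply: closedI; first by apply: closed_comp => [x _|]; [exact: cDU|exact: closed_eq].
      by apply: closed_comp => [x _|]; [exact: ckU|exact: closed_le].
    apply/seteqP; split=> x /=; rewrite /E /=.
      by move=> [-> ?]; rewrite subrr.
    by move=> [/eqP]; rewrite subr_eq0 => /eqP ->.
- split.
  + by move=> a Aa; rewrite /C /= DA// sqr_ge0.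
  + by move=> x /= /ltW.
  + by move=> a ABa /=; rewrite DA ?exprn_gt0 ?AU ?u_gt0//; case: ABa.
  + by move=> b Bb /=; rewrite UB// mulr0 divr_gt0.
- split.
    by move=> b Bb; rewrite /E /= UB// mulr0 expr0n divr_ge0//; split => //; apply/DA/BA.
  move=> x [[/= Vx Cx] /negP]; rewrite -leNgt => C0x; split; last exact: ltW.
  by apply/eqP; rewrite eq_le Cx C0x.
- split.
  + apply: within_row_continuous => i; apply: continuous_in_subspaceT => x /set_mem[Cx nBx].
    have Ux := U_gt0 x Cx nBx; have Ux0 : U x != 0 by rewrite gt_eqF.
    have Ux20 : U x ^+ 2 != 0 by rewrite expf_neq0.
    have cmu : {for x, continuous (fun y => 1 + mu y)}.
      have cv : {for x, continuous (fun y => (U y ^+ 2)^-1)}.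
        exact: (@continuousV R _ (fun y => U y ^+ 2) x Ux20 (cU2 x)).
      have c1 : {for x, continuous (fun _ : T => (1 : R))} by exact: cst_continuous.
      exact: (@continuousD _ R^o _ _ _ _ c1 (@continuousM R _ D _ x (cD x) cv)).
    have cWU j : {for x, continuous (fun y => W j y / U y)}.
      exact: (@continuousM R _ (W j) _ x (cW j x) (@continuousV R _ U x Ux0 (cU x))).
    have czt : {for x, continuous zt}.
      apply: for_row_continuous => j.
      by under [X in {for x, continuous X}]funext do rewrite mxE; exact: cWU.
    have cNz : {for x, continuous Nz}.
      apply: (@continuous_comp _ _ _ _ (@Num.sqrt R)); last exact: sqrt_continuous.
      by apply: (@continuous_comp _ _ _ zt); [exact: czt|exact: sqnorm_continuous].
    have -> : (fun y => m y ord0 i) = (fun y => c y * (W i y / U y)).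
      by apply/funext => y; rewrite !mxE.
    have c1 : {for x, continuous (fun _ : T => (1 : R))} by exact: cst_continuous.
    have cm := @continuous_max R _ _ _ x c1 (@continuousM R _ _ _ x cmu cNz).
    have cm0 : Order.max 1 ((1 + mu x) * Nz x) != 0 by rewrite gt_eqF.
    exact: (@continuousM R _ _ _ x (@continuousM R _ _ _ x cmu (@continuousV R _ _ x cm0 cm)) (cWU i)).
  + move=> x CBx; have /andP[m0 m1] := mu01 x CBx.
    rewrite sqnormZ -(sqr_sqrtr (sqnorm_ge0 (zt x))) -/(Nz x) -exprMn.
    have N0 : 0 <= Nz x := sqrtr_ge0 _.
    rewrite -[leRHS](expr1n _ 2) lerXn2r ?nnegrE//.
      by rewrite mulr_ge0// divr_ge0 ?(ltW (max_gt0 x))// addr_ge0.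
    by rewrite /c mulrAC ler_pdivrMr// mul1r le_max lexx orbT.
  + move=> a ABa; have nBa : ~ B a by case: ABa.
    have ua := u_gt0 ABa.
    have zta : zt a = z a.
      apply/rowP => i; rewrite mxE AW ?AU ?/w; try by case: ABa.
      by rewrite mulrAC divff ?mul1r// gt_eqF.
    rewrite /m /c /Nz /mu zta DA ?mul0r ?addr0 ?mul1r; last by case: ABa.
    suff -> : Order.max 1 (Num.sqrt (sqnorm (z a))) = 1 by rewrite invr1 scale1r.
    by apply/max_idPl; rewrite -sqrtr1 ler_wsqrtr// ltW// z1.
  + move=> x [[DU kU] nBx]; have Cx : C x by rewrite /C /= DU.
    have Ux := U_gt0 x Cx nBx.
    have mu1 : mu x = 1 by rewrite /mu DU divff// gt_eqF// exprn_gt0.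
    have U2 : U x < 1 / 2.
      have : 2 * U x <= k * U x by rewrite ler_pM2r// /k lerDl mulr_ge0.
      by lra.
    have := sq_zt x (conj Cx nBx) U2; rewrite ler_norml => /andP[_ s1].
    have s4 : (1 / 2) ^+ 2 <= sqnorm (zt x) by rewrite expr2; lra.
    have N2 : 1 / 2 <= Nz x.
      by rewrite -[leLHS]ger0_norm ?divr_ge0// -sqrtr_sqr ler_wsqrtr.
    rewrite sqnormZ -(sqr_sqrtr (sqnorm_ge0 (zt x))) -/(Nz x) -exprMn /c mu1.
    have /max_idPr -> : 1 <= (1 + 1) * Nz x by lra.
    have -> : (1 + 1) / ((1 + 1) * Nz x) * Nz x = 1.
      by field; rewrite gt_eqF//; lra.
    by rewrite expr1n.
- split; first by move=> x [DU _]; rewrite /C /= DU.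
  move=> b e P Bb e0 /nbhs_ballP[r /= r0 rP].
  have k4 : 0 < k + 4 by rewrite addr_gt0.
  (* The error from [m] to [z] is at most [k * U] plus [4 * U], hence [e / (k + 4)]; the point of
     [A] found lies within [2 * U^2 <= U < r / 2]. *)
  pose t : R := Order.min (1 / 2) (Order.min (e / (k + 4)) (r / 2)).
  have t0 : 0 < t by rewrite !lt_min !divr_gt0.
  exists ((ball b (r / 2))° `&` [set x | U x < t]); split.
  + apply: openI; first exact: open_interior.
    rewrite (_ : [set x | _] = U @^-1` [set r | r < t]) //.
    by apply: open_comp => [x _|]; [exact: cU|exact: open_lt].
  + split; last by rewrite /= UB.
    by apply: nbhsx_ballx; rewrite divr_gt0.
  + move=> x CBx [/interior_subset bx /=]; rewrite !lt_min => /and3P[U2 Ue Ur].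
    have Ux : 0 < U x by case: CBx => Cx nBx; exact: U_gt0.
    have [a ABa [xa ua za]] := key x CBx U2.
    exists a => //; split.
      apply: rP; rewrite [r]splitr; apply: ball_triangle bx _.
      apply: le_ball xa; rewrite (@le_trans _ _ (U x))//; last exact: ltW.
      have : U x ^+ 2 <= U x / 2 by rewrite expr2 ler_pM2l//; lra.
      by lra.
    split => // i j; rewrite (ord1 i) /ball/= distrC.
    have h := mz x j CBx U2; have h' := za j.
    rewrite ltr_pdivlMr// in Ue.
    have -> : m x ord0 j - z a ord0 j = (m x ord0 j - zt x ord0 j) + (zt x ord0 j - z a ord0 j).
      by ring.
    rewrite (le_lt_trans (ler_normD _ _))// (le_lt_trans (lerD h h'))//.
    by rewrite -mulrDl mulrC.
Qed.

End collar.

Lemma compact_set_type (T : topologicalType) (A : set T) :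
  compact A -> compact [set: set_type A].
Proof.
move=> cA; have -> : [set: set_type A] = set_val @^-1` A.
  by apply/seteqP; split=> x // _; exact: set_valP.
by apply: embedding_compact cA _; [exact: embedding_set_val|rewrite range_set_val].
Qed.

Lemma disk_compact (R : realType) (n : nat) : compact (@disk R n).
Proof.
apply: bounded_closed_compact.
  exists 1; split; first exact: num_real.
  move=> M M1 v /= v1; apply: le_trans (ltW M1).
  have [v0|] := eqVneq (mx_norm v) 0; first by rewrite /Num.norm/= v0.
  move=> /mx_norm_neq0[[i j] vij]; rewrite /Num.norm/= vij (ord1 i)/=.
  by rewrite (le_trans (coord_sqrt_sqnorm v j))// -sqrtr1 ler_wsqrtr.
rewrite (_ : @disk R n = @sqnorm R n @^-1` [set r | r <= 1])//.
by apply: closed_comp => [v _|]; [exact: sqnorm_continuous|exact: closed_le].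
Qed.

(** Maps are total functions into [K] with values in [L] where it matters, so subcomplexes need not
    be turned into spaces of their own. *)
Definition nbhd_extensor (R : realType) (K : topologicalType) (L : set K) : Prop :=
  forall (T : pseudoMetricType R) (A : set T) (f : T -> K),
    closed A -> {within A, continuous f} -> (forall a, A a -> L (f a)) ->
    exists V g, [/\ open V, A `<=` V, {within V, continuous g},
      forall a, A a -> g a = f a & forall x, V x -> L (g x)].

(* Replaces the regularity of [K], which is only assumed to be Hausdorff. *)
Lemma fibre_margin (R : realType) (D : pseudoMetricType R) (K : topologicalType)
    (psi : D -> K) (G : set K) (p : K) :
  hausdorff_space K -> compact [set: D] -> continuous psi -> open G -> G p ->
  exists N (e : R), [/\ open N, N p, 0 < e &
    forall y y', N (psi y) -> ball y e y' -> G (psi y')].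
Proof.
move=> hK cD cpsi oG Gp.
have oG' : open (psi @^-1` G) by apply: open_comp => // x _; exact: cpsi.
have cP : compact (psi @^-1` [set p]).
  apply: subclosed_compact cD _ => //; apply: closed_comp => [x _|]; first exact: cpsi.
  by apply: accessible_closed_set1; exact: hausdorff_accessible.
have [|e e0 eG] := compact_uniform_nbhs cP oG'; first by move=> y /= ->.
have e2 : 0 < e / 2 by rewrite divr_gt0.
pose V : set D := \bigcup_(y in psi @^-1` [set p]) (ball y (e / 2))°.
have oV : open V by apply: bigcup_open => y _; exact: open_interior.
exists (~` (psi @` (~` V))), (e / 2); split => //.
- rewrite openC; apply: compact_closed => //; apply: continuous_compact_image => //.
  by apply: subclosed_compact cD _ => //; rewrite closedC.
- by move=> [y nVy yp]; apply: nVy; exists y => //; exact: nbhsx_ballx.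
- move=> y y' Ny yy'; have [y0 y0p /interior_subset yy0] : V y.
    by apply: contrapT => nVy; apply: Ny; exists y.
  apply: (eG y0 y0p); rewrite [e]splitr; exact: ball_triangle yy0 yy'.
Qed.

Lemma within_preimage_closed (T K : topologicalType) (A : set T) (f : T -> K)
    (L : set K) : closed A -> {within A, continuous f} -> closed L ->
  closed (A `&` f @^-1` L).
Proof.
move=> cA /within_continuousP cf cL x cx.
have Ax : A x by apply: cA; apply: closureS cx => ? [].
split => //; apply: contrapT => nLx.
have [|V [oV Vx VL]] := cf x Ax (~` L); first by apply: open_nbhs_nbhs; split; rewrite ?openC.
by have [y [[Ay Ly] Vy]] := cx V (open_nbhs_nbhs (conj oV Vx)); exact: (VL y).
Qed.

Section attach.
Variables (R : realType) (K : topologicalType) (n : nat).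
Notation D := (set_type (@disk R n)).
Variables (L : set K) (psi : D -> K) (inv : K -> D).
Hypotheses (hK : hausdorff_space K) (cL : closed L) (cpsi : continuous psi).
Hypothesis cinv : {within psi @` (@disk_interior R n), continuous inv}.
Hypothesis invK : forall x, disk_interior x -> inv (psi x) = x.
Hypothesis intL : forall x, disk_interior x -> ~ L (psi x).
Hypothesis bdL : forall x, disk_boundary x -> L (psi x).

Let cD : compact [set: D] := compact_set_type (@disk_compact R n).

(** The collar extends the part of [f] inside the new cell to a closed set [C], pushing it to the
    boundary sphere on [E]. There the values lie in [L], and the assumption on [L] takes over
    outside [C]. *)
Lemma nbhd_extensor_attach :
  nbhd_extensor R L -> nbhd_extensor R (L `|` psi @` (@disk_interior R n)).
Proof.
move=> exL T A f cA cf fA.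
pose B := A `&` f @^-1` L.
have cB : closed B by exact: within_preimage_closed.
have BA : B `<=` A by move=> ? [].
pose z a : 'rV[R]_n := set_val (inv (f a)).
have fAB a : (A `\` B) a -> disk_interior (inv (f a)) /\ psi (inv (f a)) = f a.
  move=> [Aa nBa]; have [La|[y iy yf]] := fA a Aa; first by exfalso; exact: nBa.
  by rewrite -yf invK.
have z1 a : (A `\` B) a -> sqnorm (z a) < 1 by move=> /fAB[].
have cz : {within A `\` B, continuous z}.
  refine (@within_comp_preimage _ _ _ setT (set_val : D -> 'rV[R]_n) (inv \o f) _ _ _ _) => //.
    by apply: continuous_subspaceT; exact: initial_continuous.
  refine (@within_comp_preimage _ _ _ (psi @` (@disk_interior R n)) inv f _ cinv _ _).
    by refine (continuous_subspaceW _ cf) => ? [].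
  by move=> a /fAB[ia <-]; exists (inv (f a)).
have csq : continuous (fun y : D => sqnorm (set_val y)).
  move=> y; apply: (@continuous_comp _ _ _ (set_val : D -> 'rV[R]_n)).
    exact: initial_continuous.
  exact: sqnorm_continuous.
(* The image of a smaller concentric disk is compact and misses [L], hence [f b]; near [b] the map
   stays out of it. *)
have zB b (e : R) : B b -> 0 < e ->
    exists V, [/\ open V, V b & forall a, (A `\` B) a -> V a -> 1 - e < sqnorm (z a)].
  move=> [Ab Lb] e0; pose Q := [set y : D | sqnorm (set_val y) <= 1 - e].
  have cQ : closed (psi @` Q).
    apply: compact_closed => //; apply: continuous_compact_image => //.
    apply: subclosed_compact cD _ => //.
    by apply: closed_comp (@closed_le R (1 - e)) => y _; exact: csq.
  have nQ : ~ (psi @` Q) (f b).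
    move=> [y Qy yb]; apply: (intL (x := y)); last by rewrite yb.
    by apply: le_lt_trans Qy _; rewrite gtrBl.
  have [|V [oV Vb VQ]] := (@within_continuousP _ _ _ _).1 cf b Ab (~` (psi @` Q)).
    by apply: open_nbhs_nbhs; split; rewrite ?openC.
  exists V; split => // a ABa Va; rewrite ltNge; apply/negP => za.
  apply: (VQ a ABa.1 Va); exists (inv (f a)) => //.
  exact: (fAB a ABa).2.
have [C [C0 [V [E [m [[cC oC0 oV cE] [AC C0C AC0 BV] [BE VE] [cm m1 mz mE] [EC mB]]]]]]] :=
  collar cA cB BA cz z1 zB.
have d0 : disk (0 : 'rV[R]_n).
  by rewrite /disk /= /sqnorm big1// => i _; rewrite mxE expr0n.
pose inD (v : 'rV[R]_n) : D :=
  if pselect (disk v) is left h then SigSub (mem_set h) else SigSub (mem_set d0).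
have inDE v : disk v -> set_val (inD v) = v by move=> dv; rewrite /inD; case: pselect.
have inDK (y : D) : inD (set_val y) = y.
  by apply: (embedding_set_val (@disk R n)).1; rewrite inDE//; exact: (set_valP y).
pose Fm x := if `[< B x >] then f x else psi (inD (m x)).
have FmB x : B x -> Fm x = f x by move=> Bx; rewrite /Fm asboolT.
have FmC x : ~ B x -> Fm x = psi (inD (m x)) by move=> Bx; rewrite /Fm asboolF.
have FmA a : A a -> Fm a = f a.
  move=> Aa; have [Ba|nBa] := pselect (B a); first exact: FmB.
  by rewrite FmC// mz// /z inDK; exact: (fAB a (conj Aa nBa)).2.
have cFm : {within C, continuous Fm}.
  apply/within_continuousP => x Cx N.
  (* At a point of [B]: [f] sends nearby points [a] of [A] into [N'], and [m y] is [e]-close to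
     [z a], so [fibre_margin] keeps [Fm y] in [N]. *)
  have [Bx|nBx] := pselect (B x).
    rewrite FmB// => Nx; have Nfx := nbhs_singleton (nbhs_interior Nx).
    have [N' [e [oN' N'x e0 N'e]]] := fibre_margin hK cD cpsi (@open_interior _ N) Nfx.
    have [P [oP Px PN']] := (@within_continuousP _ _ _ _).1 cf x Bx.1 N'
      (open_nbhs_nbhs (conj oN' N'x)).
    have [P2 [oP2 P2x P2N]] := (@within_continuousP _ _ _ _).1 cf x Bx.1 N Nx.
    have [Q [oQ Qx Qm]] := mB x e P Bx e0 (open_nbhs_nbhs (conj oP Px)).
    exists (Q `&` P2); split => //; first exact: openI.
    move=> y Cy [Qy P2y]; have [By|nBy] := pselect (B y).
      by rewrite FmB//; apply: P2N => //; exact: BA.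
    have [a ABa [Pa zm]] := Qm y (conj Cy nBy) Qy.
    rewrite FmC//; apply: interior_subset; apply: (N'e (inv (f a))).
      by rewrite (fAB a ABa).2; apply: PN' => //; exact: ABa.1.
    suff : ball (set_val (inv (f a))) e (set_val (inD (m y))) by [].
    by rewrite inDE//; exact: m1.
  rewrite FmC// => Nx.
  have := cpsi Nx; rewrite nbhsE => -[S [[S' oS' <-] /= S'x] SN].
  rewrite inDE in S'x; last exact: m1.
  have [W [oW Wx WS]] := (@within_continuousP _ _ _ _).1 cm x (conj Cx nBx) S'
    (open_nbhs_nbhs (conj oS' S'x)).
  exists (W `&` ~` B); split => //; first by apply: openI => //; rewrite openC.
  move=> y Cy [Wy nBy]; rewrite FmC//; apply: SN => /=; rewrite inDE; last exact: m1.
  exact: WS.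
have [|a Ea|W [g [oW EW cg gF gL]]] := exL T E Fm cE.
- exact: continuous_subspaceW cFm.
- have [Ba|nBa] := pselect (B a); first by rewrite FmB//; exact: Ba.2.
  rewrite FmC//; apply: bdL; rewrite /disk_boundary /= inDE.
    by apply: mE.
  by apply: m1; split => //; exact: EC.
(* A point of [W] and [V] that lies in [C] but not in the open set [C0] belongs to [E], where [Fm]
   and [g] agree. *)
exists (C0 `|` (W `&` V)), (glue C Fm g); split.
- by apply: openU => //; exact: openI.
- move=> a Aa; have [Ba|nBa] := pselect (B a); last by left; exact: AC0.
  by right; split; [apply/EW/BE|apply/BV].
- apply/within_continuousP => x Ox N.
  have [C0x|nC0x] := pselect (C0 x).
    have Cx := C0C x C0x; rewrite glueE1// => Nx.
    have [S [oS Sx SN]] := (@within_continuousP _ _ _ _).1 cFm x Cx N Nx.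
    exists (S `&` C0); split => //; first exact: openI.
    by move=> y _ [Sy C0y]; rewrite glueE1; [exact: SN (C0C _ C0y) Sy|exact: C0C].
  have [Wx Vx] : (W `&` V) x by case: Ox.
  have [Cx|nCx] := pselect (C x).
    have Ex : E x by apply: VE.
    rewrite glueE1// => Nx; have Nx' := Nx; rewrite -gF// in Nx'.
    have [S [oS Sx SN]] := (@within_continuousP _ _ _ _).1 cFm x Cx N Nx.
    have [S' [oS' S'x S'N]] := (@within_continuousP _ _ _ _).1 cg x Wx N Nx'.
    exists (S `&` S' `&` W); split => //; first by apply: openI => //; exact: openI.
    move=> y _ [[Sy S'y] Wy]; rewrite /glue; case: asboolP => Cy; first exact: SN.
    exact: S'N.
  rewrite /glue asboolF// => Nx.
  have [S [oS Sx SN]] := (@within_continuousP _ _ _ _).1 cg x Wx N Nx.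
  exists (S `&` W `&` ~` C); split => //.
    by apply: openI; [exact: openI|rewrite openC].
  by move=> y _ [[Sy Wy] nCy]; rewrite asboolF//; exact: SN.
- by move=> a Aa; rewrite glueE1 ?FmA//; exact: AC.
- move=> x Ox; rewrite /glue; case: asboolP => Cx; last first.
    by left; apply: gL; case: Ox => [/C0C//|[]].
  have [Bx|nBx] := pselect (B x); first by left; rewrite FmB//; exact: Bx.2.
  rewrite FmC//; have mx := m1 x (conj Cx nBx).
  have : sqnorm (set_val (inD (m x))) <= 1 by rewrite inDE.
  rewrite le_eqVlt => /orP[/eqP s1|s1]; first by left; apply: bdL.
  by right; exists (inD (m x)).
Qed.

End attach.

(** * Finite subcomplexes *)

Section cw.
Variables (R : realType) (K : topologicalType) (I : choiceType) (dim : I -> nat).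
Variable Phi : forall i, set_type (@disk R (dim i)) -> K.
Hypothesis hK : hausdorff_space K.
Hypothesis cwK : cw_structure Phi.

Let cell i : set K := @Phi i @` @disk_interior R (dim i).
Let bd i : set K := @Phi i @` @disk_boundary R (dim i).
Let carrier (J : seq I) : set K := \bigcup_(i in [set` J]) cell i.

Definition subcomplex (J : seq I) : Prop := forall i, i \in J -> bd i `<=` carrier J.

Let cPhi i : continuous (@Phi i). Proof. by have [+ _ _ _ _] := cwK; apply. Qed.

Let cells_trivIset : trivIset [set: I] cell.
Proof. by have [_ _ [+ _] _ _] := cwK. Qed.

Let cells_cover x : exists i, cell i x.
Proof.
have [_ _ [_ cov] _ _] := cwK; have : [set: K] x by [].
by rewrite -cov => -[i _ cx]; exists i.
Qed.

Let cell_inj i j x : cell i x -> cell j x -> i = j.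
Proof. by move=> ix jx; apply: cells_trivIset => //; exists x. Qed.

Let bd_cells i : exists J : seq I, (forall j, j \in J -> (dim j < dim i)%N) /\
  bd i `<=` carrier J.
Proof.
have [_ _ _ /(_ i)[J [/finite_seqP[s ->] sd] bJ] _] := cwK.
by exists s; split => // j js; apply: sd.
Qed.

Let closed_cell i (C : set (set_type (@disk R (dim i)))) : closed C -> closed (@Phi i @` C).
Proof.
move=> cC; apply: compact_closed => //; apply: continuous_compact_image; first exact: cPhi.
exact: (subclosed_compact cC (compact_set_type (@disk_compact R (dim i))) (@subsetT _ C)).
Qed.

Let range_Phi i : range (@Phi i) = cell i `|` bd i.
Proof.
apply/seteqP; split=> [_ [y _ <-]|_ [[y _ <-]|[y _ <-]]]; try by exists y.
have : sqnorm (set_val y) <= 1 by exact: (set_valP y).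
by rewrite le_eqVlt => /orP[/eqP s1|s1]; [right|left]; exists y.
Qed.

Let carrier_sub J J' : {subset J <= J'} -> carrier J `<=` carrier J'.
Proof. by move=> JJ' x [i /= iJ ix]; exists i => //; exact: JJ'. Qed.

Let carrier_closed J : subcomplex J -> closed (carrier J).
Proof.
move=> sJ; have -> : carrier J = \bigcup_(i in [set` J]) range (@Phi i).
  apply/seteqP; split=> x [i iJ].
    by move=> ix; exists i => //; rewrite range_Phi; left.
  by rewrite range_Phi => -[ix|/(sJ i iJ)//]; exists i.
apply: closed_bigcup; first exact: finite_seq.
by move=> i _; apply: closed_cell; exact: closedT.
Qed.

Lemma subcomplex_flatten (J : seq I) (S : I -> seq I) :
  (forall i, i \in J -> subcomplex (S i)) -> subcomplex (flatten (map S J)).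
Proof.
move=> SJ i /flattenP[_ /mapP[j jJ ->] iS]; apply: subset_trans (SJ j jJ i iS) _.
by apply: carrier_sub => k kS; apply/flattenP; exists (S j) => //; exact: map_f.
Qed.

(** Induction on the dimension: the boundary is covered by finitely many cells of lower
    dimension. *)
Lemma cell_subcomplex i : exists J, subcomplex J /\ i \in J.
Proof.
have [m] := ubnP (dim i); elim: m i => // m IH i; rewrite ltnS => im.
have [J [Jd bJ]] := bd_cells i.
have /choice[S SP] : forall j, exists S, j \in J -> subcomplex S /\ j \in S.
  move=> j; case: (boolP (j \in J)) => [jJ|_]; last by exists [::].
  by have [S [? ?]] := IH j (leq_trans (Jd j jJ) im); exists S.
exists (i :: flatten (map S J)); split; last by rewrite inE eqxx.
have sJ : subcomplex (flatten (map S J)).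
  by apply: subcomplex_flatten => j /SP[].
move=> k; rewrite inE => /orP[/eqP->|kS].
  apply: subset_trans bJ _; apply: carrier_sub => j jJ; rewrite inE; apply/orP; right.
  by apply/flattenP; exists (S j); [exact: map_f|exact: (SP j jJ).2].
apply: subset_trans (sJ k kS) _.
by apply: carrier_sub => j jS; rewrite inE jS orbT.
Qed.

(* One point from each of infinitely many cells would form an infinite closed
   discrete set. *)
Lemma compact_subcomplex (C : set K) : compact C ->
  exists J, subcomplex J /\ C `<=` carrier J.
Proof.
move=> cC; have /choice[S SP] := cell_subcomplex.
suff [J CJ] : exists J : seq I, C `<=` carrier J.
  exists (flatten (map S J)); split; first by apply: subcomplex_flatten => i _; case: (SP i).
  apply: subset_trans CJ _; apply: carrier_sub => i iJ; apply/flattenP.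
  by exists (S i); [exact: map_f|case: (SP i)].
apply: contrapT => /forallNP nJ.
have /choice[ix ixP] : forall l : seq I, exists ix : I * K,
    [/\ cell ix.1 ix.2, C ix.2 & ix.1 \notin l].
  move=> l; have /existsNP[x /not_implyP[Cx nx]] := nJ l.
  have [i cix] := cells_cover x; exists (i, x); split => //.
  by apply/negP => il; apply: nx; exists i.
pose l := fix l n := if n is m.+1 then (ix (l m)).1 :: l m else [::].
pose i_ n := (ix (l n)).1; pose x_ n := (ix (l n)).2.
have lS m n : (m < n)%N -> i_ m \in l n.
  elim: n => // n IH; rewrite ltnS leq_eqVlt inE => /orP[/eqP->|/IH ->].
    by rewrite eqxx.
  by rewrite orbT.
have i_inj m n : i_ m = i_ n -> m = n.
  have aux p q : (p < q)%N -> i_ p <> i_ q.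
    by move=> /lS + pq; rewrite pq => ln; have [_ _ /negP] := ixP (l q); apply.
  by move=> mn; case: (ltngtP m n) => // [/aux|/aux] //; rewrite mn.
have xc n : cell (i_ n) (x_ n) by have [] := ixP (l n).
(* The complements of these tails form an increasing open cover of [C] without a finite subcover. *)
pose T n := [set x_ m | m in [set m | (n <= m)%N]].
have fin n (J : seq I) : finite_set (T n `&` carrier J).
  pose p j := if pselect (exists m, i_ m = j) is left h then x_ (projT1 (cid h)) else x_ 0%N.
  have : finite_set (p @` [set` J]) by apply: finite_image; exact: finite_seq.
  apply: sub_finite_set => _ [[m _ <-] [j /= jJ jx]].
  exists j => //; have mj := cell_inj (xc m) jx.
  rewrite /p; case: pselect => [h|]; last by case; exists m.
  by case: cid => m' /= m'j; congr x_; apply: i_inj; rewrite mj.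
have cT n : closed (T n).
  have [_ _ _ _ ->] := cwK; move=> i.
  have [J [_ bJ]] := bd_cells i.
  have -> : @Phi i @^-1` T n = @Phi i @^-1` (T n `&` carrier (i :: J)).
    apply/seteqP; split=> y /=; last by case.
    move=> Ty; split => //; have : range (@Phi i) (Phi y) by exists y.
    rewrite range_Phi => -[iy|/bJ]; first by exists i => //=; rewrite inE eqxx.
    by apply: carrier_sub => j jJ; rewrite inE jJ orbT.
  apply: closed_comp => [y _|]; first exact: cPhi.
  exact: (accessible_finite_set_closed.1 (hausdorff_accessible hK) _ (fin _ _)).
have [n|x Cx|k kC] := compact_bigcup_nat (O := fun n => ~` T n) cC.
- by rewrite openC.
- apply: contrapT => nT.
  have T0 : T 0%N x by apply: contrapT => nT0; apply: nT; exists 0%N.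
  have [m _ mx] := T0; apply: nT; exists m.+1 => // -[m' /= mm' m'x].
  have c' := xc m'; rewrite m'x -mx in c'; have /i_inj mE := cell_inj (xc m) c'.
  by move: mm'; rewrite mE ltnn.
- have Cx : C (x_ k) by have [] := ixP (l k).
  by have [i /= ik] := kC _ Cx; apply; exists k => //=; exact: ltnW.
Qed.

(** Induction on the number of cells: a cell [e] of maximal dimension is removed, so that the rest
    is again a subcomplex and [e] is attached to it. *)
Lemma subcomplex_nbhd_extensor J : subcomplex J -> nbhd_extensor R (carrier J).
Proof.
have [m] := ubnP (size J); elim: m J => // m IH J; rewrite ltnS => Jm sJ.
case: J Jm sJ => [|i0 J0] Jm sJ.
  move=> T A f cA cf fA; exists set0, f; split => //; first exact: open0.
  + by move=> a /fA[].
  + exact: continuous_subspace0.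
set J := i0 :: J0 in Jm sJ *.
have [e eJ emax] : exists2 e, e \in J & forall j, j \in J -> (dim j <= dim e)%N.
  rewrite /J; elim: (J0) (i0) => [|j s IHs] i.
    by exists i; rewrite ?inE// => k; rewrite inE => /eqP->.
  have [e es em] := IHs j; have [le_ie|lt_ei] := leqP (dim i) (dim e).
    exists e; first by rewrite inE es orbT.
    by move=> k; rewrite inE => /orP[/eqP->//|/em].
  exists i; first by rewrite inE eqxx.
  move=> k; rewrite inE => /orP[/eqP->//|/em ke].
  exact: leq_trans ke (ltnW lt_ei).
pose J' := [seq j <- J | j != e].
have J'm : (size J' < m)%N.
  apply: leq_trans Jm; rewrite size_filter -(count_predC (fun j => j != e) J) -addn1 leq_add2l.
  by rewrite -has_count; apply/hasP; exists e => //=; rewrite negbK.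
(* A boundary point of cell [i] in the cell [e] would give [dim e < dim i], because cells are
   disjoint; [e] has maximal dimension. *)
have bJ' i : i \in J -> bd i `<=` carrier J'.
  move=> iJ x bx; have [j /= jJ jx] := sJ i iJ x bx.
  have [Js [Jd bJs]] := bd_cells i; have [j' /= j'J j'x] := bJs x bx.
  exists j => //=; rewrite mem_filter jJ andbT; apply/eqP => je.
  have := Jd j' j'J; rewrite (cell_inj j'x jx) je ltnNge.
  by rewrite emax.
have sJ' : subcomplex J' by move=> i; rewrite mem_filter => /andP[_ /bJ'].
have -> : carrier J = carrier J' `|` @Phi e @` @disk_interior R (dim e).
  apply/seteqP; split=> x.
    move=> [j /= jJ jx]; have [je|je] := eqVneq j e; first by right; rewrite je in jx.
    by left; exists j => //=; rewrite mem_filter je.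
  move=> [[j /=]|ex]; last by exists e.
  by rewrite mem_filter => /andP[_ jJ] jx; exists j.
have [_ /(_ e)[inv cinv invK] _ _ _] := cwK.
apply: (nbhd_extensor_attach (inv := inv)) => //.
- exact: carrier_closed.
- move=> x ix [j /=]; rewrite mem_filter => /andP[/eqP je _] jx; apply: je.
  by apply: cell_inj jx _; exists x.
- by move=> x bx; apply: (bJ' e eJ); exists x.
- exact: IH.
Qed.

End cw.

(** * Extension dimension *)

Lemma cw_nbhd_extension (R : realType) (K : topologicalType)
    (T : pseudoMetricType R) (A : set T) (f : T -> K) :
  cw_complex R K -> closed A -> compact A -> {within A, continuous f} ->
  exists V g, [/\ open V, A `<=` V, {within V, continuous g}
    & forall a, A a -> g a = f a].
Proof.
move=> [hK [I [dim [Phi cw]]]] cA kA cf.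
(* The compact image of [A] meets only a finite subcomplex. The cells are indexed by a bare type;
   [{classic I}] gives it the equality test that lists of cells use. *)
have [J [sJ AJ]] := @compact_subcomplex R K {classic I} dim Phi hK cw
  _ (continuous_compact cf kA).
have [|V [g [oV AV cg gf _]]] := @subcomplex_nbhd_extensor R K {classic I} dim Phi hK cw
  J sJ T A f cA cf.
  by move=> a Aa; apply: AJ; exists a.
by exists V, g.
Qed.

Lemma embedding_prod (X Y : topologicalType) (A : set X) (B : set Y) :
  embedding (fun p : set_type A * set_type B => (set_val p.1, set_val p.2)).
Proof.
have iA := (embedding_set_val A).1; have iB := (embedding_set_val B).1.
split; first by move=> [a b] [a' b'] /= [/iA -> /iB ->].
move=> V; split=> [oV|[W oW ->]]; last first.
  rewrite openE => -[a b] /= Wab.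
  have : nbhs (set_val a, set_val b) W by apply: open_nbhs_nbhs.
  move=> [[P Q] /= [nP nQ] PQ].
  have cA : nbhs a (set_val @^-1` P) := @initial_continuous _ _ (set_val : set_type A -> X) a P nP.
  have cB : nbhs b (set_val @^-1` Q) := @initial_continuous _ _ (set_val : set_type B -> Y) b Q nQ.
  by exists (set_val @^-1` P, set_val @^-1` Q) => //= -[a' b'] /= [? ?]; exact: (PQ (_, _)).
exists (\bigcup_(PQ in [set PQ : set X * set Y | [/\ open PQ.1, open PQ.2 &
    forall a b, PQ.1 (set_val a) -> PQ.2 (set_val b) -> V (a, b)]]) (PQ.1 `*` PQ.2)).
  apply: bigcup_open => -[P Q] [/= oP oQ _]; rewrite openE => -[x y] [/= Px Qy].
  by exists (P, Q) => //; split; exact: open_nbhs_nbhs.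
apply/seteqP; split=> -[a b] /=; last by move=> [[P Q] [_ _ PQ] [/= Pa Qb]]; exact: PQ.
move=> Vab; have : nbhs (a, b) V by apply: open_nbhs_nbhs.
move=> [[P Q] /= [nP nQ] PQ].
move: nP nQ => [_ [[P' oP' <-] /= P'a P'P]] [_ [[Q' oQ' <-] /= Q'b Q'Q]].
exists (P', Q') => //; split => // a' b' P'a' Q'b'.
by apply: (PQ (a', b')); split; [exact: P'P|exact: Q'Q].
Qed.

Lemma tube (X Y : topologicalType) (V : set (X * Y)) (I : set Y) (x : X) :
  compact I -> open V -> (forall t, I t -> V (x, t)) ->
  nbhs x [set x' | forall t, I t -> V (x', t)].
Proof.
move=> /compact_near_coveringP cI oV xV.
apply: (cI X (nbhs x) (fun x' t => V (x', t))) => t It.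
have : nbhs (x, t) V by apply: open_nbhs_nbhs; split => //; exact: xV.
move=> [[P Q] /= [nP nQ] PQ]; exists (Q, P) => //= -[t' x'] [/= Qt Px].
exact: (PQ (x', t')).
Qed.

Lemma urysohn_metric (R : realType) (X : pseudoMetricType R) (A B : set X) :
  closed A -> closed B -> A `&` B = set0 ->
  exists l : X -> R, [/\ continuous l, forall x, 0 <= l x <= 1,
    forall x, A x -> l x = 0 & forall x, B x -> l x = 1].
Proof.
move=> cA cB AB.
have /(@uniform_separatorP _ R)[l [cl l01 lA lB]] :=
  (@normal_separatorP R X).1 pseudometric_normal A B cA cB AB.
exists l; split => // [x|x Ax|x Bx].
- by have : `[0, 1]%classic (l x) by [apply: l01; exists x]; rewrite /= in_itv.
- by apply: lA; exists x.
- by apply: lB; exists x.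
Qed.

(** * Amalgamating extensions over a common part *)

Section amalgam.
Variables (R : realType) (X : metricType R) (K : topologicalType) (k0 : K).
Hypothesis cwK : cw_complex R K.
Variables (A : set X) (f : X -> K).
Hypotheses (cA : closed A) (cf : {within A, continuous f}).

Definition extends_over (Z : set X) : Prop :=
  exists2 g : X -> K, {within Z, continuous g} & forall a, A a -> Z a -> g a = f a.

Let hX := @metric_hausdorff _ X.

(** The extension is applied to [g] glued with [f] on all of [A], so that the result agrees with [f]
    also at points of [A] outside [Z]. *)
Lemma extends_over_nbhs (Z : set X) : compact A -> compact Z -> extends_over Z ->
  exists V, [/\ open V, Z `<=` V & forall Z', compact Z' -> Z' `<=` V -> extends_over Z'].
Proof.
move=> kA kZ [g cg gf]; have cZ := compact_closed hX kZ.
have gf' x : Z x -> A x -> g x = f x by move=> Zx Ax; exact: gf.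
have cgf := within_glue_continuous cZ cA gf' cg cf.
have [V [h [oV ZAV ch hgf]]] :=
  cw_nbhd_extension cwK (closedU cZ cA) (compactU kZ kA) cgf.
exists V; split => //; first by move=> z Zz; apply: ZAV; left.
move=> Z' _ Z'V; exists h; first exact: continuous_subspaceW ch.
by move=> a Aa _; rewrite hgf ?(glueE2 gf')//; right.
Qed.

Let cfst (S : set X) (g : X -> K) (E : set (X * R^o)) :
  {within S, continuous g} -> (forall p, E p -> S p.1) ->
  {within E, continuous (g \o (fst : X * R^o -> X))}.
Proof.
move=> cg ES; refine (@within_comp_preimage _ _ _ S g fst E cg _ ES).
by apply: continuous_subspaceT => p; exact: cvg_fst.
Qed.

(** On the common part, [g1] and [g2] are homotopic relative to [A], because [K] is an extensor for
    its product with the interval. As in Borsuk's homotopy extension theorem, [g2] is then deformed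
    on [M2], without changing it on [A], into a map that agrees with [g1] on the common part. *)
Lemma extends_over_amalgam (M1 M2 : set X) : compact M1 -> compact M2 ->
  absolute_extensor K (set_type (M1 `&` M2) * set_type `[0 : R, 1])%type ->
  extends_over M1 -> extends_over M2 -> extends_over (M1 `|` M2).
Proof.
move=> kM1 kM2 aeK [g1 cg1 gf1] [g2 cg2 gf2].
have cM1 := compact_closed hX kM1; have cM2 := compact_closed hX kM2.
pose T : pseudoMetricType R := (X * R^o)%type.
pose I := [set t : R^o | 0 <= t <= 1].
have kI : compact I.
  rewrite (_ : I = `[0, 1]%classic); first exact: segment_compact.
  by apply/seteqP; split=> t; rewrite /= in_itv.
have cI : closed I by apply: compact_closed kI; exact: Rhausdorff.
pose F := M1 `&` M2; have cF : closed F by exact: closedI.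
pose box (S : set X) (J : set R^o) : set T := [set p | S p.1 /\ J p.2].
have cbox S J : closed S -> closed J -> closed (box S J).
  move=> cS cJ; rewrite (_ : box S J = fst @^-1` S `&` snd @^-1` J)//.
  by apply: closedI; apply: closed_comp => // p _; [exact: cvg_fst|exact: cvg_snd].
have c0 : closed [set (0 : R^o)] by apply: accessible_closed_set1; apply: hausdorff_accessible; exact: Rhausdorff.
have c1 : closed [set (1 : R^o)] by apply: accessible_closed_set1; apply: hausdorff_accessible; exact: Rhausdorff.
have I0 : I 0 by rewrite /I /= lexx ler01.
have I1 : I 1 by rewrite /I /= lexx ler01.
(* the homotopy between [g2] and [g1] on the common part, rel [A] *)
pose j (p : set_type F * set_type `[0 : R, 1]) : T := (set_val p.1, set_val p.2).
have ej : embedding j := embedding_prod _ _.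
have rj : range j = box F I.
  apply/seteqP; split=> [_ [[a b] _ <-]|[x t] [/= Fx It]].
    split; first exact: set_valP.
    by have := set_valP b; rewrite /= in_itv.
  have It' : `[0 : R, 1]%classic t by rewrite /= in_itv.
  by exists (SigSub (mem_set Fx), SigSub (mem_set It')).
pose phi0 : T -> K := glue (box F [set 1]) (g1 \o fst) (f \o fst).
have a0 p : box F [set 1] p -> box (A `&` F) I p -> (g1 \o fst) p = (f \o fst) p.
  by move=> _ [[Ap [M1p _]] _]; exact: gf1.
have cphi0 : {within box F [set 1] `|` box (A `&` F) I, continuous phi0}.
  apply: within_glue_continuous => //; try by apply: cbox => //; exact: closedI.
    by apply: (cfst cg1) => p [[]].
  by apply: (cfst cf) => p [[]].
pose phi : T -> K := glue (box F [set 0]) (g2 \o fst) phi0.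
have a1 p : box F [set 0] p -> (box F [set 1] `|` box (A `&` F) I) p ->
    (g2 \o fst) p = phi0 p.
  move=> [[M1p M2p] p0] [[_ p1]|bp].
    by exfalso; move: p1; rewrite /= p0 => /eqP; rewrite eq_sym oner_eq0.
  by rewrite /phi0 (glueE2 a0)//; case: bp => -[Ap _] _; exact: gf2.
have cphi : {within box F [set 0] `|` (box F [set 1] `|` box (A `&` F) I), continuous phi}.
  apply: within_glue_continuous => //; first exact: cbox.
    by apply: closedU; apply: cbox => //; exact: closedI.
  by apply: (cfst cg2) => p [[]].
have [| |H cH Hphi] := absolute_extensor_embedding k0 ej aeK _ _ cphi.
- by apply: closedU; [exact: cbox|apply: closedU; apply: cbox => //; exact: closedI].
- rewrite rj => p [[Fp p0]|[[Fp p1]|[[_ Fp] Ip]]] //; split => //.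
    by rewrite p0.
  by rewrite p1.
rewrite rj in cH.
have H0 x : F x -> H (x, 0) = g2 x.
  by move=> Fx; rewrite Hphi; [rewrite /phi glueE1|left].
have H1 x : F x -> H (x, 1) = g1 x.
  move=> Fx; rewrite Hphi; last by right; left.
  rewrite /phi (glueE2 a1); last by left.
  by rewrite /phi0 glueE1.
have Hf x t : F x -> A x -> I t -> H (x, t) = f x.
  move=> Fx Ax It; rewrite Hphi; last by right; right.
  rewrite /phi (glueE2 a1); last by right.
  by rewrite /phi0 (glueE2 a0).
(* the homotopy extends over a neighbourhood of the bottom of [M2 * [0, 1]] *)
pose psi0 : T -> K := glue (box (A `&` M2) I) (f \o fst) (g2 \o fst).
have b0 p : box (A `&` M2) I p -> box M2 [set 0] p -> (f \o fst) p = (g2 \o fst) p.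
  by move=> [[Ap M2p] _] _; rewrite /= gf2.
have cAM : closed (A `&` M2) by exact: closedI.
have cpsi0 : {within box (A `&` M2) I `|` box M2 [set 0], continuous psi0}.
  apply: within_glue_continuous => //; try exact: cbox.
    by apply: (cfst cf) => p [[]].
  by apply: (cfst cg2) => p [].
pose psi : T -> K := glue (box F I) H psi0.
have b1 p : box F I p -> (box (A `&` M2) I `|` box M2 [set 0]) p -> H p = psi0 p.
  case: p => x t [/= Fx It] [[/= [Ax M2x] _]|bp].
    by rewrite /psi0 glueE1//= Hf.
  by rewrite /psi0 (glueE2 b0)//; case: bp => /= _ ->; rewrite H0.
have cpsi : {within box F I `|` (box (A `&` M2) I `|` box M2 [set 0]), continuous psi}.
  apply: within_glue_continuous => //; first exact: cbox.
  by apply: closedU; exact: cbox.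
have kE : compact (box F I `|` (box (A `&` M2) I `|` box M2 [set 0])).
  have kMI : compact (box M2 I) by exact: compact_setX.
  apply: subclosed_compact kMI _.
    by apply: closedU; [exact: cbox|apply: closedU; exact: cbox].
  by move=> p [[[_ M2p] Ip]|[[[_ M2p] Ip]|[M2p p0]]]; split => //; rewrite p0.
have [|V [G [oV EV cG Gpsi]]] := cw_nbhd_extension cwK _ kE cpsi.
  by apply: closedU; [exact: cbox|apply: closedU; exact: cbox].
pose Y := F `|` (A `&` M2).
have cY : closed Y by exact: closedU.
pose N := [set x | forall t, I t -> V (x, t)]°.
have YN : Y `<=` N.
  move=> x Yx; apply: tube => // t It; apply: EV.
  by case: Yx => [Fx|AMx]; [left|right; left].
have [| |l [cl l01 l0 l1]] := @urysohn_metric R X (~` N) Y _ cY.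
- by rewrite closedC; exact: open_interior.
- by apply/seteqP; split=> x // [nN /YN].
(* Over [F] the height is 1, where the homotopy has reached [g1]; over [A] within [M2] the homotopy
   is constantly [f]; outside [N] the height 0 keeps the point inside [V]. *)
pose g2' x := G (x, l x).
have cg2' : {within M2, continuous g2'}.
  refine (@within_comp_preimage _ _ _ V G (fun x => (x, l x) : T) M2 cG _ _).
    apply: continuous_subspaceT => x W [[P Q] /= [nP nQ] PQ].
    have h : nbhs x (l @^-1` Q) := cl x Q nQ.
    suff : nbhs x ((fun x => (x, l x)) @^-1` W) by [].
    by apply: filterS (filterI nP h) => y [Py Qy]; exact: (PQ (_, _)).
  move=> x M2x; have [Nx|nNx] := pselect (N x).
    have Nx' : [set x | forall t, I t -> V (x, t)] x by exact: interior_subset.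
    exact: (Nx' (l x) (l01 x)).
  by rewrite l0//; apply: EV; right; right.
have g12 x : M1 x -> M2 x -> g1 x = g2' x.
  move=> M1x M2x; rewrite /g2' l1; last by left.
  rewrite Gpsi; last by left.
  by rewrite /psi glueE1//= H1.
have g2f x : A x -> M2 x -> g2' x = f x.
  move=> Ax M2x; rewrite /g2' l1; last by right.
  rewrite Gpsi; last by right; left.
  rewrite /psi (glueE2 b1); last by left.
  by rewrite /psi0 glueE1.
exists (glue M1 g1 g2'); first exact: within_glue_continuous.
move=> x Ax [M1x|M2x]; first by rewrite glueE1// gf1.
by rewrite (glueE2 (B := M2))// g2f.
Qed.

End amalgam.

Section stratum_dimension.
Variables (R : realType) (X : metricType R) (Ks : nat -> topologicalType).
Hypothesis strK : stratum R Ks.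

Let hX := @metric_hausdorff _ X.

Lemma thin_set0 : thin (@set0 X).
Proof.
split=> [|x N Nx]; first exact: compact0.
exists [set x]; split => //; first exact: compact_set1.
  by move=> _ ->; exact: nbhs_singleton.
by move=> h _; rewrite image_set0 setD0; split; [exact: connected1|exists x].
Qed.

Lemma embedding_hausdorff (Y : topologicalType) (j : Y -> X) :
  embedding j -> hausdorff_space Y.
Proof.
move=> ej p q pq; apply: ej.1; apply: hX => P Q Pp Qq.
have cj := embedding_continuous ej.
have [y [Py Qy]] := pq _ _ (cj p P Pp) (cj q Q Qq).
by exists (j y).
Qed.

(** The subspace is itself metrizable, so the identity serves as the perfect map. *)
Lemma stratum_set_type (Z : set X) n : absolute_extensor (Ks n) (set_type Z) ->
  absolute_extensor (Ks n.+1) (set_type Z * set_type `[0 : R, 1])%type /\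
  forall j, absolute_extensor (Ks (n + j)%N) (set_type Z).
Proof.
move=> aeZ; apply: (strK.2 (set_type Z) (set_type Z) id) => //.
- exact: metrizable_set_type.
- split.
  + exact: embedding_hausdorff (embedding_set_val Z).
  + by move=> x; exact: cvg_id.
  + by move=> A cA; rewrite image_id.
  + by move=> y; exact: compact_set1.
- by apply/seteqP; split=> y // _; exists y.
Qed.

(** The condition on [F] acts twice: through the product with the interval it allows amalgamation of
    maps to [Ks n.+1] over copies of [F], and it makes [F] itself tiny, so that no copy of [F]
    covers a failing set. *)
Lemma dim_thin (F B0 : set X) n : homogeneous X ->
  compact F -> absolute_extensor (Ks n) (set_type F) ->
  compact B0 -> ~ absolute_extensor (Ks n.+1) (set_type B0) -> thin F.
Proof.
move=> homX cF aeF cB0 nB0.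
(* A point of [F] guarantees that [Ks n] and [Ks n.+1] are inhabited, as the default values [k0] and
   [k1] require. *)
have [->|/set0P[x0 Fx0]] := eqVneq F set0; first exact: thin_set0.
have clc (Z : set X) : compact Z -> closed Z by exact: compact_closed.
have [_ aeF1] := stratum_set_type aeF; have := aeF1 1%N; rewrite addn1 => {}aeF1.
have [k0 _] := @absolute_extensor_inhabited _ (set_type F) (SigSub (mem_set Fx0)) aeF.
have [k1 _] := @absolute_extensor_inhabited _ (set_type F) (SigSub (mem_set Fx0)) aeF1.
have eF : extensor_on (Ks n) F by apply/(extensor_onP k0) => //; exact: clc.
have eF1 : extensor_on (Ks n.+1) F by apply/(extensor_onP k1) => //; exact: clc.
apply: (thin_of_cantor homX (tiny := extensor_on (Ks n.+1)) cF _ _ _ cB0).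
- by move=> A f _ _ _; exists f => //; exact: continuous_subspace0.
- by move=> Z1 Z2 cZ1 cZ2; apply: extensor_on_setU; exact: clc.
- move=> B cB /existsNP[A /existsNP[f nB]].
  move: nB => /not_implyP[cA /not_implyP[AB /not_implyP[cf nB]]].
  have kA : compact A by exact: subclosed_compact cA cB AB.
  have [Z cZ|nPB|M [cM MB nM minM]] :=
    minimal_failing hX (Pr := extends_over A f) _ cB.
  + exact: (extends_over_nbhs (strK.1 n.+1) cA cf kA cZ).
  + by case: nPB => g cg gf; apply: nB; exists g => // x Ax; apply: gf => //; exact: AB.
  have ntM : ~ extensor_on (Ks n.+1) M.
    move=> eM; apply: nM; have [|||g cg gf] := eM (A `&` M) f.
    * by apply: closedI => //; exact: clc.
    * by move=> ? [].
    * by refine (continuous_subspaceW _ cf) => ? [].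
    * by exists g => // a Aa Ma; exact: gf.
  exists M; split => // h hh; split; last first.
    apply: contrapT => M0; apply: ntM.
    apply: extensor_on_subset (extensor_on_homeo hh eF1) => z Mz.
    by apply: contrapT => nFz; apply: M0; exists z.
  apply: (minimal_connected hX cM nM minM).
    exact: continuous_compact_image hh.1 cF.
  move=> M1 M2 cM1 cM2 MF; apply: (extends_over_amalgam k1 (strK.1 n.+1)) => //.
  have cM12 : closed (M1 `&` M2) by apply: closedI; exact: clc.
  apply: (stratum_set_type _).1; apply/(extensor_onP k0) => //.
  exact: extensor_on_subset MF (extensor_on_homeo hh eF).
- move=> eB0; apply: nB0; apply/(extensor_onP k1) => //; exact: clc.
Qed.

End stratum_dimension.

(** * From compacta to regions *)

Section compacta.
Variables (R : realType) (X : metricType R).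
Hypothesis lcX : locally_compact [set: X].

Let hX := @metric_hausdorff _ X.

Lemma compact_neighbourhood (U Z : set X) : open U -> compact Z -> Z `<=` U ->
  exists Z', [/\ compact Z', Z' `<=` U & Z `<=` Z'°].
Proof.
move=> oU cZ ZU.
have /choice[V VP] : forall z, exists V : set X, Z z ->
    [/\ nbhs z V, compact V & V `<=` U].
  move=> z; have [Zz|nZz] := pselect (Z z); last by exists set0.
  have [e e0 [ce eU]] := compact_closed_ball lcX oU (ZU z Zz).
  exists (closure (ball z e)) => _; split => //.
  by apply: filterS (nbhsx_ballx z e e0); exact: subset_closure.
have [z _|z Zz|D DZ ZD] := compact_cover_compact cZ (D := Z) (f := fun z => (V z)°).
- exact: open_interior.
- by exists z => //; have [] := VP z Zz.
have cD (l : seq X) : (forall z, z \in l -> Z z) -> compact (\bigcup_(z in [set` l]) V z).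
  elim: l => [_|z l IH lZ]; first by rewrite set_nil bigcup_set0; exact: compact0.
  rewrite bigcup_seq_cons.
  apply: compactU; last by apply: IH => y yl; apply: lZ; rewrite inE yl orbT.
  by have [] := VP z (lZ z (mem_head _ _)).
exists (\bigcup_(z in [set` finmap.enum_fset D]) V z); split.
- by apply: cD => z zD; exact: set_mem (DZ z zD).
- by move=> x [z /= zD Vx]; have [_ _] := VP z (set_mem (DZ z zD)); apply.
- move=> x /ZD[z /= zD]; apply: interiorS => y Vy; by exists z.
Qed.

Lemma region_interior_exhaustion (U : set X) : region U ->
  exists M : nat -> set X, [/\ forall k, compact (M k), forall k, M k `<=` U,
    forall k, M k `<=` (M k.+1)° & U `<=` \bigcup_k M k].
Proof.
move=> rU; have [L [cL LU Lex]] := region_exhaustion lcX rU.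
have /choice[f fP] : forall kM : nat * set X, exists M' : set X,
    compact kM.2 -> kM.2 `<=` U ->
    [/\ compact M', M' `<=` U & kM.2 `|` L kM.1 `<=` M'°].
  move=> [k M] /=; have [cM|] := pselect (compact M); last by exists M.
  have [MU|] := pselect (M `<=` U); last by exists M.
  have [|z [/MU|/LU]//|M' [? ? ?]] := @compact_neighbourhood U (M `|` L k) rU.1.
    exact: compactU.
  by exists M'.
pose M := fix M n := if n is m.+1 then f (m, M m) else set0.
have MP n : compact (M n) /\ M n `<=` U.
  elim: n => [|n [cM MU]]; first by split => //; exact: compact0.
  by have [] := fP (n, M n) cM MU.
exists M; split=> [k|k|k|z Uz]; try by have [] := MP k.
  have [cM MU] := MP k; have [_ _ h] := fP (k, M k) cM MU.
  by move=> z Mz; apply: h; left.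
have [|k zL] := Lex [set z] (@compact_set1 _ z); first by move=> _ ->.
exists k.+1 => //; have [cM MU] := MP k; have [_ _ h] := fP (k, M k) cM MU.
by apply: interior_subset; apply: h; right; exact: zL.
Qed.

(** The map is extended successively over an exhaustion. The limit is continuous because each [M k]
    lies in the interior of the next, where the limit is one fixed stage. Read contrapositively,
    failure on [U] is seen on a compactum. *)
Lemma absolute_extensor_region (K : topologicalType) (U : set X) (x0 : X) :
  region U -> U x0 ->
  (forall Z, compact Z -> Z `<=` U -> absolute_extensor K (set_type Z)) ->
  absolute_extensor K (set_type U).
Proof.
move=> rU Ux0 aeZ.
have [|k0 _] := @absolute_extensor_inhabited _ (set_type [set x0]) (SigSub (mem_set (erefl : [set x0] x0)))
  (aeZ _ (@compact_set1 _ x0) _); first by move=> _ ->.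
have [M [cM MU MS UM]] := region_interior_exhaustion rU.
have clM n : closed (M n) by exact: compact_closed.
have eM n : extensor_on K (M n).
  by apply/(extensor_onP k0) => //; apply: aeZ.
move=> A f cA cf; have eU := embedding_set_val U.
have eA := embedding_comp eU (embedding_set_val A).
have [F cF Fv] := embedding_lift k0 eA cf.
set A' := range _ in cF.
have [C cC AC] := (embedding_closed _ eU).1 cA.
have A'C : A' = C `&` U.
  apply/seteqP; split=> [_ [a _ <-]|z [Cz Uz]].
    split; last exact: (set_valP (set_val a)).
    suff : (set_val @^-1` C) (set_val a) by [].
    by rewrite -AC; exact: set_valP.
  have Az : A (SigSub (mem_set Uz)) by rewrite AC.
  by exists (SigSub (mem_set Az)).
have cAM n : closed (A' `&` M n).
  rewrite A'C (_ : _ `&` _ = C `&` M n); first exact: closedI.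
  by apply/seteqP; split=> z [] => [[Cz _] Mz|Cz Mz]; split => //; split => //; exact: MU Mz.
have cFM n : {within A' `&` M n, continuous F}.
  by refine (continuous_subspaceW _ cF) => ? [].
pose good n (g : X -> K) := {within M n, continuous g} /\
  forall x, A' x -> M n x -> g x = F x.
have MM n : M n `<=` M n.+1 by move=> x /MS/interior_subset.
have /choice[s sP] : forall ng : nat * (X -> K), exists g' : X -> K, good ng.1 ng.2 ->
    good ng.1.+1 g' /\ forall x, M ng.1 x -> g' x = ng.2 x.
  move=> [n g] /=; have [gg|] := pselect (good n g); last by exists g.
  have [cg gF] := gg.
  have gF' y : M n y -> (A' `&` M n.+1) y -> g y = F y by move=> My [A'y _]; exact: gF.
  have ch := within_glue_continuous (clM n) (cAM n.+1) gF' cg (cFM n.+1).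
  have [||g' cg' gh] := eM n.+1 _ _ _ _ ch.
  - exact: closedU.
  - by move=> x [/MM|[]].
  exists g' => _; split; first split => //.
    move=> x A'x Mx; rewrite gh; last by right.
    by rewrite (glueE2 gF').
  by move=> x Mx; rewrite gh ?glueE1//; left.
have [|g0 cg0 g0F] := eM 0%N _ F (cAM 0%N) _ (cFM 0%N); first by move=> x [].
pose g := fix g n := if n is m.+1 then s (m, g m) else g0.
have gg n : good n (g n).
  elim: n => [|n IH] /=; first by split => // x A'x Mx; exact: g0F.
  by have [] := sP (n, g n) IH.
have gS n x : M n x -> g n.+1 x = g n x by have [_] := sP (n, g n) (gg n); apply.
have Mle m n : (m <= n)%N -> M m `<=` M n.
  by move=> /subnK <-; elim: (n - m)%N => // k IH x /IH/MM.
have gle m n x : (m <= n)%N -> M m x -> g n x = g m x.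
  move=> mn Mx; rewrite -(subnK mn); elim: (n - m)%N => // k <-.
  by rewrite addSn gS//; apply: Mle Mx; exact: leq_addl.
have /choice[ix ixP] : forall x, exists n, U x -> M n x.
  move=> x; have [/UM[n _ Mx]|] := pselect (U x); first by exists n.
  by exists 0%N.
pose G x := g (ix x) x.
have GE n x : M n x -> G x = g n x.
  move=> Mx; have Mix := ixP x (MU n x Mx).
  by case: (leqP n (ix x)) => [h|/ltnW h]; [exact: gle|rewrite (gle _ _ _ h Mix)].
have cG : {within U, continuous G}.
  apply/within_continuousP => x Ux N; have Mx := ixP x Ux.
  rewrite (GE _ _ (MM _ _ Mx)) => Nx.
  have [V [oV Vx VN]] := (@within_continuousP _ _ _ _).1 (gg (ix x).+1).1 x (MM _ _ Mx) N Nx.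
  exists (V `&` (M (ix x).+1)°); split; last first.
    move=> y _ [Vy /interior_subset My]; rewrite (GE _ _ My); exact: VN.
  - by split => //; exact: MS.
  - by apply: openI => //; exact: open_interior.
exists (G \o set_val).
  by apply: (within_comp_continuous cG); [exact: initial_continuous|move=> y; exact: set_valP].
move=> a; have A'a : A' (set_val (set_val a)) by exists a.
have Ua : U (set_val (set_val a)) by exact: set_valP.
rewrite /= /G (gg _).2//; last exact: ixP.
exact: Fv.
Qed.

End compacta.

(** * The four classes *)

(** Each [G n] is only closed in [U]; cutting it with an exhaustion of [U] gives countably many
    compacta that are thin in [X]. *)
Lemma mazurkiewicz_thin_pieces (R : realType) (X : metricType R) (U : set X)
    (F : set (set_type U)) (G : nat -> set (set_type U)) :
  homogeneous X -> locally_compact [set: X] -> locally_connected X -> region U ->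
  (forall n, closed (G n)) -> F `<=` \bigcup_n G n ->
  (forall n (Z : set X), compact Z -> Z `<=` set_val @` G n -> thin Z) ->
  forall Y0 Y1 : set (set_type U), closed Y0 -> closed Y1 ->
    Y0° !=set0 -> Y1° !=set0 ->
    exists Z : set (set_type U),
      [/\ continuum Z, Z `<=` ~` F, Z `&` Y0 !=set0 & Z `&` Y1 !=set0].
Proof.
move=> homX lcX lconX rU cG FG thG Y0 Y1 cY0 cY1 [y0 Y0y] [y1 Y1y].
have hX := @metric_hausdorff _ X; have ej := embedding_set_val U.
have [L [cL LU Lex]] := region_exhaustion lcX rU.
pose v := @set_val X U.
pose H n := let nk := odflt (0%N, 0%N) (pickle_inv n) in v @` G nk.1 `&` L nk.2.
have tH n : thin (H n).
  rewrite /H; case: (odflt _ _) => [m k] /=; apply: (thG m); last exact: subIsetl.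
  have [C cC GC] := (embedding_closed _ ej).1 (cG m).
  have -> : v @` G m `&` L k = C `&` L k.
    apply/seteqP; split=> z [].
      by move=> [y Gy <-] Ly; split => //; move: Gy; rewrite GC.
    move=> Cz Lz; split => //; exists (SigSub (mem_set (LU _ _ Lz))) => //.
    by rewrite GC.
  by rewrite setIC; apply: compact_closedI.
have lift (Y : set (set_type U)) y : Y° y -> closed Y -> exists Q : set X,
    [/\ open Q, U `&` Q !=set0 & forall x, closure Q (v x) -> Y x].
  move=> Yy cY; have [_ [[Q oQ <-] /= Qy QY]] : nbhs y Y by exact: Yy.
  have [C cC YC] := (embedding_closed _ ej).1 cY.
  (* The continuum will only meet the closure of this open set; points of [U] in that closure stay
     in the closed set [Y]. *)
  exists (Q `&` U); split.
  - by apply: openI => //; exact: rU.1.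
  - by exists (v y); split; [exact: set_valP|split => //; exact: set_valP].
  - move=> x cx; rewrite YC /= ((closure_id C).1 cC); apply: closureS cx => z [Qz Uz].
    suff : (v @^-1` C) (SigSub (mem_set Uz)) by [].
    by rewrite -YC; exact: QY.
have [Q0 [oQ0 UQ0 Q0Y]] := lift _ _ Y0y cY0.
have [Q1 [oQ1 UQ1 Q1Y]] := lift _ _ Y1y cY1.
have [Z [[cZ conZ] ZU Z0 Z1]] :=
  continuum_avoiding_thin homX lcX lconX tH rU oQ0 oQ1 UQ0 UQ1.
have ZUv z : Z z -> exists y, v y = z.
  by move=> /ZU[Uz _]; exists (SigSub (mem_set Uz)).
have ZE : v @` (v @^-1` Z) = Z.
  apply/seteqP; split=> [_ [y Zy <-]//|z Zz].
  by have [y yz] := ZUv z Zz; exists y => //=; rewrite yz.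
exists (v @^-1` Z); split.
- split; first by apply: embedding_compact cZ _ => // z /ZUv[y yz]; exists y.
  by apply: embedding_connected conZ _ => // z /ZUv[y yz]; exists y.
- move=> y Zy Fy; have [n _ Gy] := FG y Fy; have [_] := ZU _ Zy; apply.
  have [|k yL] := Lex [set v y] (@compact_set1 _ _).
    by move=> _ ->; exact: set_valP.
  by exists (pickle (n, k)) => //; rewrite /H pickleK_inv; split; [exists y|exact: yL].
- by have [z [Zz cz]] := Z0; have [y yz] := ZUv z Zz; exists y; split;
    [rewrite /= yz|apply: Q0Y; rewrite yz].
- by have [z [Zz cz]] := Z1; have [y yz] := ZUv z Zz; exists y; split;
    [rewrite /= yz|apply: Q1Y; rewrite yz].
Qed.

Lemma stratum_dim_le_ex (Ks : nat -> topologicalType) (Y : topologicalType) (m : int) :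
  (stratum_dim Ks Y <= m%:E)%E ->
  [set: Y] = set0 \/ exists n, (Posz n <= m)%R /\ absolute_extensor (Ks n) Y.
Proof.
rewrite /stratum_dim; case: pselect => [Y0|nY]; first by left.
case: pselect => [ex|nex]; last by [].
case: ex_minnP => n /asboolP aen _; rewrite lee_fin => nm.
by right; exists n.
Qed.

Lemma stratum_dim_lty (Ks : nat -> topologicalType) (Y : topologicalType) :
  (stratum_dim Ks Y < +oo)%E <->
  [set: Y] = set0 \/ exists n, absolute_extensor (Ks n) Y.
Proof.
rewrite /stratum_dim; case: pselect => [Y0|nY].
  by split=> [_|_]; [left|rewrite ltry].
case: pselect => [ex|nex]; split.
- by move=> _; right; have [n /asboolP aen] := ex; exists n.
- by rewrite ltry.
- by rewrite ltxx.
- by move=> [/nY//|[n aen]]; exfalso; apply: nex; exists n; apply/asboolP.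
Qed.

Lemma stratum_dim_eq (Ks : nat -> topologicalType) (Y : topologicalType) (y : Y) (n : int) :
  stratum_dim Ks Y = n%:E -> forall k, (Posz k < n)%R -> ~ absolute_extensor (Ks k) Y.
Proof.
rewrite /stratum_dim; case: pselect => [Y0|nY].
  by exfalso; have : [set: Y] y by []; rewrite Y0.
case: pselect => [ex|nex]; last by [].
case: ex_minnP => m _ mmin [<-] k; rewrite ltz_nat => km aek.
by have := mmin k (asboolT aek); rewrite leqNgt km.
Qed.

Section classes.
Variables (R : realType) (X : metricType R) (U : set X).
Hypothesis homX : homogeneous X.
Hypothesis lcX : locally_compact [set: X].
Hypothesis lconX : locally_connected X.
Hypothesis rU : region U.

Let embU : embedding (set_val : set_type U -> X) := embedding_set_val U.

Let embF (F : set (set_type U)) :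
  embedding ((set_val : set_type U -> X) \o (set_val : set_type F -> set_type U)) :=
  embedding_comp embU (embedding_set_val F).

Let rangeF (F : set (set_type U)) : range ((set_val : set_type U -> X) \o
  (set_val : set_type F -> set_type U)) = set_val @` F.
Proof. by rewrite -[in RHS](range_set_val F) image_comp. Qed.

Let exhaustion : exists L : nat -> set X, [/\ forall k, compact (L k),
  forall k, L k `<=` U & U `<=` \bigcup_k L k].
Proof.
by have [M [cM MU _ UM]] := region_interior_exhaustion lcX rU; exists M.
Qed.

Lemma mazurkiewicz_wid : ~ weakly_infinite_dimensional R (set_type U) ->
  mazurkiewicz_manifold (weakly_infinite_dimensional R) (set_type U).
Proof.
move=> nU Y0 Y1 cY0 cY1 _ iY0 iY1 F [G cG FG] wF.
have [L [cL LU UL]] := exhaustion.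
have [k nk] : exists k, ~ negligible (@wid_valid R X) (@wid_res R X) (L k).
  apply: contrapT => /forallNP nL; apply: nU; apply: (wid_of_negligible cL LU UL).
  by move=> k; apply: contrapT; exact: nL.
apply: (mazurkiewicz_thin_pieces (G := G) homX lcX lconX rU) => //; first by rewrite FG.
move=> n Z cZ ZG; apply: (negligible_thin _ _ _ _ homX cZ _ (cL k) nk).
- exact: wid_res_open.
- exact: wid_res_glue.
- exact: wid_res_homeo.
- exact: wid_res_ex.
- apply: (wid_negligible (embF F)) => //; rewrite rangeF.
  apply: subset_trans ZG _; apply: image_subset; rewrite FG => y Gy.
  by exists n.
Qed.

Lemma mazurkiewicz_C_space : ~ C_space R (set_type U) ->
  mazurkiewicz_manifold (C_space R) (set_type U).
Proof.
move=> nU Y0 Y1 cY0 cY1 _ iY0 iY1 F [G cG FG] wF.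
have [L [cL LU UL]] := exhaustion.
have [k nk] : exists k, ~ negligible (@cover_valid R X) (@cover_res R X) (L k).
  apply: contrapT => /forallNP nL; apply: nU; apply: (C_space_of_negligible cL LU UL).
  by move=> k; apply: contrapT; exact: nL.
apply: (mazurkiewicz_thin_pieces (G := G) homX lcX lconX rU) => //; first by rewrite FG.
move=> n Z cZ ZG; apply: (negligible_thin _ _ _ _ homX cZ _ (cL k) nk).
- exact: cover_res_open.
- exact: cover_res_glue.
- exact: cover_res_homeo.
- exact: cover_res_ex.
- apply: (C_space_negligible (embF F)) => //; rewrite rangeF.
  apply: subset_trans ZG _; apply: image_subset; rewrite FG => y Gy.
  by exists n.
Qed.

Variable Ks : nat -> topologicalType.
Hypothesis strK : stratum R Ks.

Let hX := @metric_hausdorff _ X.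

Lemma absolute_extensor_compact_subset (Y : topologicalType) (j : Y -> X) (Z : set X) n :
  embedding j -> absolute_extensor (Ks n) Y -> compact Z -> Z `<=` range j ->
  Z !=set0 -> absolute_extensor (Ks n) (set_type Z).
Proof.
move=> ej aeY cZ Zj [z Zz]; have [y _ _] := Zj z Zz.
have [k0 _] := absolute_extensor_inhabited y aeY.
apply/(extensor_onP k0); first exact: compact_closed.
exact: extensor_on_subset Zj (absolute_extensor_embedding k0 ej aeY).
Qed.

Lemma dim_thin_subset (Y : topologicalType) (j : Y -> X) (Z B0 : set X) n :
  embedding j -> absolute_extensor (Ks n) Y -> compact Z -> Z `<=` range j ->
  compact B0 -> ~ absolute_extensor (Ks n.+1) (set_type B0) -> thin Z.
Proof.
move=> ej aeY cZ Zj cB0 nB0.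
have [->|/set0P Z0] := eqVneq Z set0; first exact: thin_set0.
have aeZ := absolute_extensor_compact_subset ej aeY cZ Zj Z0.
exact: (dim_thin strK homX cZ aeZ cB0 nB0).
Qed.

Lemma mazurkiewicz_stratum_dim_le (n : int) : stratum_dim Ks (set_type U) = n%:E ->
  mazurkiewicz_manifold (stratum_dim_le R Ks (n - 2)) (set_type U).
Proof.
move=> dimU Y0 Y1 cY0 cY1 _ iY0 iY1 F [G cG FG] [_ dF].
have [y0 _] := iY0.
apply: (mazurkiewicz_thin_pieces (G := G) homX lcX lconX rU) => //; first by rewrite FG.
move=> i Z cZ ZG.
have ZF : Z `<=` set_val @` F.
  by apply: subset_trans ZG _; apply: image_subset; rewrite FG => y Gy; exists i.
have [F0|[m [mn aem]]] := stratum_dim_le_ex dF.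
  rewrite (_ : Z = set0); first exact: thin_set0.
  apply/seteqP; split=> z // /ZF[y Fy _].
  by have : [set: set_type F] (SigSub (mem_set Fy)) by []; rewrite F0.
(* [m <= n - 2] gives [m + 1 < n], and [n] is the least index that is an extensor for [U]. *)
have nm1 : ~ absolute_extensor (Ks m.+1) (set_type U).
  by apply: (stratum_dim_eq y0 dimU); rewrite intS; lra.
have [B [cB nB]] : exists B : set X, compact B /\ ~ absolute_extensor (Ks m.+1) (set_type B).
  apply: contrapT => /forallNP nex; apply: nm1.
  have aeB (B : set X) : compact B -> B `<=` U -> absolute_extensor (Ks m.+1) (set_type B).
    by move=> cB _; apply: contrapT => nB; exact: (nex B).
  exact: (absolute_extensor_region lcX rU (set_valP y0) aeB).
apply: (dim_thin_subset (embF F) aem cZ _ cB nB).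
by rewrite rangeF.
Qed.

Lemma mazurkiewicz_strongly_countable_dim :
  ~ strongly_countable_dim R Ks (set_type U) ->
  mazurkiewicz_manifold (strongly_countable_dim R Ks) (set_type U).
Proof.
move=> nU Y0 Y1 cY0 cY1 _ iY0 iY1 F [G cG FG] [_ [E [cE EF dE]]].
have [L [cL LU UL]] := exhaustion.
(* If one [Ks m] were an extensor for all the [L k], these would exhibit [U] as strongly countable
   dimensional. The failing compactum thus may depend on [m]. *)
have bad m : exists k, ~ absolute_extensor (Ks m) (set_type (L k)).
  apply: contrapT => /forallNP nL; apply: nU; split; first exact: metrizable_set_type.
  exists (fun k => set_val @^-1` (L k)); split=> [k||k].
  - apply/(embedding_closed _ embU); exists (L k) => //; exact: compact_closed.
  - apply/seteqP; split=> y // _; have [k _ Ly] := UL _ (set_valP y).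
    by exists k.
  - apply/stratum_dim_lty.
    have [e0|/set0P[y _]] := eqVneq [set: set_type (set_val @^-1` L k : set (set_type U))] set0.
      by left.
    right; exists m; have aeL : absolute_extensor (Ks m) (set_type (L k)).
      by apply: contrapT; exact: nL.
    have Ly : L k (set_val (set_val y)) by exact: (set_valP y).
    have [k0 _] := @absolute_extensor_inhabited _ (set_type (L k)) (SigSub (mem_set Ly)) aeL.
    have rE : range ((set_val : set_type U -> X) \o
        (set_val : set_type (set_val @^-1` L k : set (set_type U)) -> set_type U)) = L k.
      rewrite rangeF; apply/seteqP; split=> [_ [z Lz <-]//|z Lz].
      by exists (SigSub (mem_set (LU _ _ Lz))).
    have clL : closed (L k) by exact: compact_closed.
    apply: (extensor_on_embedding k0 (embF _)); rewrite rE//.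
    exact/(extensor_onP k0).
(* [E m] is closed only in [F]; its intersection with [G i], a closed set contained in [F], is
   closed in [U]. *)
pose P n := let im := odflt (0%N, 0%N) (pickle_inv n) in G im.1 `&` set_val @` E im.2.
apply: (mazurkiewicz_thin_pieces (G := P) homX lcX lconX rU) => //.
- move=> n; rewrite /P; case: (odflt _ _) => [i m] /=.
  have [C cC EC] := (embedding_closed _ (embedding_set_val F)).1 (cE m).
  have -> : G i `&` set_val @` E m = G i `&` C.
    apply/seteqP; split=> y [Gy].
      move=> [x Ex xy]; split => //; rewrite -xy.
      suff : (set_val @^-1` C) x by [].
      by rewrite -EC.
    move=> Cy; split => //; have Fy : F y by rewrite FG; exists i.
    by exists (SigSub (mem_set Fy)) => //; rewrite EC.
  exact: closedI.
- move=> y Fy; have : [set: set_type F] (SigSub (mem_set Fy)) by [].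
  rewrite -EF => -[m _ Em]; have : F y by []; rewrite {1}FG => -[i _ Gy].
  exists (pickle (i, m)) => //; rewrite /P pickleK_inv; split => //.
  by exists (SigSub (mem_set Fy)).
- move=> n Z cZ; rewrite /P; case: (odflt _ _) => [i m] /= ZP.
  have embE : embedding ((set_val : set_type U -> X) \o
    (set_val : set_type F -> set_type U) \o (set_val : set_type (E m) -> set_type F)).
    exact: embedding_comp (embF F) (embedding_set_val (E m)).
  have ZE : Z `<=` range ((set_val : set_type U -> X) \o
      (set_val : set_type F -> set_type U) \o (set_val : set_type (E m) -> set_type F)).
    move=> z /ZP[_ [_ [y Ey <-]] <-].
    by exists (SigSub (mem_set Ey)).
  have [E0|[d aed]] := (stratum_dim_lty _ _).1 (dE m).
    rewrite (_ : Z = set0); first exact: thin_set0.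
    apply/seteqP; split=> z // /ZE[y _ _].
    by have : [set: set_type (E m)] y by []; rewrite E0.
  have [k nk] := bad d.+1.
  exact: (dim_thin_subset embE aed cZ ZE (cL k) nk).
Qed.

End classes.

Theorem theorem4 (R : realType) (K : nat -> topologicalType) (X : metricType R)
    (C : topologicalType -> Prop) (U : set X) :
  stratum R K ->
  homogeneous X -> locally_compact [set: X] -> locally_connected X ->
  [\/ C = weakly_infinite_dimensional R,
      C = C_space R,
      exists2 n : int, C = stratum_dim_le R K (n - 2) &
                       stratum_dim K (set_type U) = n%:E
    | C = strongly_countable_dim R K] ->
  region U -> ~ C (set_type U) ->
  mazurkiewicz_manifold C (set_type U).
Proof.
move=> strK homX lcX lconX [->|->|[n -> dimU]|->] rU nU.
- exact: mazurkiewicz_wid.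
- exact: mazurkiewicz_C_space.
- exact: mazurkiewicz_stratum_dim_le.
- exact: mazurkiewicz_strongly_countable_dim.
Qed.
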